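(* Let $I\subset\mathbb{R}$ be a bounded symmetric interval, let $Q\subset\mathbb{P}$ generate the integers $K$, and let $J$ be the integers generated by the primes not in $Q$. Then $$\mathcal{Z}_{K,I}=\zeta_J^{-1}(1)\,\mathrm{Id}+\Psi_{K,I}$$ for a compact operator $\Psi_{K,I}$ on $L^2(I)$. Moreover, the operator $\mathcal{Z}_{K,I}$ is bounded below on $L^2(I)$ if and only if $$\sum_{p\in\mathbb{P}\setminus Q}\frac1p<\infty.$$
   Context: $\mathbb{N}=\{1,2,3,\dots\}$ and $\mathbb{P}$ is the set of prime numbers. The integers generated by a set of primes $Q$ are the positive integers all of whose prime factors lie in $Q$ (including $1$). A bounded symmetric interval is $I=(-T,T)$ with $0<T<\infty$. For $K\subset\mathbb{N}$, $\zeta_K(s)=\sum_{n\in K}n^{-s}$, absolutely convergent for $\operatorname{Re}s>1$. $\zeta_J^{-1}(1)$ denotes $\lim_{\sigma\to1^+}1/\zeta_J(\sigma)$, which equals $0$ if $\zeta_J(\sigma)\to\infty$ as $\sigma\to1^+$. The operator $\mathcal{Z}_{K,I}:L^2(I)\to L^2(I)$ is defined by $$\mathcal{Z}_{K,I}g(t)=\lim_{\delta\to0^+}\frac{\chi_I(t)}{\pi}\int_I g(\tau)\operatorname{Re}\zeta_K(1+\delta+\mathrm{i}(t-\tau))\,\mathrm{d}\tau,$$ with the limit taken in $L^2(I)$ (this is a bounded operator on $L^2(I)$); $\chi_I$ is the characteristic function of $I$. An operator $T$ is bounded below on $L^2(I)$ if there is $c>0$ with $\|Tg\|\ge c\|g\|$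 for all $g\in L^2(I)$. *)

(* Defs.v *)
From HB Require Import structures.
From mathcomp Require Import all_boot all_order all_algebra.
From mathcomp Require Import all_classical all_reals all_analysis.
From mathcomp Require Import complex.

Set Implicit Arguments.
Unset Strict Implicit.
Unset Printing Implicit Defensive.

Import Order.TTheory GRing.Theory Num.Theory.
Import numFieldNormedType.Exports.

Local Open Scope classical_set_scope.
Local Open Scope ring_scope.
Local Open Scope complex_scope.

Definition primes_set : set nat := [set p | prime p].

Definition generated_integers (Q : set nat) : set nat :=
  [set n | (0 < n)%N /\ forall p : nat, prime p -> (p %| n)%N -> Q p].

Definition cexp (R : realType) (z : R[i]) : R[i] :=
  (expR (complex.Re z))%:C * (cos (complex.Im z) +i* sin (complex.Im z)).

Definition cnatpow (R : realType) (n : nat) (s : R[i]) : R[i] :=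
  cexp (s * (ln (n%:R : R))%:C).

(* [R[i]^o] is [R[i]] with the topology given by its norm. *)
Definition zeta (R : realType) (K : set nat) (s : R[i]) : R[i] :=
  limn (fun N : nat =>
    (\sum_(1 <= n < N.+1 | n \in K) cnatpow n (- s) : R[i]^o)).

Definition inv_zeta_at1 (R : realType) (J : set nat) : R[i] :=
  lim ((((zeta J (sigma%:C))^-1 : R[i]^o) @[sigma --> (1 : R)^'+])).

Definition sym_itv (R : realType) (T : R) : set R := `]- T, T[.

Definition cintegral (R : realType) (D : set R) (f : R -> R[i]) : R[i] :=
  Rintegral lebesgue_measure D (fun t => complex.Re (f t)) +i*
  Rintegral lebesgue_measure D (fun t => complex.Im (f t)).

(* Elements of the complex space L^2(-T, T) are handled through representatives
   [R -> R[i]], of which only the restriction to (-T, T) matters: equality of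
   classes is [L2eq], and [L2norm] is a seminorm on representatives. *)
Definition L2norm (R : realType) (T : R) (g : R -> R[i]) : \bar R :=
  Lnorm lebesgue_measure 2%:E
    ((fun t => (complex.Re `|g t|)%:E) \_ (sym_itv T)).

Definition L2 (R : realType) (T : R) : set (R -> R[i]) :=
  [set g | [/\ measurable_fun (sym_itv T) (fun t => complex.Re (g t)),
               measurable_fun (sym_itv T) (fun t => complex.Im (g t)) &
               (L2norm T g < +oo)%E]].

Definition L2eq (R : realType) (T : R) (g h : R -> R[i]) : Prop :=
  {ae (@lebesgue_measure R),
    forall t, sym_itv T t -> g t = h t}.

Definition L2_operator (R : realType) (T : R)
    (A : (R -> R[i]) -> (R -> R[i])) : Prop :=
  [/\ forall g, L2 T g -> L2 T (A g),
      forall g h, L2 T g -> L2 T h -> L2eq T g h -> L2eq T (A g) (A h) &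
      forall (a : R[i]) g h, L2 T g -> L2 T h ->
        L2eq T (A (fun t => a * g t + h t)) (fun t => a * A g t + A h t)].

Definition compact_operator (R : realType) (T : R)
    (A : (R -> R[i]) -> (R -> R[i])) : Prop :=
  L2_operator T A /\
  forall u : nat -> R -> R[i],
    (forall n, L2 T (u n)) ->
    (exists M : R, forall n, (L2norm T (u n) <= M%:E)%E) ->
    exists (phi : nat -> nat) (h : R -> R[i]),
      [/\ {homo phi : m n / (m < n)%N}, L2 T h &
          L2norm T (fun t => A (u (phi n)) t - h t) @[n --> \oo] --> 0%E].

Definition bounded_below (R : realType) (T : R)
    (A : (R -> R[i]) -> (R -> R[i])) : Prop :=
  exists2 c : R, 0 < c &
    forall g, L2 T g -> (c%:E * L2norm T g <= L2norm T (A g))%E.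

Definition zeta_op_delta (R : realType) (K : set nat) (T delta : R)
    (g : R -> R[i]) : R -> R[i] := fun t =>
  (\1_(sym_itv T) t / pi)%:C *
  cintegral (sym_itv T) (fun tau =>
    g tau * (complex.Re (zeta K ((1 + delta) +i* (t - tau))))%:C).

(* A representative of the limit of [zeta_op_delta K T delta g] in L^2(-T, T)
   as delta tends to 0 from the right (such a limit is unique up to [L2eq]);
   as for [lim], a default value is returned where there is no limit. *)
Definition zeta_op (R : realType) (K : set nat) (T : R)
    (g : R -> R[i]) : R -> R[i] :=
  xget (fun=> 0) [set h | L2 T h /\
    L2norm T (fun t => zeta_op_delta K T delta g t - h t)
      @[delta --> (0 : R)^'+] --> 0%E].

(* Main.v *)
Require Import Defs.
From HB Require Import structures.
From mathcomp Require Import all_boot all_order all_algebra.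
From mathcomp Require Import all_classical all_reals all_analysis.
From mathcomp Require Import measurable_realfun complex.
From mathcomp Require Import ring lra zify.

(** Why the theorem holds.  The kernel of the operator is real, so it acts
separately on the real and the imaginary part of a function, and everything
reduces to real functions on (-T, T).  Write c_y(t) = cos(y t) and
s_y(t) = sin(y t).  Expanding Re zeta_K as a Dirichlet series and using
cos(y(t - u)) = c_y(t) c_y(u) + s_y(t) s_y(u), the regularized operators become
pi^-1 times sums over n in K, with weights n^-delta / n, of the rank-two
operators v |-> <v,c_y> c_y + <v,s_y> s_y at y = log n; they converge strongly,
as delta tends to 0, to the same sum Z with the weights 1/n ([zeta_op_sum]).

Let d be the product of the 1 - 1/p over the primes p outside Q.  K consists of
the integers divisible by none of these primes, so d is its natural density,
and d > 0 exactly when the sum of the 1/p converges ([fully_sifted_density],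
[sift_density_gt0]).  Since zeta = zeta_K zeta_J and the density of K is seen by
zeta_K at 1, one also has 1 / zeta_J -> d at 1 ([inv_rzeta_cvg]).

Compactness ([sum_op1_compact]).  Cut the half-line into blocks of length eta.
As K has density d, far enough the points log n weighted by 1/n put a mass
d eta + O(eta^2) in every block ([log_wt_regular]).  Parseval's formula says
that on a lattice of step eta, with the mass eta at each point, the same sum of
operators is pi times the identity.  Moving all points of the far blocks to the
lattice costs O(eta) in operator norm, whatever their positions
([block_compare]), and what happens in the first blocks has finite rank.  Thus
Z - d pi Id is a limit of operators of finite rank, and the operator of the
theorem is d Id plus a compact one.

Lower bound ([zeta_sum_below]).  If d = 0 then Z is compact and cannot be
bounded below, the space being infinite dimensional.  If d > 0, then Z is
bounded below as soon as it is injective.  If Z v = 0, the functions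
y |-> <v,c_y> and y |-> <v,s_y> vanish at all log n, n in K.  They are of
exponential type T, and a set of positive density has so many logarithms that
such a function must vanish identically ([exp_uniqueness]); then v = 0 by
Parseval.

Vectors of L^2 are handled as functions rather than as classes; the abstract
part of the argument is therefore written in complete spaces with a positive
semi-definite inner product, where equality means that the difference has norm
zero. *)

Set Implicit Arguments.
Unset Strict Implicit.
Unset Printing Implicit Defensive.

Import Order.TTheory GRing.Theory Num.Theory.
Import numFieldNormedType.Exports.

Local Open Scope classical_set_scope.
Local Open Scope ring_scope.

(** * Complete semi-inner product spaces, Bessel families, compactness *)

(** The form may vanish on non-zero vectors: square integrable functions are not
identified when they agree almost everywhere. *)
HB.mixin Record isSemiHilbert (R : realType) V of GRing.Lmodule R V := {
  ip : V -> V -> R;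
  ipC : forall u v, ip u v = ip v u;
  ipDl : forall u v w, ip (u + v) w = ip u w + ip v w;
  ipZl : forall a u w, ip (a *: u) w = a * ip u w;
  ip_ge0 : forall u, 0 <= ip u u;
  semi_complete : forall u : nat -> V,
    (forall e, 0 < e -> exists N, forall m n, (N <= m)%N -> (N <= n)%N ->
       ip (u m - u n) (u m - u n) < e) ->
    exists l, ip (u n - l) (u n - l) @[n --> \oo] --> 0 }.

#[short(type="semiHilbertType")]
HB.structure Definition SemiHilbert (R : realType) :=
  {V of isSemiHilbert R V & GRing.Lmodule R V}.

Lemma incr_ge_id (phi : nat -> nat) : {homo phi : m n / (m < n)%N} -> forall n, (n <= phi n)%N.
Proof. by move=> phi_lt; elim=> // n IH; exact: leq_ltn_trans IH (phi_lt _ _ (ltnSn n)). Qed.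

Lemma incr_cvg (phi : nat -> nat) : {homo phi : m n / (m < n)%N} -> phi @ \oo --> \oo.
Proof.
move=> phi_lt P [N _ NP]; exists N => // n /= Nn; apply: NP => /=.
exact: leq_trans Nn (incr_ge_id phi_lt n).
Qed.

Section SemiHilbertTheory.
Context {R : realType} {V : semiHilbertType R}.
Implicit Types u v w : V.

Lemma ipDr u v w : ip u (v + w) = ip u v + ip u w.
Proof. by rewrite ipC ipDl !(ipC u). Qed.
Lemma ipZr a u w : ip u (a *: w) = a * ip u w.
Proof. by rewrite ipC ipZl ipC. Qed.
Lemma ip0l w : ip 0 w = 0.
Proof. by rewrite -(scale0r 0) ipZl mul0r. Qed.
Lemma ip0r w : ip w 0 = 0.
Proof. by rewrite ipC ip0l. Qed.
Lemma ipNl u w : ip (- u) w = - ip u w.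
Proof. by rewrite -scaleN1r ipZl mulN1r. Qed.
Lemma ipNr u w : ip w (- u) = - ip w u.
Proof. by rewrite ipC ipNl ipC. Qed.
Lemma ipBl u v w : ip (u - v) w = ip u w - ip v w.
Proof. by rewrite ipDl ipNl. Qed.
Lemma ipBr u v w : ip u (v - w) = ip u v - ip u w.
Proof. by rewrite ipDr ipNr. Qed.

Lemma ip_suml I (r : seq I) (P : pred I) (F : I -> V) w :
  ip (\sum_(i <- r | P i) F i) w = \sum_(i <- r | P i) ip (F i) w.
Proof.
by apply: (big_morph (ip^~ w)) => [x y|]; rewrite ?ipDl ?ip0l.
Qed.

Lemma ip_sumr I (r : seq I) (P : pred I) (F : I -> V) w :
  ip w (\sum_(i <- r | P i) F i) = \sum_(i <- r | P i) ip w (F i).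
Proof. by rewrite ipC ip_suml; apply: eq_bigr => i _; rewrite ipC. Qed.

Definition nrm v : R := Num.sqrt (ip v v).

Lemma nrm_ge0 v : 0 <= nrm v. Proof. exact: sqrtr_ge0. Qed.
Lemma sqr_nrm v : nrm v ^+ 2 = ip v v. Proof. by rewrite sqr_sqrtr// ip_ge0. Qed.
Lemma nrm0 : nrm 0 = 0. Proof. by rewrite /nrm ip0l sqrtr0. Qed.
Lemma nrmN v : nrm (- v) = nrm v.
Proof. by rewrite /nrm ipNl ipNr opprK. Qed.
Lemma nrmB u v : nrm (u - v) = nrm (v - u).
Proof. by rewrite -nrmN opprB. Qed.
Lemma nrmZ a v : nrm (a *: v) = `|a| * nrm v.
Proof. by rewrite /nrm ipZl ipZr mulrA -expr2 sqrtrM ?sqr_ge0// sqrtr_sqr. Qed.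

Lemma cauchy_schwarz_sqr u v : ip u v ^+ 2 <= ip u u * ip v v.
Proof.
have [v0|v0] := eqVneq (ip v v) 0.
  rewrite v0 mulr0.
  have [->|uv0] := eqVneq (ip u v) 0; first by rewrite expr0n.
  (* with this multiple of v, of norm zero, the square would be -1 *)
  have := ip_ge0 (u - ((ip u u + 1) / (2 * ip u v)) *: v).
  rewrite ipBl !ipBr !ipZl !ipZr v0 !(ipC v u).
  set t := _ / _.
  have -> : t * ip u v = (ip u u + 1) / 2 by rewrite /t; field.
  lra.
have vp : 0 < ip v v by rewrite lt_def v0 ip_ge0.
rewrite -(ler_pM2r vp).
have := ip_ge0 (ip v v *: u - ip u v *: v).
rewrite ipBl !ipBr !ipZl !ipZr !(ipC v u).
nra.
Qed.

Lemma cauchy_schwarz u v : `|ip u v| <= nrm u * nrm v.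
Proof.
rewrite -ler_sqr ?nnegrE ?mulr_ge0 ?nrm_ge0//.
by rewrite exprMn !sqr_nrm real_normK ?num_real// cauchy_schwarz_sqr.
Qed.

Lemma ler_nrmD u v : nrm (u + v) <= nrm u + nrm v.
Proof.
rewrite -ler_sqr ?nnegrE ?addr_ge0 ?nrm_ge0//.
rewrite sqrrD !sqr_nrm ipDl !ipDr (ipC v u).
have := cauchy_schwarz u v; have := ler_norm (ip u v); lra.
Qed.

Lemma ler_nrm_dist u v w : nrm (u - w) <= nrm (u - v) + nrm (v - w).
Proof. by apply: le_trans (ler_nrmD _ _); rewrite addrA subrK. Qed.

Lemma ler_nrm_sum I (r : seq I) (P : pred I) (F : I -> V) :
  nrm (\sum_(i <- r | P i) F i) <= \sum_(i <- r | P i) nrm (F i).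
Proof.
elim/big_ind2 : _ => [|x a y b xa yb|//]; first by rewrite nrm0.
by apply: le_trans (ler_nrmD _ _) (lerD xa yb).
Qed.

Lemma nrm_eq0_ip u w : nrm u = 0 -> ip u w = 0.
Proof.
move=> u0; apply/eqP; rewrite -normr_le0.
by have := cauchy_schwarz u w; rewrite u0 mul0r.
Qed.

Definition scvg (u : nat -> V) (l : V) := nrm (u n - l) @[n --> \oo] --> 0.

Lemma nrm_complete (u : nat -> V) :
    (forall e, 0 < e -> exists N, forall m n, (N <= m)%N -> (N <= n)%N ->
       nrm (u m - u n) <= e) ->
  exists l, scvg u l.
Proof.
move=> uC; have [|l ul] := @semi_complete R V u.
  move=> e e0.
  have e2 : 0 < Num.sqrt e / 2 by rewrite divr_gt0// sqrtr_gt0.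
  have [N uN] := uC _ e2; exists N => m n Nm Nn.
  rewrite -sqr_nrm; have := uN m n Nm Nn; have := nrm_ge0 (u m - u n).
  have := sqr_sqrtr (ltW e0); nra.
exists l; rewrite /scvg /nrm.
rewrite -[X in _ --> X]sqrtr0; apply: continuous_cvg ul.
exact: sqrt_continuous.
Qed.

Lemma scvgP (u : nat -> V) l : scvg u l <->
  forall e, 0 < e -> \forall n \near \oo, nrm (u n - l) <= e.
Proof.
split=> [ul e e0|ul].
  have /cvgrPdist_le/(_ _ e0) := ul; apply: filterS => n.
  by rewrite sub0r normrN ger0_norm// nrm_ge0.
apply/cvgrPdist_le => e e0; apply: filterS (ul _ e0) => n.
by rewrite sub0r normrN ger0_norm// nrm_ge0.
Qed.

Lemma scvgD (u v : nat -> V) l m : scvg u l -> scvg v m ->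
  scvg (fun n => u n + v n) (l + m).
Proof.
move=> ul vm; apply/scvgP => e e0.
have e2 : 0 < e / 2 by rewrite divr_gt0.
near=> n; have -> : u n + v n - (l + m) = (u n - l) + (v n - m).
  by rewrite opprD addrACA.
rewrite (le_trans (ler_nrmD _ _))// [e]splitr lerD//; near: n.
- by move/scvgP: ul; apply.
- by move/scvgP: vm; apply.
Unshelve. all: by end_near. Qed.

Lemma scvgZ a (u : nat -> V) l : scvg u l -> scvg (fun n => a *: u n) (a *: l).
Proof.
move=> ul; rewrite /scvg.
under eq_fun do rewrite -scalerBr nrmZ.
by rewrite -[0](mulr0 `|a|); exact: cvgMl_tmp.
Qed.

Lemma scvg_ip (u : nat -> V) l w : scvg u l -> ip (u n) w @[n --> \oo] --> ip l w.
Proof.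
move=> /scvgP ul; apply/cvgrPdist_le => e e0.
have e2 : 0 < e / (nrm w + 1) by rewrite divr_gt0// ltr_wpDl// nrm_ge0.
apply: filterS (ul _ e2) => n uln.
rewrite distrC -ipBl (le_trans (cauchy_schwarz _ _))//.
have w0 := nrm_ge0 w.
apply: le_trans (_ : e / (nrm w + 1) * (nrm w + 1) <= e); last first.
  by rewrite mulfVK// gt_eqF// ltr_wpDl.
by rewrite ler_pM// ?nrm_ge0// lerDl.
Qed.

Lemma scvg_uniq (u : nat -> V) l m : scvg u l -> scvg u m -> nrm (l - m) = 0.
Proof.
move=> /scvgP ul /scvgP um; apply/eqP; rewrite eq_le nrm_ge0 andbT.
apply/ler_addgt0Pl => e e0; rewrite addr0.
have e2 : 0 < e / 2 by rewrite divr_gt0.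
near \oo => n.
rewrite (le_trans (ler_nrm_dist _ (u n) _))// [e]splitr lerD//.
  by rewrite nrmB; near: n; exact: ul.
by near: n; exact: um.
Unshelve. all: by end_near. Qed.

Lemma scvg_nrm (u : nat -> V) l C : scvg u l -> (forall n, nrm (u n) <= C) ->
  nrm l <= C.
Proof.
move=> /scvgP ul uC; apply/ler_addgt0Pl => e e0.
near \oo => n.
rewrite -[l](subrK (u n)) (le_trans (ler_nrmD _ _))// lerD// nrmB.
by near: n; exact: ul.
Unshelve. all: by end_near. Qed.

Definition bessel (C : R) (x : nat -> V) :=
  forall n v, \sum_(0 <= i < n) ip v (x i) ^+ 2 <= C * ip v v.

Section Bessel.
Variables (C : R) (x : nat -> V).
Hypotheses (C0 : 0 < C) (xC : bessel C x).

Lemma bessel_range m n v : \sum_(m <= i < n) ip v (x i) ^+ 2 <= C * ip v v.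
Proof.
apply: le_trans (xC n v).
have [mn|nm] := leqP m n; last first.
  by rewrite big_geq ?(ltnW nm)// sumr_ge0// => i _; rewrite sqr_ge0.
rewrite (@big_cat_nat _ _ _ m 0 n)//= lerDr.
by rewrite sumr_ge0// => i _; rewrite sqr_ge0.
Qed.

(** By duality with the Bessel inequality: expand the square of the norm of
C a_i - <S,x_i>. *)
Lemma synthesis_le (a : nat -> R) m n :
  ip (\sum_(m <= i < n) a i *: x i) (\sum_(m <= i < n) a i *: x i)
    <= C * \sum_(m <= i < n) a i ^+ 2.
Proof.
set S := \sum_(m <= i < n) a i *: x i.
have SE : ip S S = \sum_(m <= i < n) a i * ip S (x i).
  by rewrite {1}/S ip_suml; apply: eq_bigr => i _; rewrite ipZl ipC.
have : 2 * C * ip S S <= C ^+ 2 * \sum_(m <= i < n) a i ^+ 2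
                         + \sum_(m <= i < n) ip S (x i) ^+ 2.
  rewrite {1}SE !mulr_sumr -big_split/= ler_sum// => i _.
  by have := sqr_ge0 (C * a i - ip S (x i)); nra.
move=> aS; rewrite -(ler_pM2l C0); have := bessel_range m n S; lra.
Qed.

Lemma bessel_series_cauchy v e : 0 < e -> exists N, forall m n, (N <= m)%N ->
  \sum_(m <= i < n) ip v (x i) ^+ 2 <= e.
Proof.
move=> e0; pose f i := ip v (x i) ^+ 2.
have fc : cvgn (fun n => \sum_(0 <= i < n) f i).
  apply: nondecreasing_is_cvgn; last first.
    by exists (C * ip v v) => _ [n _ <-]; exact: xC.
  move=> m n mn; rewrite (@big_cat_nat _ _ _ m 0 n)//= lerDl.
  by rewrite sumr_ge0// => i _; rewrite sqr_ge0.
have e2 : 0 < e / 2 by rewrite divr_gt0.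
have /cvgrPdist_le/(_ _ e2)[N _ NP] := fc.
exists N => m n Nm; have [nm|mn] := leqP n m; first by rewrite big_geq// ltW.
have -> : \sum_(m <= i < n) f i = \sum_(0 <= i < n) f i - \sum_(0 <= i < m) f i.
  by rewrite (@big_cat_nat _ _ _ m 0 n)//= 1?ltnW// addrC addrK.
have := NP m Nm; have := NP n (leq_trans Nm (ltnW mn)); rewrite /= !ler_norml.
lra.
Qed.

Definition frame_part (w : nat -> R) v n := \sum_(0 <= i < n) (w i * ip v (x i)) *: x i.

(** The partial sums have no canonical limit in a space where limits are only
unique up to vectors of norm zero, hence the choice. *)
Definition frame_op (w : nat -> R) v : V := xget 0 [set z | scvg (frame_part w v) z].

Lemma frame_opP (w : nat -> R) v : (forall i, 0 <= w i <= 1) ->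
  scvg (frame_part w v) (frame_op w v).
Proof.
move=> w1; suff [l fl] : exists l, scvg (frame_part w v) l.
  by rewrite /frame_op; case: xgetP => [z _//|/(_ l)]; exact.
apply: nrm_complete => e e0.
have e2 : 0 < e ^+ 2 / C by rewrite divr_gt0// exprn_gt0.
have [N NP] := bessel_series_cauchy v e2.
suff H m n : (N <= m)%N -> (m <= n)%N ->
    nrm (frame_part w v n - frame_part w v m) <= e.
  exists N => m n Nm Nn; have [nm|mn] := leqP n m; first exact: H.
  by rewrite nrmB H// ltnW.
move=> Nm mn; rewrite -ler_sqr ?nnegrE ?nrm_ge0 ?(ltW e0)//.
rewrite /frame_part (@big_cat_nat _ _ _ m 0 n)//= addrAC subrr add0r sqr_nrm.
apply: le_trans (synthesis_le (fun i => w i * ip v (x i)) m n) _.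
rewrite mulrC -ler_pdivlMr// (le_trans _ (NP m n Nm))//.
rewrite ler_sum// => i _; have /andP[w0 wi1] := w1 i.
rewrite exprMn ler_piMl ?sqr_ge0//.
by rewrite expr_le1.
Qed.

Lemma frame_op_ip (w : nat -> R) v z : (forall i, 0 <= w i <= 1) ->
  \sum_(0 <= i < n) w i * ip v (x i) * ip z (x i) @[n --> \oo]
    --> ip (frame_op w v) z.
Proof.
move=> w1; have := @scvg_ip _ _ z (frame_opP v w1).
apply: cvg_trans; apply: near_eq_cvg; near=> n.
rewrite /frame_part ip_suml; apply: eq_bigr => i _.
by rewrite ipZl (ipC z).
Unshelve. all: by end_near. Qed.

Lemma frame_op_linear (w : nat -> R) a u v : (forall i, 0 <= w i <= 1) ->
  nrm (frame_op w (a *: u + v) - (a *: frame_op w u + frame_op w v)) = 0.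
Proof.
move=> w1; apply: (@scvg_uniq (frame_part w (a *: u + v))).
  exact: frame_opP.
have := scvgD (scvgZ a (frame_opP u w1)) (frame_opP v w1).
rewrite /scvg; apply: cvg_trans; apply: near_eq_cvg; near=> n.
congr (nrm (_ - _)); rewrite /frame_part scaler_sumr -big_split/=.
apply: eq_bigr => i _; rewrite scalerA -scalerDl ipDl ipZl.
by congr (_ *: _); ring.
Unshelve. all: by end_near. Qed.

Lemma nrm_frame_op (w : nat -> R) v : (forall i, 0 <= w i <= 1) ->
  nrm (frame_op w v) <= C * nrm v.
Proof.
move=> w1; apply: scvg_nrm (frame_opP v w1) _ => n.
rewrite -ler_sqr ?nnegrE ?mulr_ge0 ?nrm_ge0 ?(ltW C0)// exprMn !sqr_nrm.
apply: le_trans (synthesis_le (fun i => w i * ip v (x i)) 0 n) _.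
rewrite expr2 -mulrA.
rewrite ler_pM2l// (le_trans _ (xC n v))//.
rewrite ler_sum// => i _; have /andP[w0 wi1] := w1 i.
by rewrite exprMn ler_piMl ?sqr_ge0// expr_le1.
Qed.

(** Strong convergence: the tail of the Bessel series of v is small uniformly in
the weights, and the finitely many other weights converge. *)
Lemma frame_op_cvg (D : Type) (F : set_system D) {FF : ProperFilter F}
    (W : D -> nat -> R) v :
  (\forall d \near F, forall i, 0 <= W d i <= 1) ->
  (forall i, W d i @[d --> F] --> (1 : R)) ->
  nrm (frame_op (W d) v - frame_op (fun=> 1) v) @[d --> F] --> 0.
Proof.
move=> W01 W1; apply/cvgrPdist_le => e e0.
have e2 : 0 < e / 2 by rewrite divr_gt0.
have eC : 0 < e ^+ 2 / (2 * C) by rewrite divr_gt0 ?exprn_gt0// mulr_gt0.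
have [N NP] := bessel_series_cauchy v eC.
have : \sum_(0 <= i < N) (W d i - 1) ^+ 2 * ip v (x i) ^+ 2 @[d --> F]
     --> \sum_(0 <= i < N) (1 - 1) ^+ 2 * ip v (x i) ^+ 2.
  apply: (cvg_big (op := +%R)) => [|i _]; first exact: add_continuous.
  apply: cvgMr_tmp; rewrite !expr2.
  by apply: cvgM; apply: cvgB => //; exact: cvg_cst.
under [X in _ --> X]eq_bigr do rewrite subrr expr0n mul0r.
rewrite big1// => /cvgrPdist_le/(_ _ eC) Wlim.
near=> d.
have Wd : forall i, 0 <= W d i <= 1 by near: d.
have Wlimd : `|0 - \sum_(0 <= i < N) (W d i - 1) ^+ 2 * ip v (x i) ^+ 2|
    <= e ^+ 2 / (2 * C) by near: d.
rewrite sub0r normrN ger0_norm ?nrm_ge0//.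
have w01 (i : nat) : 0 <= (1 : R) <= 1 by rewrite ler01 lexx.
have scd := scvgD (frame_opP v Wd) (scvgZ (-1) (frame_opP v w01)).
rewrite !scaleN1r in scd.
apply: scvg_nrm scd _ => n.
rewrite scaleN1r /frame_part -sumrN -big_split/=.
rewrite (eq_bigr (fun i => ((W d i - 1) * ip v (x i)) *: x i)); last first.
  by move=> i _; rewrite -scaleNr -scalerDl; congr (_ *: _); ring.
rewrite -ler_sqr ?nnegrE ?nrm_ge0 ?(ltW e0)//.
rewrite sqr_nrm.
apply: le_trans (synthesis_le (fun i => (W d i - 1) * ip v (x i)) 0 n) _.
rewrite mulrC -ler_pdivlMr//.
have -> : e ^+ 2 / C = e ^+ 2 / (2 * C) + e ^+ 2 / (2 * C).
  by field; rewrite gt_eqF.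
pose G i := (W d i - 1) ^+ 2 * ip v (x i) ^+ 2.
have G0 i : 0 <= G i by rewrite mulr_ge0// sqr_ge0.
have GW i : G i <= ip v (x i) ^+ 2.
  rewrite /G ler_piMl ?sqr_ge0//; have := Wd i; clear; nra.
have GN : \sum_(0 <= i < N) G i <= e ^+ 2 / (2 * C).
  have SG : 0 <= \sum_(0 <= i < N) G i by apply: sumr_ge0.
  by move: Wlimd; rewrite sub0r normrN (ger0_norm SG).
apply: le_trans (_ : \sum_(0 <= i < maxn N n) G i <= _).
  rewrite (eq_bigr G); last by move=> i _; rewrite exprMn.
  rewrite (@big_cat_nat _ _ _ n 0 (maxn N n))//= ?leq_maxr//.
  by rewrite lerDl sumr_ge0.
rewrite (@big_cat_nat _ _ _ N 0 (maxn N n))//= ?leq_maxl//.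
rewrite lerD// (le_trans _ (NP N (maxn N n) (leqnn _)))//.
exact: ler_sum.
Unshelve. all: by end_near. Qed.

End Bessel.

Lemma ultra_fmap (S S' : Type) (f : S -> S') (U : set_system S) :
  UltraFilter U -> UltraFilter (f @ U).
Proof.
move=> UU; split => [|G GP fG]; first exact: fmap_proper_filter.
rewrite eqEsubset; split=> // A GA.
have [//|nA] := in_ultra_setVsetC (f @^-1` A) UU.
have /fG GnA : (f @ U) (~` A) by [].
by have [x []] := filter_ex (@filterI _ G _ _ _ GA GnA).
Qed.

Definition seq_compact (A : V -> V) := forall u : nat -> V,
  (exists M, forall n, nrm (u n) <= M) ->
  exists (phi : nat -> nat) (h : V),
    {homo phi : m n / (m < n)%N} /\ scvg (fun n => A (u (phi n))) h.

Definition finite_rank (F : V -> V) := exists m (x y : nat -> V),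
  forall v, F v = \sum_(0 <= i < m) ip v (x i) *: y i.

Lemma finite_rank0 : finite_rank (fun=> 0).
Proof. by exists 0%N, (fun=> 0), (fun=> 0) => v; rewrite big_geq. Qed.

Lemma finite_rank1 x y : finite_rank (fun v => ip v x *: y).
Proof. by exists 1%N, (fun=> x), (fun=> y) => v; rewrite big_nat1. Qed.

Lemma finite_rankD F G : finite_rank F -> finite_rank G ->
  finite_rank (fun v => F v + G v).
Proof.
move=> [m [x [y Fxy]]] [m' [x' [y' Gxy]]].
exists (m + m')%N, (fun i => if (i < m)%N then x i else x' (i - m)%N),
  (fun i => if (i < m)%N then y i else y' (i - m)%N) => v.
rewrite (@big_cat_nat _ _ _ m)/= ?leq_addr// Fxy Gxy; congr (_ + _).
  by apply: eq_big_nat => i /andP[_ ->].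
symmetry; rewrite -[X in \sum_(X <= _ < _) _]add0n big_addn addKn.
by apply: eq_bigr => i _; rewrite ltnNge leq_addl/= addnK.
Qed.

Lemma finite_rankZ a F : finite_rank F -> finite_rank (fun v => a *: F v).
Proof.
move=> [m [x [y Fxy]]]; exists m, x, (fun i => a *: y i) => v.
by rewrite Fxy scaler_sumr; apply: eq_bigr => i _; rewrite !scalerA mulrC.
Qed.

Lemma finite_rank_sum (r : seq nat) (F : nat -> V -> V) :
  (forall i, finite_rank (F i)) -> finite_rank (fun v => \sum_(i <- r) F i v).
Proof.
move=> FF; elim: r => [|i r IHr].
  have -> : (fun v => \sum_(i <- [::]) F i v) = fun=> 0.
    by apply/funext => v; rewrite big_nil.
  exact: finite_rank0.
have -> : (fun v => \sum_(j <- i :: r) F j v) =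
    fun v => F i v + \sum_(j <- r) F j v.
  by apply/funext => v; rewrite big_cons.
exact: finite_rankD.
Qed.

(** An ultrafilter containing the neighbourhoods of infinity gives a limit to all
the bounded sequences <u_n,x> at once, so that the images under the
approximating operators are Cauchy along it; this replaces the extraction of
diagonal subsequences. *)
Lemma approx_seq_compact (A : V -> V) :
  (forall e, 0 < e -> exists2 F, finite_rank F &
     forall v, nrm (A v - F v) <= e * nrm v) ->
  seq_compact A.
Proof.
move=> approxA u [M uM].
have M0 : 0 <= M by apply: le_trans (uM 0%N); exact: nrm_ge0.
have [U [UU ooU]] := @ultraFilterLemma nat \oo _.
have Uip x : exists l : R, ip (u n) x @[n --> U] --> l.
  have := @segment_compact R (- (M * nrm x)) (M * nrm x).
  rewrite compact_ultra => /(_ ((fun n => ip (u n) x) @ U)) [||l [_ ul]].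
  - exact: ultra_fmap.
  - apply: (@filterE _ U) => n /=; rewrite in_itv/= -ler_norml.
    by rewrite (le_trans (cauchy_schwarz _ _))// ler_wpM2r ?nrm_ge0.
  - by exists l.
have Ucauchy e : 0 < e -> exists2 E, U E &
    forall k l, E k -> E l -> nrm (A (u k) - A (u l)) <= e.
  move=> e0.
  have eM : 0 < e / (3 * (M + 1)) by rewrite divr_gt0// mulr_gt0// ltr_wpDl.
  have [F0 [m [x [y F0E]]] Axy] := approxA _ eM.
  pose Y := \sum_(0 <= i < m) nrm (y i).
  have Y0 : 0 <= Y by rewrite sumr_ge0// => i _; exact: nrm_ge0.
  have eY : 0 < e / (6 * (Y + 1)) by rewrite divr_gt0// mulr_gt0// ltr_wpDl.
  have [l ul] := choice Uip.
  exists [set k | forall i : 'I_m, `|ip (u k) (x i) - l (x i)| <= e / (6 * (Y + 1))].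
    apply: filter_forall => i; have /cvgrPdist_le/(_ _ eY) := ul (x i).
    by apply: filterS => k; rewrite distrC.
  move=> k k' Ek Ek'.
  pose F v := \sum_(0 <= i < m) ip v (x i) *: y i.
  have {F0E} F0E : F0 = F by apply/funext.
  rewrite F0E in Axy.
  have AF n : nrm (A (u n) - F (u n)) <= e / 3.
    apply: le_trans (Axy (u n)) _.
    apply: le_trans (_ : e / (3 * (M + 1)) * (M + 1) <= _).
      by rewrite ler_wpM2l ?(ltW eM)// (le_trans (uM n))// lerDl.
    rewrite le_eqVlt; apply/orP; left; apply/eqP; field.
    by rewrite gt_eqF// ltr_wpDl.
  have FF : nrm (F (u k) - F (u k')) <= e / 3.
    rewrite /F -sumrB; apply: le_trans (ler_nrm_sum _ _ _) _.
    apply: le_trans (_ : \sum_(0 <= i < m) (e / (3 * (Y + 1))) * nrm (y i) <= _).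
      rewrite !big_mkord; apply: ler_sum => i _.
      rewrite -scalerBl nrmZ ler_wpM2r ?nrm_ge0//.
      have -> : ip (u k) (x i) - ip (u k') (x i) =
        (ip (u k) (x i) - l (x i)) - (ip (u k') (x i) - l (x i)) by ring.
      rewrite (le_trans (ler_normB _ _))//.
      have -> : e / (3 * (Y + 1)) = e / (6 * (Y + 1)) + e / (6 * (Y + 1)).
        by field; rewrite gt_eqF// ltr_wpDl.
      by rewrite lerD.
    rewrite -mulr_sumr -/Y.
    apply: le_trans (_ : e / (3 * (Y + 1)) * (Y + 1) <= _).
      by rewrite ler_wpM2l ?lerDl// divr_ge0 ?mulr_ge0 ?addr_ge0// ltW.
    rewrite le_eqVlt; apply/orP; left; apply/eqP; field.
    by rewrite gt_eqF// ltr_wpDl.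
  have -> : A (u k) - A (u k') = (A (u k) - F (u k)) + (F (u k) - F (u k'))
       + (F (u k') - A (u k')) by rewrite !addrA !subrK.
  have -> : e = e / 3 + e / 3 + e / 3 by field.
  rewrite (le_trans (ler_nrmD _ _))// lerD//; last by rewrite nrmB.
  by rewrite (le_trans (ler_nrmD _ _))// lerD.
(* phi n is chosen in the n-th of countably many sets of the ultrafilter *)
have Einv n : exists E : set nat, U E /\
    forall k l, E k -> E l -> nrm (A (u k) - A (u l)) <= n.+1%:R^-1.
  by have [//|E UE EE] := Ucauchy n.+1%:R^-1; exists E.
have [E EP] := choice Einv.
have step n N : exists k, (N < k)%N /\ forall i, (i <= n)%N -> E i k.
  have : U ([set k | (N < k)%N] `&` [set k | forall i : 'I_n.+1, E i k]).
    apply: filterI; first by apply: ooU; exact: nbhs_infty_gt.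
    by apply: filter_forall => i; exact: (EP i).1.
  move=> /filter_ex[k [Nk Ek]]; exists k; split=> // i ni.
  exact: (Ek (Ordinal (ni : (i < n.+1)%N))).
have [nxt nxtP] := choice (fun p : nat * nat => step p.1 p.2).
pose phi := fix phi n := if n is n'.+1 then nxt (n, phi n') else nxt (0%N, 0%N).
have phiE n i : (i <= n)%N -> E i (phi n).
  by case: n => [|n] /=; exact: (nxtP (_, _)).2.
have phi_lt n : (phi n < phi n.+1)%N by exact: (nxtP (_, _)).1.
have phi_homo : {homo phi : m n / (m < n)%N}.
  by apply: homo_ltn => //; exact: ltn_trans.
suff [h hP] : exists h, scvg (fun n => A (u (phi n))) h by exists phi, h.
apply: nrm_complete => e e0.
exists (Num.truncn e^-1) => m n Nm Nn.
apply: le_trans ((EP (Num.truncn e^-1)).2 _ _ (phiE _ _ Nm) (phiE _ _ Nn)) _.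
by rewrite invf_ple ?posrE// ltW// truncnS_gt.
Qed.

End SemiHilbertTheory.

Section NullRelation.
Context {R : realType} {V : semiHilbertType R}.
Implicit Types (x y z : V).

Definition null_eq x y := nrm (x - y) = 0.

Lemma null_refl x : null_eq x x.
Proof. by rewrite /null_eq subrr nrm0. Qed.

Lemma null_sym x y : null_eq x y -> null_eq y x.
Proof. by rewrite /null_eq nrmB. Qed.

Lemma null_trans y x z : null_eq x y -> null_eq y z -> null_eq x z.
Proof.
rewrite /null_eq => xy yz; apply/eqP; rewrite eq_le nrm_ge0 andbT.
by have := ler_nrm_dist x y z; rewrite xy yz addr0.
Qed.

Lemma null_add x y x' y' : null_eq x x' -> null_eq y y' -> null_eq (x + y) (x' + y').
Proof.
rewrite /null_eq => xx yy; apply/eqP; rewrite eq_le nrm_ge0 andbT.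
by rewrite opprD addrACA (le_trans (ler_nrmD _ _))// xx yy addr0.
Qed.

Lemma null_scale k x y : null_eq x y -> null_eq (k *: x) (k *: y).
Proof. by rewrite /null_eq -scalerBr nrmZ => ->; rewrite mulr0. Qed.

Lemma null_nrm x y : null_eq x y -> nrm x = nrm y.
Proof.
rewrite /null_eq => xy; apply/eqP; rewrite eq_le.
have := ler_nrmD (x - y) y; have := ler_nrmD (y - x) x.
by rewrite !subrK nrmB xy !add0r => -> ->.
Qed.

Lemma null_dist x y z : null_eq x y -> nrm (x - z) = nrm (y - z).
Proof. by move=> xy; apply: null_nrm; apply: null_add => //; exact: null_refl. Qed.

End NullRelation.

(** * Almost orthogonality of exponentials taken in the blocks of a lattice *)

(** What the argument uses of the functions c_y = cos(y t), s_y = sin(y t) on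
(-T, T): bounds, the derivatives in y, where [mt] is the multiplication by t, and
Parseval's formula for all steps eta <= pi / T.  The term j = 0 of a cosine series
has the weight 1/2. *)
Record exp_system (R : realType) (V : semiHilbertType R) (T : R)
    (c s : R -> V) (mt : V -> V) : Prop := ExpSystem {
  es_T0 : 0 < T;
  es_mt : forall v, nrm (mt v) <= T * nrm v;
  es_c : forall y, ip (c y) (c y) <= 2 * T;
  es_s : forall y, ip (s y) (s y) <= 2 * T;
  es_dc : forall v y, is_derive y (1 : R) (fun y => ip v (c y)) (- ip (mt v) (s y));
  es_ds : forall v y, is_derive y (1 : R) (fun y => ip v (s y)) (ip (mt v) (c y));
  es_parseval : forall v eta, 0 < eta -> eta * T <= pi ->
    \sum_(0 <= j < n) (if j == 0%N then 2^-1 else 1) *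
       (ip v (c (eta * j%:R)) ^+ 2 + ip v (s (eta * j%:R)) ^+ 2) @[n --> \oo]
      --> pi / eta * ip v v }.

Section ExpSystem.
Context {R : realType} {V : semiHilbertType R}.
Variables (T : R) (c s : R -> V) (mt : V -> V).
Hypothesis ES : exp_system T c s mt.
Implicit Types (v w : V) (y eta : R).

Let T0 : 0 < T := es_T0 ES.

(** The real part of the product of one Fourier transform with the conjugate of
another, at the frequency y. *)
Definition hat_prod v w y := ip v (c y) * ip w (c y) + ip v (s y) * ip w (s y).

Lemma hat_prod_ge0 v y : 0 <= hat_prod v v y.
Proof. by rewrite addr_ge0// -expr2 sqr_ge0. Qed.

Lemma hat_prodD v w y : hat_prod (v + w) (v + w) y =
  hat_prod v v y + hat_prod w w y + 2 * hat_prod v w y.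
Proof. by rewrite /hat_prod !ipDl; ring. Qed.

Definition lattice_wt (j : nat) : R := if j == 0%N then 2^-1 else 1.

Lemma lattice_wt_ge0 j : 0 <= lattice_wt j. Proof. by rewrite /lattice_wt; case: ifP. Qed.

Lemma parseval_sqr v eta : 0 < eta -> eta * T <= pi ->
  \sum_(0 <= j < n) lattice_wt j * hat_prod v v (eta * j%:R) @[n --> \oo]
      --> pi / eta * ip v v.
Proof. by move=> e0 eT; exact: (es_parseval ES). Qed.

Lemma parseval_ip v w eta : 0 < eta -> eta * T <= pi ->
  \sum_(0 <= j < n) lattice_wt j * hat_prod v w (eta * j%:R) @[n --> \oo]
      --> pi / eta * ip v w.
Proof.
move=> e0 eT.
have -> : pi / eta * ip v w = 2^-1 * (pi / eta * ip (v + w) (v + w)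
   - pi / eta * ip v v - pi / eta * ip w w).
  by rewrite ipDl !ipDr (ipC w v); field; rewrite gt_eqF.
apply: cvg_trans (@cvgMl_tmp _ _ _ _ _ 2^-1 _ (cvgB (cvgB (@parseval_sqr (v + w) _ e0 eT)
  (@parseval_sqr v _ e0 eT)) (@parseval_sqr w _ e0 eT))).
apply: near_eq_cvg; near=> n.
rewrite !fctE -!sumrB mulr_sumr; apply: eq_bigr => j _.
by rewrite hat_prodD; field.
Unshelve. all: by end_near. Qed.

Lemma lattice_bessel v eta m n : 0 < eta -> eta * T <= pi ->
  \sum_(m <= j < n) hat_prod v v (eta * j%:R) <= 2 * pi / eta * ip v v.
Proof.
move=> e0 eT.
have le1 k : \sum_(0 <= j < k) lattice_wt j * hat_prod v v (eta * j%:R) <= pi / eta * ip v v.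
  have ps := @parseval_sqr v _ e0 eT.
  rewrite -(cvg_lim _ ps)//.
  apply: (nondecreasing_cvgn_le (u_ := fun k => \sum_(0 <= j < k) lattice_wt j * hat_prod v v (eta * j%:R))).
    move=> i j ij; rewrite (@big_cat_nat _ _ _ i 0 j)//= lerDl sumr_ge0// => k' _.
    by rewrite mulr_ge0 ?lattice_wt_ge0 ?hat_prod_ge0.
  by apply/cvg_ex; exists (pi / eta * ip v v).
have [mn|nm] := leqP m n; last first.
  rewrite big_geq ?(ltnW nm)// mulr_ge0 ?ip_ge0// divr_ge0 ?ltW//.
  by rewrite mulr_gt0// pi_gt0.
apply: le_trans (_ : 2 * \sum_(0 <= j < n) lattice_wt j * hat_prod v v (eta * j%:R) <= _).
  rewrite mulr_sumr (@big_cat_nat _ _ _ m 0 n)//= -[leLHS]add0r lerD//.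
    rewrite sumr_ge0// => i _.
    by rewrite mulr_ge0// mulr_ge0 ?lattice_wt_ge0 ?hat_prod_ge0.
  rewrite ler_sum// => i _; rewrite mulrA ler_peMl ?hat_prod_ge0// /lattice_wt.
  by case: ifP => _; lra.
by rewrite -!mulrA ler_pM2l// mulrA.
Qed.

Lemma mvt_c v y y' : y <= y' -> exists2 xi, y <= xi <= y' &
  ip v (c y') - ip v (c y) = - (y' - y) * ip (mt v) (s xi).
Proof.
move=> yy'.
have [|xi] := @MVT_segment _ _ (fun y => - ip (mt v) (s y)) _ _ yy' (fun y _ => es_dc ES v y).
  apply: derivable_within_continuous => x _.
  by have := es_dc ES v x => /@ex_derive.
by rewrite in_itv/= => xiI ->; exists xi => //; ring.
Qed.

Lemma mvt_s v y y' : y <= y' -> exists2 xi, y <= xi <= y' &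
  ip v (s y') - ip v (s y) = (y' - y) * ip (mt v) (c xi).
Proof.
move=> yy'.
have [|xi] := @MVT_segment _ _ (fun y => ip (mt v) (c y)) _ _ yy' (fun y _ => es_ds ES v y).
  apply: derivable_within_continuous => x _.
  by have := es_ds ES v x => /@ex_derive.
by rewrite in_itv/= => xiI ->; exists xi => //; ring.
Qed.

Lemma ip_c_le v y : ip v (c y) ^+ 2 <= 2 * T * ip v v.
Proof.
rewrite (le_trans (cauchy_schwarz_sqr _ _))// mulrC ler_wpM2r ?ip_ge0//.
exact: (es_c ES).
Qed.

Lemma ip_s_le v y : ip v (s y) ^+ 2 <= 2 * T * ip v v.
Proof.
rewrite (le_trans (cauchy_schwarz_sqr _ _))// mulrC ler_wpM2r ?ip_ge0//.
exact: (es_s ES).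
Qed.

Lemma ip_mt_le v : ip (mt v) (mt v) <= T ^+ 2 * ip v v.
Proof.
rewrite -!sqr_nrm -exprMn ler_sqr ?nnegrE ?mulr_ge0 ?nrm_ge0 ?(ltW T0)//.
exact: (es_mt ES).
Qed.

Section Blocks.
Variables (eta : R) (b : R) (j0 J : nat) (r : nat -> seq nat) (a : nat -> R).
Hypotheses (eta0 : 0 < eta) (etaT : eta * T <= 2^-1).
Hypotheses (a0 : forall n, 0 <= a n) (b0 : 0 <= b).
Hypothesis ab : forall j, (j0 <= j < J)%N -> \sum_(n <- r j) a n <= b.

Definition in_blocks (y : nat -> nat -> R) :=
  forall j n, eta * j%:R <= y j n <= eta * j%:R + eta.

Definition block_sum (f : nat -> nat -> R) :=
  \sum_(j0 <= j < J) \sum_(n <- r j) a n * f j n.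

Lemma block_sum_le f g : (forall j n, f j n <= g j n) -> block_sum f <= block_sum g.
Proof.
move=> fg; apply: ler_sum => j _; apply: ler_sum => n _.
exact: ler_wpM2l.
Qed.

Lemma block_sumD f g : block_sum (fun j n => f j n + g j n) = block_sum f + block_sum g.
Proof.
rewrite /block_sum -big_split/=; apply: eq_bigr => j _; rewrite -big_split/=.
by apply: eq_bigr => n _; rewrite mulrDr.
Qed.

Lemma block_sumZ k f : block_sum (fun j n => k * f j n) = k * block_sum f.
Proof.
rewrite /block_sum mulr_sumr; apply: eq_bigr => j _; rewrite mulr_sumr.
by apply: eq_bigr => n _; rewrite mulrCA.
Qed.

Let etaTpi : eta * T <= pi.
Proof. by rewrite (le_trans etaT)//; have := pi_ge2 R; lra. Qed.

Let B0 := 2 * pi / eta.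

Let B00 : 0 <= B0.
Proof. by rewrite divr_ge0 ?(ltW eta0)// mulr_ge0// pi_ge0. Qed.

Lemma block_sum_lattice v : block_sum (fun j _ => hat_prod v v (eta * j%:R)) <= b * (B0 * ip v v).
Proof.
apply: le_trans (_ : \sum_(j0 <= j < J) b * hat_prod v v (eta * j%:R) <= _).
  rewrite /block_sum !big_nat; apply: ler_sum => j jJ.
  by rewrite -mulr_suml ler_wpM2r ?hat_prod_ge0// ab.
by rewrite -mulr_sumr ler_wpM2l// lattice_bessel.
Qed.

(** Moving a point by at most eta changes a coefficient of v by at most eta times a
coefficient of t v at another point of the same block: mean value theorem. *)
Lemma hat_shift v (y : nat -> nat -> R) : in_blocks y -> exists xi xi',
  [/\ in_blocks xi, in_blocks xi',
      forall j n, (ip v (c (y j n)) - ip v (c (eta * j%:R))) ^+ 2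
         <= eta ^+ 2 * ip (mt v) (s (xi j n)) ^+ 2 &
      forall j n, (ip v (s (y j n)) - ip v (s (eta * j%:R))) ^+ 2
         <= eta ^+ 2 * ip (mt v) (c (xi' j n)) ^+ 2].
Proof.
move=> yB.
have Hc (p : nat * nat) : exists x, eta * p.1%:R <= x <= eta * p.1%:R + eta /\
    (ip v (c (y p.1 p.2)) - ip v (c (eta * p.1%:R))) ^+ 2
         <= eta ^+ 2 * ip (mt v) (s x) ^+ 2.
  have /andP[y1 y2] := yB p.1 p.2.
  have [x /andP[x1 x2] ->] := mvt_c v y1.
  exists x; split; first by rewrite x1 (le_trans x2).
  rewrite exprMn sqrrN ler_wpM2r ?sqr_ge0// ler_sqr ?nnegrE ?subr_ge0 ?(ltW eta0)//.
  by rewrite lerBlDl.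
have Hs (p : nat * nat) : exists x, eta * p.1%:R <= x <= eta * p.1%:R + eta /\
    (ip v (s (y p.1 p.2)) - ip v (s (eta * p.1%:R))) ^+ 2
         <= eta ^+ 2 * ip (mt v) (c x) ^+ 2.
  have /andP[y1 y2] := yB p.1 p.2.
  have [x /andP[x1 x2] ->] := mvt_s v y1.
  exists x; split; first by rewrite x1 (le_trans x2).
  rewrite exprMn ler_wpM2r ?sqr_ge0// ler_sqr ?nnegrE ?subr_ge0 ?(ltW eta0)//.
  by rewrite lerBlDl.
have [f fP] := choice Hc; have [g gP] := choice Hs.
exists (fun j n => f (j, n)), (fun j n => g (j, n)); split=> j n.
- exact: (fP (j, n)).1.
- exact: (gP (j, n)).1.
- exact: (fP (j, n)).2.
- exact: (gP (j, n)).2.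
Qed.

(** The exponentials at the lattice points satisfy a Bessel inequality by Parseval.
Moving the points inside their blocks replaces v by t v and multiplies the error
by eta; as eta T <= 1/2, applying the inequality to t v halves what is lost with
respect to the expected constant.  Starting from a trivial bound and iterating
removes the excess. *)
Lemma block_bessel v (y y' : nat -> nat -> R) : in_blocks y -> in_blocks y' ->
  block_sum (fun j n => ip v (c (y j n)) ^+ 2 + ip v (s (y' j n)) ^+ 2)
    <= 4 * (b * (B0 * ip v v)).
Proof.
move=> yB y'B.
(* the trivial bound, from the norms of the vectors *)
pose W := 4 * T * block_sum (fun _ _ => 1).
have W0 : 0 <= W.
  rewrite mulr_ge0 ?mulr_ge0 ?(ltW T0)// sumr_ge0// => j _.
  by rewrite sumr_ge0// => n _; rewrite mulr1.
have main k : forall v (y y' : nat -> nat -> R), in_blocks y -> in_blocks y' ->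
    block_sum (fun j n => ip v (c (y j n)) ^+ 2 + ip v (s (y' j n)) ^+ 2)
    <= (4 * (b * B0) + 2^-1 ^+ k * W) * ip v v.
  elim: k => [|k IH] {yB y'B}v {}y {}y' yB y'B.
    rewrite expr0 mul1r.
    apply: le_trans (_ : W * ip v v <= _); last first.
      rewrite ler_wpM2r ?ip_ge0// lerDr.
      by apply: mulr_ge0 => //; exact: mulr_ge0.
    rewrite /W mulrAC -block_sumZ; apply: block_sum_le => j n.
    have := ip_c_le v (y j n); have := ip_s_le v (y' j n); lra.
  have [xi [xi' [xiB xi'B Hc Hs]]] := hat_shift v yB.
  have [ze [ze' [zeB ze'B Kc Ks]]] := hat_shift v y'B.
  have IH' := IH (mt v) ze' xi ze'B xiB.
  apply: le_trans (_ : 2 * block_sum (fun j _ => hat_prod v v (eta * j%:R)) + 2 * eta ^+ 2 * 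
     block_sum (fun j n => ip (mt v) (c (ze' j n)) ^+ 2 + ip (mt v) (s (xi j n)) ^+ 2) <= _).
    rewrite -!block_sumZ -block_sumD; apply: block_sum_le => j n.
    have := Hc j n; have := Ks j n; rewrite /hat_prod.
    set p := ip v (c (y j n)); set q := ip v (c _).
    set p' := ip v (s (y' j n)); set q' := ip v (s _).
    have := sqr_ge0 (p - 2 * q); have := sqr_ge0 (p' - 2 * q'); nra.
  have := block_sum_lattice v; have := ip_mt_le v; have := ip_ge0 v.
  have : eta ^+ 2 * T ^+ 2 <= 4^-1.
    rewrite -exprMn (_ : 4^-1 = 2^-1 ^+ 2); last by field.
    by rewrite ler_sqr ?nnegrE ?mulr_ge0 ?(ltW eta0) ?(ltW T0).
  set P := 4 * (b * B0) + 2^-1 ^+ k * W in IH' *.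
  have P0 : 0 <= P.
    apply: addr_ge0; first by apply: mulr_ge0 => //; exact: mulr_ge0.
    by apply: mulr_ge0 => //; exact: exprn_ge0.
  set S := block_sum _ in IH' *; set L := block_sum _.
  set vv := ip v v; set mm := ip (mt v) (mt v) in IH' *.
  move=> eT vv0 mmT LB.
  have h1 : eta ^+ 2 * S <= eta ^+ 2 * (P * mm) by rewrite ler_wpM2l// sqr_ge0.
  have h2 : eta ^+ 2 * (P * mm) <= eta ^+ 2 * (P * (T ^+ 2 * vv)).
    by rewrite ler_wpM2l ?sqr_ge0// ler_wpM2l.
  have h3 : P * vv * (eta ^+ 2 * T ^+ 2) <= P * vv * 4^-1.
    by rewrite ler_wpM2l// mulr_ge0.
  have h4 : P = 4 * (b * B0) + 2 * (2^-1 ^+ k.+1 * W).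
    by rewrite exprS /P; field.
  have h5 : P * vv = (4 * (b * B0) + 2 * (2^-1 ^+ k.+1 * W)) * vv by rewrite {1}h4.
  lra.
have [WV0|WV0] := eqVneq (W * ip v v) 0.
  by have := main 0%N v y y' yB y'B; rewrite expr0 mul1r mulrDl WV0 addr0 !mulrA.
have WVp : 0 < W * ip v v by rewrite lt_def WV0 mulr_ge0// ip_ge0.
apply/ler_addgt0Pl => e e0.
pose k := (Num.truncn (W * ip v v / e)).+1.
apply: le_trans (main k v y y' yB y'B) _.
rewrite mulrDl (_ : 4 * (b * (B0 * _)) = 4 * (b * B0) * ip v v); last by ring.
rewrite [e + _]addrC lerD2l -mulrA exprVn mulrC ler_pdivrMr ?exprn_gt0//.
rewrite [e * _]mulrC -ler_pdivrMr// (le_trans (ltW (truncnS_gt _)))//.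
have -> : (2 : R) ^+ k = (2 ^ k)%:R by rewrite natrX.
by rewrite ler_nat ltnW// ltn_expl.
Qed.

Lemma block_variation v (y : nat -> nat -> R) : in_blocks y ->
  block_sum (fun j n => (ip v (c (y j n)) - ip v (c (eta * j%:R))) ^+ 2
                 + (ip v (s (y j n)) - ip v (s (eta * j%:R))) ^+ 2)
    <= (eta * T) ^+ 2 * (4 * (b * (B0 * ip v v))).
Proof.
move=> yB; have [xi [xi' [xiB xi'B Hc Hs]]] := hat_shift v yB.
apply: le_trans (_ : eta ^+ 2 * block_sum (fun j n => ip (mt v) (c (xi' j n)) ^+ 2 +
    ip (mt v) (s (xi j n)) ^+ 2) <= _).
  rewrite -block_sumZ; apply: block_sum_le => j n; rewrite mulrDr addrC lerD//.
rewrite (_ : (eta * T) ^+ 2 * _ = eta ^+ 2 * (T ^+ 2 * (4 * (b * (B0 * ip v v)))));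
  last by ring.
rewrite ler_wpM2l ?sqr_ge0//.
apply: le_trans (block_bessel (mt v) xi'B xiB) _.
have := ler_wpM2l (mulr_ge0 b0 B00) (ip_mt_le v); lra.
Qed.

(** Replacing the frequencies by the left ends of the blocks costs a factor eta T:
the variation is controlled by [block_variation], hence by the Bessel inequality
for t v. *)
Lemma block_compare v w (y : nat -> nat -> R) : in_blocks y ->
  `|block_sum (fun j n => hat_prod v w (y j n) - hat_prod v w (eta * j%:R))|
    <= 4 * (eta * T) * (b * B0) * (ip v v + ip w w).
Proof.
move=> yB.
pose D u := block_sum (fun j n => (ip u (c (y j n)) - ip u (c (eta * j%:R))) ^+ 2
                 + (ip u (s (y j n)) - ip u (s (eta * j%:R))) ^+ 2).
pose E u := block_sum (fun j n => hat_prod u u (y j n)).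
pose L u := block_sum (fun j _ => hat_prod u u (eta * j%:R)).
set d := eta * T.
have d0 : 0 < d by rewrite mulr_gt0.
have Dle u : D u <= d ^+ 2 * (4 * (b * (B0 * ip u u))) by exact: block_variation.
have Ele u : E u <= 4 * (b * (B0 * ip u u)).
  exact: block_bessel.
have Lle u : L u <= b * (B0 * ip u u) by exact: block_sum_lattice.
(* arithmetic-geometric mean: the differences are smaller by a factor d *)
have Eb : `|block_sum (fun j n => hat_prod v w (y j n) - hat_prod v w (eta * j%:R))|
   <= d^-1 / 2 * (D v + D w) + d / 2 * (E w + L v).
  rewrite -!block_sumD -!block_sumZ -block_sumD.
  apply: le_trans (_ : block_sum (fun j n => `|hat_prod v w (y j n) - hat_prod v w (eta * j%:R)|) <= _).
    rewrite /block_sum (le_trans (ler_norm_sum _ _ _))// ler_sum// => j _.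
    rewrite (le_trans (ler_norm_sum _ _ _))// ler_sum// => n _.
    by rewrite normrM (ger0_norm (a0 _)).
  apply: block_sum_le => j n; rewrite /hat_prod.
  set p := ip v (c (y j n)); set p0 := ip v (c (eta * _)).
  set q := ip v (s (y j n)); set q0 := ip v (s (eta * _)).
  set P := ip w (c (y j n)); set P0 := ip w (c (eta * _)).
  set Q := ip w (s (y j n)); set Q0 := ip w (s (eta * _)).
  have -> : p * P + q * Q - (p0 * P0 + q0 * Q0) =
     (p - p0) * P + (q - q0) * Q + ((P - P0) * p0 + (Q - Q0) * q0) by ring.
  have am x z : `|x * z| <= d^-1 / 2 * x ^+ 2 + d / 2 * z ^+ 2.
    have di : d * d^-1 = 1 by rewrite mulfV// gt_eqF.
    have di0 : 0 < d^-1 by rewrite invr_gt0.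
    rewrite ler_norml; have : 0 <= d^-1 * (x + d * z) ^+ 2.
      by rewrite mulr_ge0 ?sqr_ge0 ?(ltW di0).
    have : 0 <= d^-1 * (x - d * z) ^+ 2.
      by rewrite mulr_ge0 ?sqr_ge0 ?(ltW di0).
    have -> : d^-1 * (x - d * z) ^+ 2 = d^-1 * x ^+ 2 - 2 * x * z + d * z ^+ 2.
      by field; rewrite gt_eqF.
    have -> : d^-1 * (x + d * z) ^+ 2 = d^-1 * x ^+ 2 + 2 * x * z + d * z ^+ 2.
      by field; rewrite gt_eqF.
    move=> h1 h2; apply/andP; split; lra.
  rewrite (le_trans (ler_normD _ _))//.
  have := ler_normD ((p - p0) * P) ((q - q0) * Q).
  have := ler_normD ((P - P0) * p0) ((Q - Q0) * q0).
  have := am (p - p0) P; have := am (q - q0) Q.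
  have := am (P - P0) p0; have := am (Q - Q0) q0.
  lra.
apply: le_trans Eb _.
have h (u : V) : d^-1 / 2 * D u <= d / 2 * (4 * (b * (B0 * ip u u))).
  rewrite (_ : d / 2 * _ = d^-1 / 2 * (d ^+ 2 * (4 * (b * (B0 * ip u u))))); last first.
    by field; rewrite gt_eqF.
  by rewrite ler_wpM2l// divr_ge0// invr_ge0 ltW.
have hE := ler_wpM2l (ltW (divr_gt0 d0 (ltr0n _ 2))) (Ele w).
have hL := ler_wpM2l (ltW (divr_gt0 d0 (ltr0n _ 2))) (Lle v).
have hb : 0 <= d * (b * (B0 * ip v v)).
  by rewrite mulr_ge0 ?(ltW d0)// mulr_ge0// mulr_ge0// ip_ge0.
have hv := h v; have hw := h w.
lra.
Qed.

(** Far blocks all have nearly the same mass m; this turns the weighted sum over the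
blocks into the lattice sum of Parseval's formula. *)
Lemma block_discrepancy v w (m e : R) :
  (forall j, (j0 <= j < J)%N -> `|\sum_(n <- r j) a n - m| <= e) -> 0 <= e ->
  `|block_sum (fun j n => hat_prod v w (eta * j%:R)) - m * \sum_(j0 <= j < J) hat_prod v w (eta * j%:R)|
    <= e / 2 * B0 * (ip v v + ip w w).
Proof.
move=> am e0.
have -> : block_sum (fun j n => hat_prod v w (eta * j%:R)) -
   m * \sum_(j0 <= j < J) hat_prod v w (eta * j%:R) =
   \sum_(j0 <= j < J) (\sum_(n <- r j) a n - m) * hat_prod v w (eta * j%:R).
  rewrite mulr_sumr -sumrB; apply: eq_bigr => j _.
  by rewrite -mulr_suml mulrBl.
rewrite (le_trans (ler_norm_sum _ _ _))//.
apply: le_trans (_ : \sum_(j0 <= j < J) (e / 2 * (hat_prod v v (eta * j%:R) +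
   hat_prod w w (eta * j%:R))) <= _).
  rewrite !big_nat; apply: ler_sum => j jJ; rewrite normrM.
  have h : `|hat_prod v w (eta * j%:R)| <= 2^-1 * (hat_prod v v (eta * j%:R) +
     hat_prod w w (eta * j%:R)).
    have := hat_prod_ge0 (v + w) (eta * j%:R).
    have := hat_prod_ge0 (v - w) (eta * j%:R).
    have -> : hat_prod (v - w) (v - w) (eta * j%:R) = hat_prod v v (eta * j%:R) +
      hat_prod w w (eta * j%:R) - 2 * hat_prod v w (eta * j%:R).
      by rewrite /hat_prod !ipBl; ring.
    rewrite hat_prodD ler_norml => h1 h2; apply/andP; split; lra.
  by rewrite -mulrA ler_pM// am.
rewrite -mulr_sumr big_split/= -[_ * B0 * _]mulrA ler_wpM2l ?divr_ge0//.
by rewrite mulrDr lerD// lattice_bessel.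
Qed.

End Blocks.
End ExpSystem.

(** * Operators bounded below, and sums over block-regular frequencies *)

Section SemiLinear.
Context {R : realType} {V : semiHilbertType R}.
Implicit Types (u v w : V).

Lemma nrmD_null u v : nrm u = 0 -> nrm (u + v) = nrm v.
Proof.
move=> u0; apply/eqP; rewrite eq_le; apply/andP; split.
  by rewrite (le_trans (ler_nrmD _ _))// u0 add0r.
rewrite -{1}(addKr u v) (le_trans (ler_nrmD _ _))// nrmN u0 add0r//.
Qed.

(** Linearity up to vectors of norm zero. *)
Definition semi_linear (A : V -> V) := forall a u v,
  nrm (A (a *: u + v) - (a *: A u + A v)) = 0.

Variable A : V -> V.
Hypothesis Alin : semi_linear A.

Lemma semi_linearB u v : nrm (A u - A v) = nrm (A (u - v)).
Proof.
rewrite -[RHS](nrmD_null (u := A u - A v - A (u - v))); last first.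
  rewrite -[A u - A v - _]opprB nrmN.
  have := Alin (-1) v u; rewrite !scaleN1r addrC [- A v + _]addrC.
  by rewrite [- v + _]addrC addrC.
by rewrite subrK.
Qed.

Lemma semi_linear_null : nrm (A 0) = 0.
Proof. by rewrite -(subrr 0) -semi_linearB subrr nrm0. Qed.

Lemma semi_linearZ a u : nrm (A (a *: u)) = `|a| * nrm (A u).
Proof.
have := Alin a u 0; rewrite addr0 => h.
rewrite -nrmZ -[A (a *: u)](subrK (a *: A u + A 0)) (nrmD_null _ h) addrC.
by rewrite nrmD_null// semi_linear_null.
Qed.

(** Bounds a norm by testing against multiples of the vector itself whose norm is
close to that of v. *)
Lemma polar_bound u (k : R) v : 0 <= k ->
  (forall w, `|ip u w| <= k * (ip v v + ip w w)) -> nrm u <= 2 * k * nrm v.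
Proof.
move=> k0 h.
have [->|u0] := eqVneq (nrm u) 0; first by rewrite !mulr_ge0// nrm_ge0.
have up : 0 < nrm u by rewrite lt_def u0 nrm_ge0.
apply/ler_addgt0Pl => e e0; rewrite addrC.
pose r := nrm v + e / (2 * k + 1).
have k1 : 0 < 2 * k + 1 by lra.
have rp : 0 < r by rewrite ltr_wpDl ?nrm_ge0// divr_gt0.
have vr : nrm v <= r by rewrite lerDl divr_ge0 ?(ltW e0) ?(ltW k1).
have /(le_trans (ler_norm _)) := h ((r / nrm u) *: u).
rewrite !ipZr !ipZl -!sqr_nrm.
have -> : r / nrm u * (r / nrm u * nrm u ^+ 2) = r ^+ 2 by field.
have -> : r / nrm u * nrm u ^+ 2 = r * nrm u by field.
move=> ru.
have : r * nrm u <= r * (2 * k * r).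
  apply: le_trans ru _.
  have : nrm v ^+ 2 <= r ^+ 2 by rewrite ler_sqr ?nnegrE ?nrm_ge0 ?(ltW rp).
  move=> vr2; have := ler_wpM2l k0 vr2; rewrite expr2; lra.
rewrite ler_pM2l// => /le_trans; apply.
rewrite /r mulrDr lerD2l mulrCA ler_piMr ?(ltW e0)//.
by rewrite ler_pdivrMr// mul1r; lra.
Qed.

(** A separated bounded sequence would have a separated image. *)
Lemma seq_compact_not_below (e : nat -> V) (M d : R) :
  seq_compact A -> (forall n, nrm (e n) <= M) -> 0 < d ->
  (forall m n, (m < n)%N -> d <= nrm (e m - e n)) ->
  ~ exists2 k, 0 < k & forall v, k * nrm v <= nrm (A v).
Proof.
move=> Acpt eM d0 ed [k k0 kA].
have [|phi [h [phi_lt /scvgP Ah]]] := Acpt e; first by exists M.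
have kd : 0 < k * d / 3 by rewrite divr_gt0// mulr_gt0.
have [N _ NP] := Ah _ kd.
have h1 := NP N (leqnn N); have h2 := NP N.+1 (leqnSn N).
have h3 := ed _ _ (phi_lt N N.+1 (ltnSn N)).
have h4 := kA (e (phi N) - e (phi N.+1)); rewrite -semi_linearB in h4.
have h5 := ler_nrm_dist (A (e (phi N))) h (A (e (phi N.+1))).
rewrite (nrmB h) in h5; rewrite /= in h1 h2.
have := ler_wpM2l (ltW k0) h3; nra.
Qed.

(** Otherwise some unit vectors u_n have A u_n -> 0; by compactness l u_n converges
along a subsequence, to l times a vector of the kernel that is not of norm zero. *)
Lemma identity_plus_compact_below (l M : R) :
  (forall v, nrm (A v) <= M * nrm v) -> l != 0 ->
  seq_compact (fun v => A v - l *: v) ->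
  (forall v, nrm (A v) = 0 -> nrm v = 0) ->
  exists2 k, 0 < k & forall v, k * nrm v <= nrm (A v).
Proof.
move=> AM l0 Acpt Ainj; apply: contrapT => nobelow.
have M0 : 0 <= `|M| + 1 by rewrite addr_ge0.
have small (n : nat) : exists u, nrm u = 1 /\ nrm (A u) <= n.+1%:R^-1.
  apply: contrapT => nosmall; apply: nobelow; exists n.+1%:R^-1 => // v.
  have [v0|v0] := eqVneq (nrm v) 0; first by rewrite v0 mulr0 nrm_ge0.
  have vp : 0 < nrm v by rewrite lt_def v0 nrm_ge0.
  rewrite leNgt; apply/negP => Av; apply: nosmall.
  exists ((nrm v)^-1 *: v); rewrite semi_linearZ nrmZ.
  rewrite gtr0_norm ?invr_gt0// mulVf//; split => //.
  by rewrite mulrC ler_pdivrMr// ltW.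
have [u uP] := choice small.
have [|phi [h [phi_lt Ah]]] := Acpt u.
  by exists 1 => n; rewrite (uP n).1.
have A0 : scvg (fun n => A (u (phi n))) 0.
  apply/scvgP => e e0; exists (Num.truncn e^-1) => // n /= nN.
  rewrite subr0 (le_trans (uP _).2)// invf_ple ?posrE//.
  apply: ltW; rewrite (lt_le_trans (truncnS_gt _))// ler_nat ltnS.
  exact: leq_trans nN (incr_ge_id phi_lt n).
pose g := - l^-1 *: h.
have ug : scvg (fun n => u (phi n)) g.
  have := scvgZ (- l^-1) (scvgD Ah (scvgZ (-1) A0)).
  rewrite scaler0 addr0 => /scvgP ug; apply/scvgP => e /ug; apply: filterS => n.
  rewrite -/g scaleN1r addrAC subrr add0r scaleNr scalerN opprK scalerA.
  by rewrite mulVf// scale1r.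
have Ag : nrm (A g) = 0.
  apply/eqP; rewrite eq_le nrm_ge0 andbT; apply/ler_addgt0Pl => e e0; rewrite addr0.
  have e2 : 0 < e / 2 by rewrite divr_gt0.
  have e2M : 0 < e / 2 / (`|M| + 1) by rewrite divr_gt0// ltr_wpDl.
  move/scvgP : ug => ug; move/scvgP: A0 => A0.
  near \oo => n.
  rewrite -[A g](subrK (A (u (phi n)))) (le_trans (ler_nrmD _ _))// [e]splitr lerD//.
    rewrite semi_linearB (le_trans (AM _))// nrmB.
    have un : nrm (u (phi n) - g) <= e / 2 / (`|M| + 1) by near: n; exact: ug.
    rewrite ler_pdivlMr ?ltr_wpDl// mulrC in un.
    rewrite (le_trans _ un)// ler_wpM2r ?nrm_ge0//.
    by rewrite (le_trans (ler_norm _))// lerDl.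
  have : nrm (A (u (phi n)) - 0) <= e / 2 by near: n; exact: A0.
  by rewrite subr0.
have g0 := Ainj _ Ag.
move/scvgP : ug => /(_ 2^-1); rewrite invr_gt0 ltr0n => /(_ isT)[N _ /(_ N (leqnn N))] /=.
have := ler_nrmD (u (phi N) - g) g; rewrite subrK g0 (uP _).1; lra.
Unshelve. all: by end_near. Qed.

End SemiLinear.

Lemma unit_weight (R : realType) (i : nat) : 0 <= (1 : R) <= 1.
Proof. by rewrite ler01 lexx. Qed.

Section SumOp.
Context {R : realType} {V : semiHilbertType R}.
Variables (T : R) (c s : R -> V) (mt : V -> V).
Hypothesis ES : exp_system T c s mt.
Variables (a lam : nat -> R) (d : R).
Hypothesis a0 : forall n, 0 <= a n.
Implicit Types (v w : V).

Let T0 : 0 < T := es_T0 ES.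

(** The measure with mass a_n at lam_n looks, at infinity and at every scale eta,
like d times the Lebesgue measure: the mass of a far block of length eta is
d eta + O(eta^2). *)
Definition block_regular := forall eta, 0 < eta -> eta <= 3^-1 ->
  exists (N : nat -> nat) (j0 : nat), [/\ {homo N : i j / (i <= j)%N},
    forall n, exists j, (n <= N j)%N,
    forall j n, (N j <= n < N j.+1)%N -> eta * j%:R <= lam n <= eta * j%:R + eta &
    forall j, (j0 <= j)%N ->
      `|\sum_(N j <= n < N j.+1) a n - d * eta| <= 2 * eta ^+ 2].

Hypothesis areg : block_regular.
Hypothesis d01 : 0 <= d <= 1.

Local Notation corr := (hat_prod c s).

Lemma nested_blocks (f : nat -> R) (N : nat -> nat) j0 J :
  {homo N : i j / (i <= j)%N} -> (j0 <= J)%N ->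
  \sum_(j0 <= j < J) \sum_(N j <= n < N j.+1) f n = \sum_(N j0 <= n < N J) f n.
Proof.
move=> Nhomo; elim: J => [|J IH]; first by rewrite leqn0 => /eqP ->; rewrite !big_geq.
rewrite leq_eqVlt => /predU1P[->|]; first by rewrite !big_geq.
rewrite ltnS => j0J; rewrite big_nat_recr//= IH//.
by rewrite -big_cat_nat// Nhomo.
Qed.

Let small_eta (e : R) : 0 < e -> exists eta, [/\ 0 < eta, eta <= 3^-1, eta * T <= 2^-1 & eta <= e].
Proof.
move=> e0; exists (Num.min e (Num.min 3^-1 (2^-1 / T))).
split.
- by rewrite !lt_min e0 invr_gt0 ltr0n divr_gt0 ?invr_gt0.
- by rewrite !ge_min lexx orbT.
- by rewrite -ler_pdivlMr// !ge_min lexx !orbT.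
- by rewrite ge_min lexx.
Qed.

(** The two estimates over the blocks after the j0-th one: the Bessel inequality
with a constant that does not depend on eta, and the comparison with the lattice,
of order eta. *)
Lemma tail_bounds (e : R) : 0 < e -> exists eta N j0, [/\ 0 < eta, eta * T <= pi, eta <= e &
   [/\ {homo N : i j / (i <= j)%N}, (0 < j0)%N, (forall n, exists j, (n <= N j)%N),
   (forall J v, (j0 <= J)%N -> \sum_(N j0 <= n < N J) a n * corr v v (lam n) <= 24 * pi * ip v v) &
   (forall J v w, (j0 <= J)%N ->
     `|\sum_(N j0 <= n < N J) a n * corr v w (lam n)
        - d * eta * \sum_(j0 <= j < J) corr v w (eta * j%:R)|
      <= (24 * T + 2) * pi * eta * (ip v v + ip w w))]].
Proof.
move=> e0; have [eta [eta0 eta1 etaT etae]] := small_eta e0.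
have [N [j1 [Nhomo Ninf Nlam Na]]] := areg eta0 eta1.
exists eta, N, (maxn 1 j1).
set j0 := maxn 1 j1.
have j1j0 : (j1 <= j0)%N by rewrite leq_maxr.
have d1 : 0 <= d /\ d <= 1 by case/andP: d01.
(* the mass of a far block is at most d eta + 2 eta^2 <= 3 eta *)
have b0 : 0 <= 3 * eta by rewrite mulr_ge0// ltW.
have ab J j : (j0 <= j < J)%N -> \sum_(n <- index_iota (N j) (N j.+1)) a n <= 3 * eta.
  move=> /andP[j0j _]; have := Na j (leq_trans j1j0 j0j); rewrite ler_norml.
  nra.
pose y j n := if (N j <= n < N j.+1)%N then lam n else eta * j%:R.
have yB : in_blocks eta y.
  move=> j n; rewrite /y; case: ifPn => [/Nlam//|_].
  by rewrite lexx lerDl ltW.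
have block_sumE J (f : R -> R) : (j0 <= J)%N ->
    block_sum j0 J (fun j => index_iota (N j) (N j.+1)) a (fun j n => f (y j n)) =
    \sum_(N j0 <= n < N J) a n * f (lam n).
  move=> j0J; rewrite -nested_blocks//.
  apply: eq_bigr => j _; apply: eq_big_nat => n jn.
  by rewrite /y jn.
have piT : eta * T <= pi by rewrite (le_trans etaT)//; have := pi_ge2 R; lra.
have pi0 : 0 < pi :> R := pi_gt0 R.
split => //; split => //; first by rewrite leq_max.
- move=> J v j0J; rewrite -(block_sumE _ (corr v v))//.
  have := block_bessel ES eta0 etaT a0 b0 (@ab J) v yB yB.
  rewrite (_ : 4 * (3 * eta * (2 * pi / eta * ip v v)) = 24 * pi * ip v v)//.
  by field; rewrite gt_eqF.
move=> J v w j0J.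
have h1 := block_compare ES eta0 etaT a0 b0 (@ab J) v w yB.
have h2 := block_discrepancy ES eta0 etaT v w (r := fun j => index_iota (N j) (N j.+1))
  (m := d * eta) (e := 2 * eta ^+ 2) (j0 := j0) (J := J) (a := a).
have {}h2 := h2 (fun j jJ => Na j (leq_trans j1j0 (proj1 (andP jJ)))) _.
have {}h2 := h2 (mulr_ge0 (ler0n _ 2) (sqr_ge0 eta)).
rewrite -(block_sumE _ (corr v w))//.
set A := block_sum _ _ _ _ _.
set B := block_sum _ _ _ _ _ in h1.
set C := block_sum _ _ _ _ _ in h2.
have -> : A = B + C by rewrite /A /B /C -block_sumD; congr block_sum; apply/funext => j; apply/funext => n; rewrite subrK.
rewrite -addrA (le_trans (ler_normD _ _))//.
apply: le_trans (lerD h1 h2) _.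
rewrite le_eqVlt; apply/orP; left; apply/eqP; field.
by rewrite gt_eqF.
Qed.

Let xc n : V := Num.sqrt (a n) *: c (lam n).
Let xs n : V := Num.sqrt (a n) *: s (lam n).

Lemma hat_prod_frame v w n : ip v (xc n) * ip w (xc n) + ip v (xs n) * ip w (xs n)
  = a n * corr v w (lam n).
Proof.
by rewrite /xc /xs !ipZr -[in RHS](sqr_sqrtr (a0 n)) /hat_prod; ring.
Qed.

(** Far away this is the Bessel inequality over blocks; the finitely many remaining
terms are bounded. *)
Lemma frame_bessel : exists C, [/\ 0 < C, bessel C xc & bessel C xs].
Proof.
have [eta [N [j0 [_ _ _ [Nhomo _ Ninf tail _]]]]] := tail_bounds ltr01.
pose S := \sum_(0 <= n < N j0) a n.
have S0 : 0 <= S by exact: sumr_ge0.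
pose C := 24 * pi + 4 * T * S.
have C0 : 0 < C.
  by rewrite ltr_pwDl ?mulr_gt0 ?pi_gt0// !mulr_ge0// ltW.
have main m v : \sum_(0 <= n < m) a n * corr v v (lam n) <= C * ip v v.
  have an0 n : 0 <= a n * corr v v (lam n) by rewrite mulr_ge0// hat_prod_ge0.
  have [j mj] := Ninf m.
  pose J := maxn j j0.
  have mJ : (m <= N J)%N by rewrite (leq_trans mj)// Nhomo// leq_maxl.
  have j0J : (j0 <= J)%N by rewrite leq_maxr.
  apply: le_trans (_ : \sum_(0 <= n < N J) a n * corr v v (lam n) <= _).
    by rewrite (@big_cat_nat _ _ _ m 0 (N J))//= lerDl sumr_ge0.
  rewrite (@big_cat_nat _ _ _ (N j0) 0 (N J))//= ?Nhomo// /C mulrDl addrC lerD//.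
    exact: tail.
  rewrite /S -mulrA mulr_suml mulr_sumr; apply: ler_sum => n _.
  have hb : corr v v (lam n) <= 4 * T * ip v v.
    have := ip_c_le ES v (lam n); have := ip_s_le ES v (lam n).
    rewrite /hat_prod -!expr2; lra.
  have := ler_wpM2l (a0 n) hb; lra.
exists C; split => // m v; apply: le_trans (main m v); apply: ler_sum => n _;
  by rewrite -hat_prod_frame -!expr2 ?lerDl ?lerDr sqr_ge0.
Qed.

(** The sum over n of w_n a_n (<v,c_y> c_y + <v,s_y> s_y) at y = lam_n.  Putting
the square root of a_n in each vector makes it a sum of two frame operators. *)
Definition sum_op (w : nat -> R) v := frame_op xc w v + frame_op xs w v.
Definition sum_part (w : nat -> R) v m :=
  \sum_(0 <= n < m) (w n * a n) *: (ip v (c (lam n)) *: c (lam n) + ip v (s (lam n)) *: s (lam n)).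

Lemma sum_partE (w : nat -> R) v m : sum_part w v m = frame_part xc w v m + frame_part xs w v m.
Proof.
rewrite /sum_part /frame_part -big_split/=; apply: eq_bigr => n _.
rewrite /xc /xs !ipZr !scalerA scalerDr !scalerA.
by congr (_ *: _ + _ *: _); rewrite -{1}(sqr_sqrtr (a0 n)); ring.
Qed.

Lemma sum_opP (w : nat -> R) v : (forall i, 0 <= w i <= 1) -> scvg (sum_part w v) (sum_op w v).
Proof.
move=> w01; have [C [C0 Bc Bs]] := frame_bessel.
rewrite (_ : sum_part w v = fun m => frame_part xc w v m + frame_part xs w v m).
  by apply: scvgD; [exact: (frame_opP C0 Bc)|exact: (frame_opP C0 Bs)].
by apply/funext => m; rewrite sum_partE.
Qed.

Lemma sum_op_ip (w : nat -> R) v z : (forall i, 0 <= w i <= 1) ->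
  \sum_(0 <= n < m) w n * a n * corr v z (lam n) @[m --> \oo] --> ip (sum_op w v) z.
Proof.
move=> w01; apply: cvg_trans (@scvg_ip _ _ _ _ z (sum_opP v w01)).
apply: near_eq_cvg; near=> m; rewrite /sum_part ip_suml; apply: eq_bigr => n _.
by rewrite ipZl ipDl !ipZl !(ipC _ z) /hat_prod; ring.
Unshelve. all: by end_near. Qed.

Lemma sum_op_semi_linear (w : nat -> R) : (forall i, 0 <= w i <= 1) -> semi_linear (sum_op w).
Proof.
move=> w01 k u v; have [C [C0 Bc Bs]] := frame_bessel.
rewrite /sum_op scalerDr addrACA opprD addrACA nrmD_null.
  exact: (frame_op_linear C0 Bs).
exact: (frame_op_linear C0 Bc).
Qed.

Lemma sum_op_bounded : exists M, forall (w : nat -> R) v, (forall i, 0 <= w i <= 1) ->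
  nrm (sum_op w v) <= M * nrm v.
Proof.
have [C [C0 Bc Bs]] := frame_bessel; exists (C + C) => w v w01.
rewrite /sum_op (le_trans (ler_nrmD _ _))// mulrDl lerD//.
  exact: (nrm_frame_op C0 Bc).
exact: (nrm_frame_op C0 Bs).
Qed.

Lemma sum_op_cvg (D : Type) (F : set_system D) {FF : ProperFilter F}
    (W : D -> nat -> R) v :
  (\forall d \near F, forall i, 0 <= W d i <= 1) ->
  (forall i, W d i @[d --> F] --> (1 : R)) ->
  nrm (sum_op (W d) v - sum_op (fun=> 1) v) @[d --> F] --> 0.
Proof.
move=> W01 W1; have [C [C0 Bc Bs]] := frame_bessel.
have hc := @frame_op_cvg _ _ _ _ C0 Bc _ _ FF _ v W01 W1.
have hs := @frame_op_cvg _ _ _ _ C0 Bs _ _ FF _ v W01 W1.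
apply/cvgrPdist_le => e e0; have e2 : 0 < e / 2 by rewrite divr_gt0.
move/cvgrPdist_le : hc => /(_ _ e2) hc; move/cvgrPdist_le : hs => /(_ _ e2) hs.
near=> x.
have h1 : `|0 - nrm (frame_op xc (W x) v - frame_op xc (fun=> 1) v)| <= e / 2.
  by near: x.
have h2 : `|0 - nrm (frame_op xs (W x) v - frame_op xs (fun=> 1) v)| <= e / 2.
  by near: x.
rewrite sub0r normrN ger0_norm ?nrm_ge0// in h1.
rewrite sub0r normrN ger0_norm ?nrm_ge0// in h2.
rewrite sub0r normrN ger0_norm ?nrm_ge0// /sum_op opprD addrACA.
by rewrite (le_trans (ler_nrmD _ _))// [e]splitr lerD.
Unshelve. all: by end_near. Qed.

Definition sum_op1 := sum_op (fun=> 1).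

(** F collects the terms of the sum before the first far block, and subtracts the
terms of Parseval's series that are missing when the lattice sum also starts at
that block.  What is left is the difference estimated in [tail_bounds]. *)
Lemma sum_op1_approx e : 0 < e -> exists2 F, finite_rank F &
  forall v, nrm (sum_op1 v - (d * pi) *: v - F v) <= e * nrm v.
Proof.
move=> e0; pose q := 2 * ((24 * T + 2) * pi) : R.
have q0 : 0 < q by rewrite !mulr_gt0 ?pi_gt0// addr_gt0// mulr_gt0.
have eq0 : 0 < e / q by rewrite divr_gt0.
have [eta [N [j0 [eta0 etaT etae [Nhomo j00 Ninf _ tail]]]]] := tail_bounds eq0.
pose C y v := ip v (c y) *: c y + ip v (s y) *: s y.
have Crank y : finite_rank (C y).
  by apply: finite_rankD; exact: finite_rank1.
have ipC' y v w : ip (C y v) w = corr v w y.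
  by rewrite /C ipDl !ipZl !(ipC _ w) /hat_prod; ring.
pose F v := \sum_(0 <= n < N j0) a n *: C (lam n) v +
  (- (d * eta)) *: \sum_(0 <= j < j0) lattice_wt j *: C (eta * j%:R) v.
exists F.
  apply: finite_rankD.
    by apply: finite_rank_sum => n; exact: finite_rankZ.
  by apply: finite_rankZ; apply: finite_rank_sum => n; exact: finite_rankZ.
move=> v.
have -> : e * nrm v = 2 * (e / 2) * nrm v by rewrite mulrCA divff ?mulr1.
apply: polar_bound; first by rewrite divr_ge0// ltW.
move=> w.
have l1 := @sum_op_ip (fun=> 1) v w (@unit_weight R).
have l2 := @parseval_ip _ _ _ _ _ _ ES v w eta eta0 etaT.
pose phi J := (\sum_(N j0 <= n < N J) a n * corr v w (lam n)
        - d * eta * \sum_(j0 <= j < J) corr v w (eta * j%:R)).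
have NJoo : N J @[J --> \oo] --> \oo.
  apply/cvgnyPge => A; have [j Aj] := Ninf A.
  by exists j => // i /= ji; rewrite (leq_trans Aj)// Nhomo.
have lphi : phi J @[J --> \oo] --> ip (sum_op1 v - (d * pi) *: v - F v) w.
  have -> : ip (sum_op1 v - (d * pi) *: v - F v) w =
     (ip (sum_op1 v) w - \sum_(0 <= n < N j0) a n * corr v w (lam n)) -
     d * eta * (pi / eta * ip v w - \sum_(0 <= j < j0) lattice_wt j * corr v w (eta * j%:R)).
    have FE : ip (F v) w = ip (\sum_(0 <= n < N j0) a n *: C (lam n) v) w
        - d * eta * ip (\sum_(0 <= j < j0) lattice_wt j *: C (eta * j%:R) v) w.
      by rewrite [LHS]ipDl ipZl mulNr.
    rewrite ipBl FE ipBl ipZl !ip_suml.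
    under [X in _ - (X - _)]eq_bigr do rewrite ipZl ipC'.
    under [X in _ - (_ - _ * X)]eq_bigr do rewrite ipZl ipC'.
    by field; rewrite gt_eqF.
  have h1 : \sum_(0 <= n < N J) 1 * a n * corr v w (lam n)
      - \sum_(0 <= n < N j0) a n * corr v w (lam n) @[J --> \oo] -->
      ip (sum_op1 v) w - \sum_(0 <= n < N j0) a n * corr v w (lam n).
    by apply: cvgB; [exact: (cvg_comp _ _ NJoo l1)|exact: cvg_cst].
  have h2 : d * eta * (\sum_(0 <= j < J) lattice_wt j * corr v w (eta * j%:R)
      - \sum_(0 <= j < j0) lattice_wt j * corr v w (eta * j%:R)) @[J --> \oo] -->
      d * eta * (pi / eta * ip v w - \sum_(0 <= j < j0) lattice_wt j * corr v w (eta * j%:R)).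
    by apply: cvgMl_tmp; apply: cvgB; [exact: l2|exact: cvg_cst].
  apply: cvg_trans (cvgB h1 h2).
  apply: near_eq_cvg; near=> J.
  have j0J : (j0 <= J)%N by near: J; exact: nbhs_infty_ge.
  rewrite !fctE/= /phi; congr (_ - _ * _).
    under eq_bigr do rewrite mul1r.
    rewrite (@big_cat_nat _ _ _ (N j0) 0 (N J))//= ?Nhomo//.
    by rewrite addrAC subrr add0r.
  rewrite (@big_cat_nat _ _ _ j0 0 J)//= addrAC subrr add0r.
  apply: eq_big_nat => j /andP[j0j _].
  have /negbTE j_neq0 : j != 0%N by rewrite -lt0n (leq_trans j00).
  by rewrite /lattice_wt j_neq0 mul1r.
have eb : (24 * T + 2) * pi * eta <= e / 2.
  move: q0 etae; rewrite /q; set B := (24 * T + 2) * pi => B0 etae.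
  have Bp : 0 < B by move: B0; rewrite pmulr_rgt0.
  have -> : e / 2 = B * (e / (2 * B)) by field; rewrite gt_eqF.
  by rewrite ler_wpM2l// ltW.
have vw0 : 0 <= ip v v + ip w w by rewrite addr_ge0 ?ip_ge0.
have lphin : `|phi J| @[J --> \oo] --> `|ip (sum_op1 v - (d * pi) *: v - F v) w|.
  exact: cvg_norm lphi.
apply: (cvgr_to_le lphin).
near=> J.
have j0J : (j0 <= J)%N by near: J; exact: nbhs_infty_ge.
rewrite (le_trans (tail J v w j0J))// ler_wpM2r//.
Unshelve. all: by end_near. Qed.

Theorem sum_op1_compact : seq_compact (fun v => sum_op1 v - (d * pi) *: v).
Proof. exact/approx_seq_compact/sum_op1_approx. Qed.

(** <Z v,v> is a sum of non-negative terms. *)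
Lemma sum_op1_kernel v : nrm (sum_op1 v) = 0 -> forall n, 0 < a n ->
  ip v (c (lam n)) = 0 /\ ip v (s (lam n)) = 0.
Proof.
move=> Sv0 n an.
have l1 := @sum_op_ip (fun=> 1) v v (@unit_weight R).
rewrite -/sum_op1 (nrm_eq0_ip v Sv0) in l1.
have hn : a n * corr v v (lam n) <= 0.
  apply: (cvgr_to_ge l1); near=> m.
  have nm : (n < m)%N by near: m; exact: nbhs_infty_gt.
  rewrite (bigD1_seq n) ?mem_index_iota ?iota_uniq//= mul1r lerDl.
  by rewrite sumr_ge0// => k _; rewrite mul1r mulr_ge0// hat_prod_ge0.
have : corr v v (lam n) <= 0.
  by rewrite -(pmulr_rle0 _ an).
rewrite /hat_prod -!expr2 => hh.
have := sqr_ge0 (ip v (c (lam n))); have := sqr_ge0 (ip v (s (lam n))) => h1 h2.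
split; apply/eqP; rewrite -sqrf_eq0; apply/eqP; lra.
Unshelve. all: by end_near. Qed.

End SumOp.

(** * Functions of exponential type with many zeros *)

Section Interpolation.
Context {R : realType}.

Lemma rolle_step (f f' : R -> R) x s :
  (forall x, is_derive x (1 : R) f (f' x)) -> path <%R x s ->
  (forall z, z \in x :: s -> f z = 0) ->
  exists s', [/\ size s' = size s, path <%R x s' & forall z, z \in s' -> f' z = 0].
Proof.
move=> df; elim: s x => [|y s IH] x /=; first by exists [::].
move=> /andP[xy ys] f0.
have [|s' [ss' ps' fs']] := IH y ys; first by move=> z zs; rewrite f0// inE zs orbT.
have fxy : f x = f y by rewrite !f0 ?inE ?eqxx ?orbT.
have [|xi] := Rolle xy (fun z _ => @ex_derive _ _ _ _ _ _ _ (df z)) _ fxy.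
  apply: derivable_within_continuous => z _; exact: (@ex_derive _ _ _ _ _ _ _ (df z)).
rewrite in_itv/= => /andP[xxi xiy] dxi.
have fxi : f' xi = 0.
  have /@derive_val <- := df xi; exact: derive_val.
exists (xi :: s'); split.
- by rewrite /= ss'.
- rewrite /= xxi/=; case: s' ps' {ss' fs'} => //= h t /andP[yh ->].
  by rewrite (lt_trans xiy).
- by move=> z; rewrite inE => /predU1P[->//|/fs'].
Qed.

Lemma rolle_iter (G : nat -> R -> R) n s :
  (forall k x, is_derive x (1 : R) (G k) (G k.+1 x)) ->
  size s = n.+1 -> sorted <%R s -> (forall z, z \in s -> G 0%N z = 0) ->
  exists xi, G n xi = 0.
Proof.
elim: n G s => [|n IH] G [//|x s] dG /= [sn] xs G0.
  by exists x; rewrite G0// mem_head.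
have [s' [ss' ps' Gs']] := rolle_step (dG 0%N) xs G0.
apply: (IH (fun k => G k.+1) s') => //; first by rewrite ss'.
exact: path_sorted ps'.
Qed.

(** The remainder of the interpolation by the zero polynomial at the points of zs.
With w the monic polynomial vanishing on zs, the function D 0 - l w, where l is
chosen to make it vanish also at y, has one more zero than there are points; by
Rolle its derivative of order the number of points vanishes somewhere. *)
Lemma interpolation_zeros (D : nat -> R -> R) (B T L y : R) (zs : seq R) :
  (forall k x, is_derive x (1 : R) (D k) (D k.+1 x)) -> 0 < T ->
  (forall k x, `|D k x| <= B * T ^+ k) -> uniq zs ->
  (forall z, z \in zs -> D 0%N z = 0) -> (forall z, z \in zs -> `|y - z| <= L) ->
  0 <= L ->
  `|D 0%N y| <= B * (T * L) ^+ size zs / (size zs)`!%:R.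
Proof.
move=> dD T0 DB uzs Dz zL L0; set N := size zs.
have B0 : 0 <= B by have := DB 0%N 0; rewrite expr0 mulr1; apply: le_trans.
have N0 : 0 < N`!%:R :> R by rewrite ltr0n fact_gt0.
have [yz|yz] := boolP (y \in zs).
  by rewrite Dz// normr0 divr_ge0 ?(ltW N0)// mulr_ge0// exprn_ge0// mulr_ge0// ltW.
pose w : {poly R} := \prod_(z <- zs) ('X - z%:P).
have wy : w.[y] != 0.
  by rewrite -/(root w y) root_prod_XsubC.
have wz z : z \in zs -> w.[z] = 0.
  by move=> zzs; apply/eqP; rewrite -/(root w z) root_prod_XsubC.
pose l := D 0%N y / w.[y].
pose G k x := D k x - l * (w^`(k)).[x].
have dG k x : is_derive x (1 : R) (G k) (G k.+1 x).
  rewrite /G derivnS.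
  have h1 := dD k x; have h2 := is_derive_poly (w^`(k)) x.
  have h3 := @is_deriveZ _ _ _ (horner w^`(k)) l _ _ _ h2.
  exact: is_deriveB.
have [||z|xi] := @rolle_iter G N (sort <=%R (y :: zs)) dG.
- by rewrite size_sort.
- by rewrite sort_lt_sorted/= yz.
- rewrite mem_sort inE /G derivn0 => /predU1P[->|zzs].
    by rewrite /l divfK// subrr.
  by rewrite Dz// wz// mulr0 subrr.
have wN : w^`(N) = (N`!%:R)%:P.
  have sw : size w = N.+1 by rewrite size_prod_XsubC.
  have lw : w`_N = 1.
    have /monicP := monic_prod_XsubC zs xpredT id.
    by rewrite /lead_coef sw.
  apply/polyP => i; rewrite coef_derivn coefC.
  case: i => [|i] /=; first by rewrite addn0 lw ffactnn.
  by rewrite nth_default ?mul0rn// sw addnS ltnS leq_addr.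
rewrite /G wN hornerC => /eqP; rewrite subr_eq0 => /eqP Dxi.
have lE : `|l| <= B * T ^+ N / N`!%:R.
  rewrite ler_pdivlMr//.
  have := DB N xi; rewrite Dxi normrM (ger0_norm (ltW N0)); exact: id.
have -> : D 0%N y = l * w.[y] by rewrite /l divfK.
have wL : `|w.[y]| <= L ^+ N.
  rewrite /w horner_prod normr_prod /N.
  elim: zs zL {uzs Dz N N0 yz w wy wz l G dG wN Dxi lE} => [|z zs IH] zL.
    by rewrite big_nil expr0.
  rewrite big_cons exprS ler_pM// ?normr_ge0//.
  - by rewrite prodr_ge0.
  - by rewrite hornerXsubC zL// mem_head.
  - by apply: IH => x xzs; rewrite zL// inE xzs orbT.
rewrite normrM exprMn.
have -> : B * (T ^+ N * L ^+ N) / N`!%:R = B * T ^+ N / N`!%:R * L ^+ N.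
  by field; rewrite gt_eqF.
exact: ler_pM.
Qed.

Lemma expn_fact_le (x : R) n : 0 <= x -> x ^+ n / n`!%:R <= expR x.
Proof.
move=> x0; case: n => [|n].
  by rewrite expr0 fact0 divr1 (le_trans _ (expR_ge1Dx x))// lerDl.
by have := expR_ge1Dxn n x0; lra.
Qed.

Lemma expR1_le4 : expR 1 <= 4 :> R.
Proof.
have := expR_ge1Dx (- 2^-1 : R); rewrite expRN => h.
have e0 := expR_gt0 (2^-1 : R).
have e2 : expR (2^-1 : R) <= 2.
  have : (1 + - 2^-1) * expR (2^-1 : R) <= 1.
    by rewrite -ler_pdivlMr// mul1r.
  lra.
have -> : (1 : R) = 2^-1 + 2^-1 by field.
by rewrite expRD; nra.
Qed.

End Interpolation.

Section Uniqueness.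
Context {R : realType} {V : semiHilbertType R}.
Variables (T : R) (c s : R -> V) (mt : V -> V).
Hypothesis ES : exp_system T c s mt.
Let T0 : 0 < T := es_T0 ES.

(** The coefficients of cosine and sine after k derivations in the frequency. *)
Fixpoint phases (p : R * R) k :=
  if k is k'.+1 then ((phases p k').2, - (phases p k').1) else p.

(** The k-th derivative of y |-> p.1 <v,c_y> + p.2 <v,s_y>. *)
Definition hat_der (p : R * R) v k y :=
  (phases p k).1 * ip (iter k mt v) (c y) + (phases p k).2 * ip (iter k mt v) (s y).

Lemma is_derive_hat_der p v k y :
  is_derive y (1 : R) (hat_der p v k) (hat_der p v k.+1 y).
Proof.
have h1 := es_dc ES (iter k mt v) y; have h2 := es_ds ES (iter k mt v) y.
have h3 := @is_deriveD _ _ _ _ _ _ _ _ _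
  (@is_deriveZ _ _ _ (fun y => ip (iter k mt v) (c y)) (phases p k).1 _ _ _ h1)
  (@is_deriveZ _ _ _ (fun y => ip (iter k mt v) (s y)) (phases p k).2 _ _ _ h2).
apply: trigger_derive h3 _.
by rewrite /hat_der /= /GRing.scale/=; ring.
Qed.

Lemma hat_der_bound p v k y :
  `|hat_der p v k y| <= (`|p.1| + `|p.2|) * Num.sqrt (2 * T) * nrm v * T ^+ k.
Proof.
have ph : `|(phases p k).1| + `|(phases p k).2| = `|p.1| + `|p.2|.
  by elim: k => //= k <-; rewrite normrN addrC.
have it : nrm (iter k mt v) <= nrm v * T ^+ k.
  elim: k {ph} => [|k IH] /=; first by rewrite mulr1.
  rewrite (le_trans (es_mt ES _))// exprS mulrCA ler_wpM2l// ltW//.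
have nc : nrm (c y) <= Num.sqrt (2 * T).
  by rewrite ler_sqrt ?mulr_ge0 ?(ltW T0)// (es_c ES).
have ns : nrm (s y) <= Num.sqrt (2 * T).
  by rewrite ler_sqrt ?mulr_ge0 ?(ltW T0)// (es_s ES).
have hc : `|ip (iter k mt v) (c y)| <= nrm v * T ^+ k * Num.sqrt (2 * T).
  by rewrite (le_trans (cauchy_schwarz _ _))// ler_pM ?nrm_ge0.
have hs : `|ip (iter k mt v) (s y)| <= nrm v * T ^+ k * Num.sqrt (2 * T).
  by rewrite (le_trans (cauchy_schwarz _ _))// ler_pM ?nrm_ge0.
rewrite /hat_der (le_trans (ler_normD _ _))// !normrM -ph.
have := ler_wpM2l (normr_ge0 (phases p k).1) hc.
have := ler_wpM2l (normr_ge0 (phases p k).2) hs.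
lra.
Qed.

(** The k-th derivative is at most B T^k.  With N zeros at distance at most L of y,
the interpolation error is B (T L)^N / N!, which tends to 0 when N is a large
multiple of T L. *)
Lemma hat_der_zeros p v :
  (forall A : R, exists zs (X : R), [/\ uniq zs, A * (X + 1) <= (size zs)%:R, 0 <= X,
     forall z, z \in zs -> 0 <= z <= X &
     forall z, z \in zs -> hat_der p v 0 z = 0]) ->
  forall y, hat_der p v 0 y = 0.
Proof.
move=> zeros y; apply/eqP; rewrite -normr_le0; apply/ler_addgt0Pl => e e0.
rewrite addr0.
pose B := (`|p.1| + `|p.2|) * Num.sqrt (2 * T) * nrm v.
have B0 : 0 <= B by rewrite !mulr_ge0 ?addr_ge0 ?sqrtr_ge0 ?nrm_ge0.
(* the number N of zeros is then at least 8 T L and B / e; the former gives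
   (T L)^N / N! <= exp(N) / 8^N <= 2^-N, and the latter B 2^-N <= e *)
pose A := 8 * T * (1 + `|y|) + B / e.
have [zs [X [uzs Azs X0 zX z0]]] := zeros A.
have A1 : 0 <= 8 * T * (1 + `|y|) by rewrite !mulr_ge0 ?addr_ge0// ltW.
have A2 : 0 <= B / e by rewrite divr_ge0// ltW.
have XB : B / e <= (size zs)%:R.
  apply: le_trans Azs; rewrite /A; nra.
have XL : 8 * (T * (X + `|y|)) <= (size zs)%:R.
  apply: le_trans Azs; rewrite /A.
  have : T * (X + `|y|) <= T * ((1 + `|y|) * (X + 1)).
    by rewrite ler_pM2l//; have := normr_ge0 y; nra.
  nra.
set N := size zs in XL XB *.
have L0 : 0 <= X + `|y| by rewrite addr_ge0.
have zL z : z \in zs -> `|y - z| <= X + `|y|.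
  move=> /zX/andP[z1 z2]; rewrite (le_trans (ler_normB _ _))// addrC lerD2r.
  by rewrite ger0_norm.
have := interpolation_zeros (is_derive_hat_der p v) T0 (hat_der_bound p v) uzs z0 zL L0.
rewrite -/B -/N => /le_trans; apply.
set L := T * (X + `|y|) in XL *.
have LT0 : 0 <= L by rewrite mulr_ge0// ltW.
have h : L ^+ N / N`!%:R <= 2^-1 ^+ N.
  have h8 : (8 * L) ^+ N / N`!%:R <= 4 ^+ N.
    apply: le_trans (expn_fact_le N _) _; first by rewrite mulr_ge0.
    apply: le_trans (_ : expR N%:R <= _); first by rewrite ler_expR.
    rewrite -[N%:R]mulr1 expRM_natl lerXn2r ?nnegrE ?expR_ge0//.
    exact: expR1_le4.
  have e8 : (8 : R) ^+ N * 2^-1 ^+ N = 4 ^+ N.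
    by rewrite -exprMn; congr (_ ^+ _); field.
  have p8 : 0 < (8 : R) ^+ N by rewrite exprn_gt0.
  by rewrite -(ler_pM2l p8) e8 mulrA -exprMn.
rewrite -mulrA (le_trans (ler_wpM2l B0 h))//.
rewrite exprVn ler_pdivrMr ?exprn_gt0//.
rewrite mulrC -ler_pdivrMr// (le_trans XB)//.
have -> : (2 : R) ^+ N = (2 ^ N)%:R by rewrite natrX.
by rewrite ler_nat ltnW// ltn_expl.
Qed.

Lemma exp_uniqueness v :
  (forall A : R, exists zs (X : R), [/\ uniq zs, A * (X + 1) <= (size zs)%:R, 0 <= X,
     forall z, z \in zs -> 0 <= z <= X &
     forall z, z \in zs -> ip v (c z) = 0 /\ ip v (s z) = 0]) ->
  nrm v = 0.
Proof.
move=> zeros.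
have hc y : ip v (c y) = 0.
  have := @hat_der_zeros (1, 0) v _ y; rewrite /hat_der /= mul1r mul0r addr0.
  apply=> A; have [zs [X [? ? ? ? z0]]] := zeros A; exists zs, X; split => // z zz.
  by rewrite mul1r mul0r addr0 (z0 _ zz).1.
have hs y : ip v (s y) = 0.
  have := @hat_der_zeros (0, 1) v _ y; rewrite /hat_der /= mul1r mul0r add0r.
  apply=> A; have [zs [X [? ? ? ? z0]]] := zeros A; exists zs, X; split => // z zz.
  by rewrite mul1r mul0r add0r (z0 _ zz).2.
have eta0 : 0 < pi / T by rewrite divr_gt0 ?pi_gt0.
have etaT : pi / T * T <= pi by rewrite divfK// gt_eqF.
have lim0 := @es_parseval _ _ _ _ _ _ ES v _ eta0 etaT.
have vv0 : pi / (pi / T) * ip v v = 0.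
  rewrite -(cvg_lim _ lim0)//.
  rewrite (_ : (fun n => _) = fun=> 0) ?lim_cst//.
  apply/funext => n; rewrite big1// => j _.
  by rewrite hc hs expr0n addr0 mulr0.
move/eqP : vv0; rewrite mulf_eq0 gt_eqF ?divr_gt0 ?pi_gt0//= => /eqP vv0.
by rewrite /nrm vv0 sqrtr0.
Qed.

End Uniqueness.

(** * The density of a sifted set *)

Section Counting.
Context {R : realType}.
Implicit Types (K P Q : set nat) (n m N : nat).

Definition count_upto K N : R := \sum_(1 <= n < N.+1) (n \in K)%:R.

Definition has_density K (d : R) := forall e, 0 < e -> exists N0, forall N,
  (N0 <= N)%N -> `|count_upto K N - d * N%:R| <= e * N%:R.

Lemma count_upto_ge0 K N : 0 <= count_upto K N.
Proof. exact: sumr_ge0. Qed.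

Lemma count_uptoS K N : count_upto K N.+1 = count_upto K N + (N.+1 \in K)%:R.
Proof. by rewrite /count_upto big_nat_recr. Qed.

Lemma count_upto_le K N : count_upto K N <= N%:R.
Proof.
elim: N => [|N IH]; first by rewrite /count_upto big_geq.
by rewrite count_uptoS -natr1 lerD// lern1 leq_b1.
Qed.

Lemma le_count_upto K K' N : K `<=` K' -> count_upto K N <= count_upto K' N.
Proof.
move=> KK'; apply: ler_sum => n _; rewrite ler_nat.
by case: (boolP (n \in K)) => // /set_mem/KK' Kn; rewrite mem_set.
Qed.

Lemma count_multiples K p N : (0 < p)%N ->
  \sum_(1 <= n < N.+1) ((p %| n)%N && ((n %/ p)%N \in K))%:R = count_upto K (N %/ p) :> R.
Proof.
move=> p0; elim: N => [|N IH]; first by rewrite div0n /count_upto !big_geq.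
rewrite big_nat_recr//= IH divnS//.
have [pN|pN] := boolP (p %| N.+1)%N; last by rewrite add0n addr0.
by rewrite add1n count_uptoS.
Qed.

Section Sieve.
Variable P : set nat.
Hypothesis Pprime : P `<=` primes_set.

Definition sifted m : set nat :=
  [set n | (0 < n)%N /\ forall p, (p < m)%N -> P p -> ~~ (p %| n)%N].
Definition fully_sifted : set nat :=
  [set n | (0 < n)%N /\ forall p, P p -> ~~ (p %| n)%N].

Definition prime_wt p : R := if p \in P then p%:R^-1 else 0.

Lemma prime_wt_itv p : 0 <= prime_wt p <= 2^-1.
Proof.
rewrite /prime_wt; case: ifPn => [/set_mem/Pprime/prime_gt1 p1|_]; last first.
  by rewrite lexx invr_ge0 ler0n.
rewrite invr_ge0 ler0n/= lef_pV2 ?posrE ?ltr0n ?(ltn_trans _ p1)//.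
by rewrite ler_nat.
Qed.

Definition sieve_density m : R := \prod_(0 <= p < m) (1 - prime_wt p).

Lemma sieve_densityS m : sieve_density m.+1 = sieve_density m * (1 - prime_wt m).
Proof. by rewrite /sieve_density big_nat_recr. Qed.

Lemma sieve_density_itv m : 0 <= sieve_density m <= 1.
Proof.
elim: m => [|m /andP[d0 d1]]; first by rewrite /sieve_density big_geq// ler01 lexx.
by rewrite sieve_densityS; have /andP[w0 w1] := prime_wt_itv m; nra.
Qed.

(** Legendre's sieve: removing the multiples of one more prime m replaces the count
at N by its difference with the count at N / m. *)
Lemma count_sifted m : exists E, 0 <= E /\ forall N,
  `|count_upto (sifted m) N - sieve_density m * N%:R| <= E.
Proof.
elim: m => [|m [E [E0 IH]]].
  exists 0; split => // N; rewrite /sieve_density big_geq// mul1r.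
  rewrite (_ : count_upto _ N = N%:R) ?subrr ?normr0//.
  elim: N => [|N IHN]; first by rewrite /count_upto big_geq.
  by rewrite count_uptoS IHN mem_set ?natr1//; split.
have [Pm|Pm] := boolP (m \in P); last first.
  exists E; split => // N; rewrite sieve_densityS /prime_wt (negbTE Pm) subr0 mulr1.
  rewrite (_ : sifted m.+1 = sifted m); first exact: IH.
  apply/seteqP; split => n [n0 nP]; split => // p pm Pp.
    by apply: nP => //; rewrite ltnS ltnW.
  move: pm; rewrite ltnS leq_eqVlt => /predU1P[pm|pm]; last exact: nP.
  by move: Pm; rewrite notin_setE -pm.
have mprime : prime m by apply: Pprime; exact: set_mem.
have m0 : (0 < m)%N := prime_gt0 mprime.
have mR : 0 < m%:R :> R by rewrite ltr0n.
have cE N : count_upto (sifted m.+1) N =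
    count_upto (sifted m) N - count_upto (sifted m) (N %/ m).
  apply/eqP; rewrite eq_sym subr_eq -(count_multiples _ _ m0) -big_split/=.
  apply/eqP; apply: eq_big_nat => n /andP[n0 _].
  have [mn|mn] /= := boolP (m %| n)%N.
    have -> : (n \in sifted m.+1) = false.
      apply/negP => /set_mem[_ /(_ m (ltnSn m) (set_mem Pm))].
      by rewrite mn.
    rewrite add0r; congr (_%:R); congr nat_of_bool.
    apply/idP/idP => /set_mem[k0 kP]; apply/mem_set; split.
    - by rewrite divn_gt0// dvdn_leq.
    - move=> p pm Pp; apply: contra (kP p pm Pp) => pn.
      by rewrite -(divnK mn) dvdn_mulr.
    - by [].
    - move=> p pm Pp; rewrite -(divnK mn) Euclid_dvdM; last exact: Pprime.
      rewrite negb_or kP//= dvdn_prime2//; last exact: Pprime.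
      by rewrite neq_ltn pm.
  rewrite addr0; congr (_%:R); congr nat_of_bool.
  apply/idP/idP => /set_mem[k0 kP]; apply/mem_set; split => // p pm Pp.
    move: pm; rewrite ltnS leq_eqVlt => /predU1P[->//|pm]; exact: kP.
  by apply: kP => //; rewrite ltnS ltnW.
exists (2 * E + 1); split => [|N]; first lra.
rewrite cE sieve_densityS /prime_wt Pm.
have h1 := IH N; have h2 := IH (N %/ m)%N.
have /andP[d0 d1] := sieve_density_itv m.
set d := sieve_density m in h1 h2 d0 d1 *.
have h3 : `|(N %/ m)%:R - N%:R / m%:R| <= 1 :> R.
  have -> : N%:R = (N %/ m)%:R * m%:R + (N %% m)%:R :> R.
    by rewrite -natrM -natrD -divn_eq.
  rewrite mulrDl mulfK ?gt_eqF// opprD addNKr normrN ger0_norm ?divr_ge0//.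
  by rewrite ler_pdivrMr// mul1r ler_nat ltnW// ltn_mod.
set A := count_upto _ _ in h1 *; set B := count_upto _ _ in h2 *.
have -> : A - B - d * (1 - m%:R^-1) * N%:R = (A - d * N%:R) -
   (B - d * (N %/ m)%:R) - d * ((N %/ m)%:R - N%:R / m%:R).
  by field; rewrite gt_eqF.
rewrite (le_trans (ler_normB _ _))// lerD//; last first.
  by rewrite normrM (ger0_norm d0) mulr_ile1.
by rewrite (le_trans (ler_normB _ _))//; lra.
Qed.

Lemma sieve_density_le_exp m :
  sieve_density m <= expR (- \sum_(0 <= p < m) prime_wt p).
Proof.
elim: m => [|m IH]; first by rewrite /sieve_density !big_geq// oppr0 expR0.
rewrite sieve_densityS big_nat_recr//= opprD expRD ler_pM//.
- by case/andP: (sieve_density_itv m).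
- by have /andP[] := prime_wt_itv m; lra.
- by have := expR_ge1Dx (- prime_wt m); lra.
Qed.

(** 1 - x >= exp(-2 x) for 0 <= x <= 1/2. *)
Lemma sieve_density_ge_exp m :
  expR (- 2 * \sum_(0 <= p < m) prime_wt p) <= sieve_density m.
Proof.
elim: m => [|m IH]; first by rewrite /sieve_density !big_geq// mulr0 expR0.
have /andP[w0 w1] := prime_wt_itv m.
rewrite sieve_densityS big_nat_recr//= mulrDr expRD ler_pM ?expR_ge0//.
rewrite mulNr expRN invf_ple ?posrE ?expR_gt0//; last by lra.
rewrite (le_trans _ (expR_ge1Dx _))//.
by rewrite -[leLHS]mul1r ler_pdivrMr; nra.
Qed.

Lemma sieve_density_nincr : {homo sieve_density : m n / (m <= n)%N >-> n <= m}.
Proof.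
apply/nonincreasing_seqP => m; rewrite sieve_densityS.
by have := prime_wt_itv m; have := sieve_density_itv m; nra.
Qed.

Definition sift_density : R := limn sieve_density.

Lemma sieve_density_cvg : sieve_density @ \oo --> sift_density.
Proof.
apply: nonincreasing_is_cvgn; first exact: sieve_density_nincr.
by exists 0 => _ [n _ <-]; case/andP: (sieve_density_itv n).
Qed.

Lemma sift_density_itv : 0 <= sift_density <= 1.
Proof.
apply/andP; split.
  apply: (cvgr_to_ge sieve_density_cvg); near=> m.
  by case/andP: (sieve_density_itv m).
apply: (cvgr_to_le sieve_density_cvg); near=> m.
by case/andP: (sieve_density_itv m).
Unshelve. all: by end_near. Qed.

Lemma sift_density_le m : sift_density <= sieve_density m.
Proof. 
apply: (cvgr_to_le sieve_density_cvg); near=> n.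
by apply: sieve_density_nincr; near: n; exact: nbhs_infty_ge.
Unshelve. all: by end_near. Qed.

(** An integer that survives the primes below m but not all of them is a multiple of
a prime between m and N. *)
Lemma count_fully_sifted m N :
  count_upto (sifted m) N - count_upto fully_sifted N <=
    N%:R * \sum_(m <= p < maxn m N.+1) prime_wt p.
Proof.
rewrite /count_upto -sumrB.
apply: le_trans (_ : \sum_(1 <= n < N.+1) \sum_(m <= p < maxn m N.+1)
    ((p \in P) && (p %| n)%N)%:R <= _).
  rewrite !big_nat; apply: ler_sum => n /andP[n0 nN].
  have [ns|ns] := boolP (n \in sifted m); last first.
    rewrite sub0r (le_trans (_ : _ <= 0))// ?oppr_le0//; exact: sumr_ge0.
  have [nf|nf] := boolP (n \in fully_sifted); first by rewrite subrr sumr_ge0.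
  rewrite subr0.
  have [p [Pp pn]] : exists p, P p /\ (p %| n)%N.
    apply: contrapT => h; move: nf; rewrite notin_setE; apply; split => // p Pp.
    by apply/negP => pn; apply: h; exists p.
  have pm : (m <= p)%N.
    rewrite leqNgt; apply/negP => pm; move/set_mem : ns => [_ /(_ p pm Pp)].
    by rewrite pn.
  have pN : (p < maxn m N.+1)%N.
    by rewrite leq_max ltnS (leq_trans (dvdn_leq n0 pn)) ?orbT// -ltnS.
  rewrite (bigD1_seq p) ?mem_index_iota ?pm ?iota_uniq//= (mem_set Pp) pn lerDl.
  exact: sumr_ge0.
rewrite exchange_big/= mulr_sumr; apply: ler_sum => p _.
rewrite /prime_wt; case: ifPn => [/set_mem Pp|_]; last by rewrite mulr0 big1.
have p0 : (0 < p)%N by exact: prime_gt0 (Pprime Pp).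
have := @count_multiples setT p N p0; rewrite /=.
under eq_bigr do rewrite in_setT andbT.
move=> ->; rewrite (le_trans (count_upto_le _ _))// ler_pdivlMr ?ltr0n//.
by rewrite -natrM ler_nat leq_trunc_div.
Qed.

Definition prime_sum_bounded := exists B, forall m, \sum_(0 <= p < m) prime_wt p <= B.

Lemma sift_density_gt0 : 0 < sift_density <-> prime_sum_bounded.
Proof.
split=> [d0|[B SB]].
  exists (- ln sift_density) => m; rewrite lerNr -ler_expR.
  rewrite lnK ?posrE//.
  exact: le_trans (sift_density_le m) (sieve_density_le_exp m).
apply: lt_le_trans (expR_gt0 (- 2 * B)) _.
apply: (cvgr_to_ge sieve_density_cvg); near=> m.
apply: le_trans (sieve_density_ge_exp m); rewrite ler_expR.
by have := SB m; lra.
Unshelve. all: by end_near. Qed.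

Lemma sift_density_eq0 : ~ prime_sum_bounded -> sift_density = 0.
Proof.
move=> nb; apply/eqP; rewrite eq_le (andP sift_density_itv).1 andbT leNgt.
by apply/negP => /sift_density_gt0.
Qed.

(** Truncating the sieve at m always gives an upper bound for the count.  For the
lower bound, either the density is zero and there is nothing to prove, or the sum
of 1/p converges and the integers removed after m are few. *)
Theorem fully_sifted_density : has_density fully_sifted sift_density.
Proof.
move=> e e0; have e3 : 0 < e / 3 by rewrite divr_gt0.
suff [m [mE mT]] : exists m, sieve_density m - sift_density <= e / 3 /\
    forall N, (sift_density - e / 3) * N%:R - `|count_upto (sifted m) N - sieve_density m * N%:R|
      <= count_upto fully_sifted N.
  have [E [E0 EP]] := count_sifted m.
  exists (Num.truncn (E / (e / 3))).+1 => N NE.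
  have EN : E <= e / 3 * N%:R.
    rewrite mulrC -ler_pdivrMr// ltW// (lt_le_trans (truncnS_gt _))// ler_nat//.
  have := EP N; have := mT N; have := @le_count_upto fully_sifted (sifted m) N.
  have -> : (fully_sifted `<=` sifted m) = True.
    by apply/propext; split => // _ n [n0 nP]; split => // p _; exact: nP.
  move=> /(_ Logic.I).
  have N0 : 0 <= N%:R :> R by [].
  have := ler_wpM2r N0 mE.
  move=> h1 h2 h3 h4.
  have /andP[h5 h6] : - E <= count_upto (sifted m) N - sieve_density m * N%:R <= E.
    by rewrite -ler_norml.
  rewrite ler_norml; apply/andP; split; lra.
have [b|nb] := pselect prime_sum_bounded; last first.
  have d0 := sift_density_eq0 nb.
  have /cvgrPdist_le/(_ _ e3)[m _ /(_ m (leqnn m))/=] := sieve_density_cvg.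
  rewrite d0 => h; exists m; split.
    by move: h; rewrite ler_norml => /andP[]; lra.
  move=> N; have := count_upto_ge0 fully_sifted N; have N0 : 0 <= N%:R :> R by [].
  have := mulr_ge0 (ltW e3) N0.
  have := normr_ge0 (count_upto (sifted m) N - sieve_density m * N%:R); lra.
have wc : cvgn (fun m => \sum_(0 <= p < m) prime_wt p).
  apply: nondecreasing_is_cvgn.
    apply/nondecreasing_seqP => k; rewrite big_nat_recr//= lerDl.
    by case/andP: (prime_wt_itv k).
  by have [B SB] := b; exists B => _ [k _ <-].
have e6 : 0 < e / 6 by rewrite divr_gt0.
near \oo => m; exists m; split.
  have : `|sift_density - sieve_density m| <= e / 3.
    by near: m; have /cvgrPdist_le := sieve_density_cvg; exact.
  by rewrite ler_norml => /andP[]; lra.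
have wm k : (m <= k)%N -> \sum_(m <= p < k) prime_wt p <= e / 3.
  move=> mk; have -> : \sum_(m <= p < k) prime_wt p =
      \sum_(0 <= p < k) prime_wt p - \sum_(0 <= p < m) prime_wt p.
    by rewrite (@big_cat_nat _ _ _ m 0 k)//= addrAC subrr add0r.
  set l := limn (fun m => \sum_(0 <= p < m) prime_wt p).
  have h1 : `|l - \sum_(0 <= p < m) prime_wt p| <= e / 6.
    by near: m; have /cvgrPdist_le := wc; exact.
  have h2 : \sum_(0 <= p < k) prime_wt p <= l.
    apply: (nondecreasing_cvgn_le _ wc).
    apply/nondecreasing_seqP => k'; rewrite big_nat_recr//= lerDl.
    by case/andP: (prime_wt_itv k').
  by move: h1; rewrite ler_norml => /andP[]; lra.
move=> N.
have := count_fully_sifted m N; have N0 : 0 <= N%:R :> R by [].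
have := ler_wpM2l N0 (wm _ (leq_maxl m N.+1)).
have := ler_wpM2r N0 (sift_density_le m).
have := ler_norm (sieve_density m * N%:R - count_upto (sifted m) N).
rewrite distrC; lra.
Unshelve. all: by end_near. Qed.

End Sieve.
End Counting.

(** * The logarithms of a set with a density *)

Section DensityBlocks.
Context {R : realType}.
Variables (K : set nat) (d : R).
Hypotheses (Kd : has_density K d) (d01 : 0 <= d <= 1).

Definition log_wt n : R := (n \in K)%:R / n%:R.

Lemma log_wt_ge0 n : 0 <= log_wt n.
Proof. by rewrite divr_ge0. Qed.

Lemma expR_small (x : R) : 0 <= x -> x <= 3^-1 -> expR x <= 1 + x + x ^+ 2.
Proof.
move=> x0 x3.
have h := expR_ge1Dx (- (x / 2)); rewrite expRN in h.
set E := expR (x / 2) in h.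
have E0 : 0 < E := expR_gt0 _.
have EE : expR x = E * E by rewrite -expRD -splitr.
have hE : E * (1 - x / 2) <= 1.
  by have := ler_wpM2l (ltW E0) h; rewrite mulfV ?gt_eqF.
have y0 : 0 < 1 - x / 2 by lra.
have : E * E * (1 - x / 2) ^+ 2 <= 1.
  have h0 : 0 <= E * (1 - x / 2) by rewrite mulr_ge0 ?ltW.
  rewrite (_ : _ * _ = (E * (1 - x / 2)) ^+ 2); last by ring.
  by rewrite expr_le1.
have : 1 <= (1 + x + x ^+ 2) * (1 - x / 2) ^+ 2.
  have -> : (1 + x + x ^+ 2) * (1 - x / 2) ^+ 2 = 1 + x ^+ 2 / 4 * (1 - 3 * x + x ^+ 2).
    by field.
  rewrite lerDl mulr_ge0 ?divr_ge0 ?sqr_ge0//.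
  by have := sqr_ge0 x; lra.
move=> h1 h2; rewrite EE -(ler_pM2r (exprn_gt0 2 y0)).
exact: le_trans h2 h1.
Qed.

Lemma expRN_small (x : R) : 0 <= x -> expR (- x) <= 1 - x + x ^+ 2.
Proof.
move=> x0; rewrite expRN; have h := expR_ge1Dx x.
have x1 : 0 < 1 + x by lra.
apply: le_trans (_ : (1 + x)^-1 <= _).
  by rewrite lef_pV2 ?posrE ?expR_gt0.
by rewrite -[leLHS]mul1r ler_pdivrMr//; nra.
Qed.

(** The j-th block of integers is the interval from exp(eta j) to exp(eta (j + 1)). *)
Definition block_end (eta : R) j := (Num.truncn (expR (eta * j%:R))).

Lemma block_end_homo eta : 0 < eta -> {homo block_end eta : i j / (i <= j)%N}.
Proof.
move=> eta0 i j ij; apply: le_truncn; rewrite ler_expR ler_pM2l// ler_nat//.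
Qed.

Lemma block_end_itv eta j : expR (eta * j%:R) - 1 <= (block_end eta j)%:R <= expR (eta * j%:R).
Proof.
have := truncn_itv (expR_ge0 (eta * j%:R)) => /andP[h1 h2].
by rewrite /block_end h1 andbT lerBlDr natr1 ltW.
Qed.

Lemma block_endP eta j n : ((block_end eta j).+1 <= n)%N -> 0 < n%:R :> R /\ eta * j%:R <= ln (n%:R : R).
Proof.
move=> jn; have n0 : 0 < n%:R :> R by rewrite ltr0n (leq_trans _ jn).
split => //; rewrite -ler_expR lnK ?posrE// ltW//.
by rewrite (lt_le_trans (truncnS_gt _))// ler_nat.
Qed.

Lemma block_endPlt eta j n : (0 < n)%N -> (n < (block_end eta j).+1)%N -> ln (n%:R : R) <= eta * j%:R.
Proof.
move=> n0 nj; have nR : 0 < n%:R :> R by rewrite ltr0n.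
rewrite -ler_expR lnK ?posrE//.
have /andP[_] := block_end_itv eta j; apply: le_trans.
by rewrite ler_nat -ltnS.
Qed.

Lemma count_block eta e : 0 < eta -> eta <= 3^-1 -> 0 < e -> exists j0, forall j, (j0 <= j)%N ->
  `|count_upto K (block_end eta j) - d * expR (eta * j%:R)| <= e * expR (eta * j%:R).
Proof.
move=> eta0 eta3 e0.
have e2 : 0 < e / 2 by rewrite divr_gt0.
have [N0 NP] := Kd e2.
pose Y := (N0%:R + 1 + 2 / e) : R.
have e20 : 0 < 2 / e by rewrite divr_gt0.
have Y0 : 0 < Y by have := ler0n R N0; rewrite /Y; lra.
exists (Num.truncn (Y / eta)).+1 => j jP.
set x := expR _.
have xY : Y <= x.
  have : Y <= eta * j%:R.
    rewrite mulrC -ler_pdivrMr// ltW// (lt_le_trans (truncnS_gt _))//.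
    by rewrite ler_nat.
  by move=> /le_trans; apply; have := expR_ge1Dx (eta * j%:R); rewrite -/x; lra.
have /andP[m1 m2] := block_end_itv eta j; rewrite -/x in m1 m2.
set M := block_end eta j in m1 m2 *.
have MN : (N0 <= M)%N by rewrite -(ler_nat R); rewrite /Y in xY; lra.
have xe : 1 <= e / 2 * x.
  rewrite mulrC -ler_pdivrMr// (_ : 1 / (e / 2) = 2 / e); last by field; rewrite gt_eqF.
  by apply: le_trans xY; rewrite /Y lerDr addr_ge0.
have /andP[d0 d1] := d01.
have := NP M MN; rewrite !ler_norml => /andP[h1 h2].
have h3 := ler_wpM2l (ltW e2) m2.
have h4 := ler_wpM2l d0 m2.
have h5 : d * (x - 1) <= d * M%:R by rewrite ler_wpM2l.
apply/andP; split; lra.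
Qed.

(** In the j-th block, K has about d exp(eta j) (exp(eta) - 1) elements, each with a
weight between exp(-eta (j + 1)) and exp(-eta j). *)
Theorem log_wt_regular : block_regular log_wt (fun n => ln (n%:R : R)) d.
Proof.
move=> eta eta0 eta3.
have e0 : 0 < eta ^+ 2 / 3 by rewrite divr_gt0// exprn_gt0.
have [j0 jP] := count_block eta0 eta3 e0.
exists (fun j => (block_end eta j).+1), j0; split.
- by move=> i j ij; rewrite ltnS block_end_homo.
- move=> n; exists (Num.truncn (n%:R / eta)).+1; apply: leqW.
  rewrite -(ler_nat R).
  have /andP[h _] := block_end_itv eta (Num.truncn (n%:R / eta)).+1.
  apply: le_trans h; rewrite lerBrDr.
  have h2 := expR_ge1Dx (eta * (Num.truncn (n%:R / eta)).+1%:R).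
  apply: le_trans h2; rewrite addrC lerD2l.
  by rewrite mulrC -ler_pdivrMr// ltW// truncnS_gt.
- move=> j n /andP[n1 n2].
  have [n0 h1] := block_endP n1.
  rewrite h1 (le_trans (block_endPlt _ n2)) ?(leq_trans _ n1)//.
  by rewrite -natr1 mulrDr mulr1.
move=> j jj0.
set x := expR (eta * j%:R).
have x0 : 0 < x := expR_gt0 _.
have xS : expR (eta * j.+1%:R) = x * expR eta.
  by rewrite -natr1 mulrDr mulr1 expRD.
pose D : R := \sum_((block_end eta j).+1 <= n < (block_end eta j.+1).+1) (n \in K)%:R.
have DE : D = count_upto K (block_end eta j.+1) - count_upto K (block_end eta j).
  rewrite /D /count_upto (@big_cat_nat _ _ _ (block_end eta j).+1 1 _)//=.
    by rewrite addrAC subrr add0r.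
  by rewrite ltnS block_end_homo.
set S := \sum_(_ <= n < _) log_wt n.
have q1 := expR_small (ltW eta0) eta3.
have q2 := expRN_small (ltW eta0).
set q := expR eta in xS q1.
have q0 : 0 < q := expR_gt0 _.
rewrite expRN -/q in q2.
have Sup : S * x <= D.
  rewrite /S /D mulr_suml !big_nat; apply: ler_sum => n /andP[n1 n2].
  have [n0 h1] := block_endP n1.
  rewrite /log_wt -mulrA ler_piMr// mulrC ler_pdivrMr// mul1r.
  by rewrite -[leRHS]lnK ?posrE// ler_expR.
have Sdown : D <= S * (x * q).
  rewrite /S /D mulr_suml !big_nat; apply: ler_sum => n /andP[n1 n2].
  have [n0 h1] := block_endP n1.
  rewrite /log_wt -mulrA ler_peMr// mulrC ler_pdivlMr// mul1r -xS.
  rewrite -[leLHS]lnK ?posrE// ler_expR block_endPlt// (leq_trans _ n1)//.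
have h1 := jP _ jj0; have h2 := jP _ (leqW jj0).
rewrite xS -/x in h1 h2.
have /andP[d0 d1] := d01.
rewrite !ler_norml in h1 h2; move/andP : h1 => [h1 h1']; move/andP : h2 => [h2 h2'].
set r := eta ^+ 2 / 3 in h1 h1' h2 h2' e0.
have rE : eta ^+ 2 = 3 * r by rewrite /r; field.
have D1 : D <= x * (d * (q - 1) + r * (q + 1)) by rewrite DE; lra.
have D2 : x * (d * (q - 1) - r * (q + 1)) <= D by rewrite DE; lra.
have q3 : q <= 2 by have := sqr_ge0 eta; nra.
have S1 : S <= d * (q - 1) + r * (q + 1).
  by rewrite -(ler_pM2r x0) (le_trans Sup)// mulrC.
have S2 : d * (1 - q^-1) - r * (1 + q^-1) <= S.
  have xq0 : 0 < x * q by rewrite mulr_gt0.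
  rewrite -(ler_pM2r xq0) (le_trans _ Sdown)// (le_trans _ D2)//.
  rewrite le_eqVlt; apply/orP; left; apply/eqP; field.
  by rewrite gt_eqF.
rewrite ler_norml; apply/andP; split.
  have qv : q^-1 <= 1 by have := sqr_ge0 eta; nra.
  have qv0 : 0 < q^-1 by rewrite invr_gt0.
  nra.
nra.
Qed.

(** K has about d N elements up to N, and their logarithms lie in [0, log N]. *)
Lemma density_many_logs (A : R) : 0 < d -> exists zs (X : R),
  [/\ uniq zs, A * (X + 1) <= (size zs)%:R, 0 <= X,
     forall z, z \in zs -> 0 <= z <= X &
     forall z, z \in zs -> exists2 n, z = ln (n%:R : R) & 0 < log_wt n].
Proof.
move=> d0; have d2 : 0 < d / 2 by rewrite divr_gt0.
have [N0 NP] := Kd d2.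
pose B := `|A|.
pose k := (Num.truncn (6 * B / d) + N0).+1.
(* for a square, log N <= 2 k is obviously negligible with respect to N *)
pose N := (k ^ 2)%N.
have k0 : (0 < k)%N by [].
have N0' : (0 < N)%N by rewrite expn_gt0.
have NN0 : (N0 <= N)%N.
  rewrite /N (leq_trans _ (leq_pexp2l k0 (isT : (1 <= 2)%N)))// expn1 /k.
  by rewrite leqW// leq_addl.
pose zs := [seq ln (n%:R : R) | n <- [seq n <- iota 1 N | n \in K]].
exists zs, (ln (N%:R : R)).
have NR : 0 < N%:R :> R by rewrite ltr0n.
have lnN0 : 0 <= ln (N%:R : R) by rewrite ln_ge0// ler1n.
split => //.
- rewrite map_inj_in_uniq; first by rewrite filter_uniq// iota_uniq.
  move=> m n; rewrite !mem_filter !mem_iota => /andP[_ /andP[m0 _]] /andP[_ /andP[n0 _]].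
  by move/ln_inj => /(_ _ _)/eqP; rewrite !posrE !ltr0n m0 n0 eqr_nat => /(_ isT isT)/eqP.
- have szE : (size zs)%:R = count_upto K N :> R.
    rewrite size_map size_filter /count_upto /index_iota subSS subn0.
    elim: (iota 1 N) => [|n s IH]; first by rewrite big_nil.
    by rewrite big_cons /= natrD IH.
  have := NP N NN0; rewrite szE ler_norml => /andP[h _].
  have lnk : ln (N%:R : R) <= 2 * k%:R.
    rewrite /N natrX lnXn ?ltr0n// mulr_natl lerMn2r/= ltW//.
    by rewrite ln_sublinear// ltr0n.
  have AB : A <= B by rewrite ler_norm.
  have B0 : 0 <= B by exact: normr_ge0.
  have k1 : 1 <= k%:R :> R by rewrite ler1n.
  have kB : 6 * B <= d * k%:R.
    rewrite [d * _]mulrC -ler_pdivrMr// ltW// (lt_le_trans (truncnS_gt _))//.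
    by rewrite ler_nat ltnS leq_addr.
  have NE : N%:R = k%:R ^+ 2 :> R by rewrite /N natrX.
  rewrite NE in h lnN0 lnk *.
  apply: le_trans (_ : B * (3 * k%:R) <= _).
    apply: le_trans (_ : B * (ln (k%:R ^+ 2) + 1) <= _).
      by rewrite ler_wpM2r// addr_ge0.
    by rewrite ler_wpM2l//; lra.
  have := ler_wpM2r (ler0n R k) kB; lra.
- move=> z /mapP[n]; rewrite mem_filter mem_iota => /andP[_ /andP[n0 nN]] ->.
  rewrite ln_ge0 ?ler1n//= ler_ln ?posrE ?ltr0n// ler_nat.
  by move: nN; rewrite add1n ltnS.
- move=> z /mapP[n]; rewrite mem_filter mem_iota => /andP[nK /andP[n0 nN]] ->.
  by exists n => //; rewrite /log_wt nK mul1r invr_gt0 ltr0n.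
Qed.

End DensityBlocks.

(** * The Dirichlet series of a set with a density *)

Section RealZeta.
Context {R : realType}.
Implicit Types (K J Q : set nat) (sigma : R).

(** The power n^-sigma. *)
Definition npow sigma n : R := expR (- sigma * ln (n%:R : R)).

Lemma npow_gt0 sigma n : 0 < npow sigma n. Proof. exact: expR_gt0. Qed.

Lemma npow1 sigma : npow sigma 1 = 1.
Proof. by rewrite /npow ln1 mulr0 expR0. Qed.

Lemma npowM sigma m n : (0 < m)%N -> (0 < n)%N ->
  npow sigma (m * n) = npow sigma m * npow sigma n.
Proof.
by move=> m0 n0; rewrite /npow natrM lnM ?posrE ?ltr0n// mulrDr expRD.
Qed.

Lemma npow_nincr sigma m n : 0 <= sigma -> (0 < m)%N -> (m <= n)%N ->
  npow sigma n <= npow sigma m.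
Proof.
move=> s0 m0 mn; rewrite ler_expR !mulNr lerN2 ler_wpM2l//.
by rewrite ler_ln ?posrE ?ltr0n ?(leq_trans m0)// ler_nat.
Qed.

Definition zeta_part K sigma N : R := \sum_(1 <= n < N.+1) (n \in K)%:R * npow sigma n.

Lemma zeta_partS K sigma N :
  zeta_part K sigma N.+1 = zeta_part K sigma N + (N.+1 \in K)%:R * npow sigma N.+1.
Proof. by rewrite /zeta_part big_nat_recr. Qed.

Lemma zeta_part_homo K sigma : {homo zeta_part K sigma : m n / (m <= n)%N >-> m <= n}.
Proof.
apply/nondecreasing_seqP => n; rewrite zeta_partS lerDl mulr_ge0//.
by rewrite ltW// npow_gt0.
Qed.

(** Comparison of the series with the integral of x^-sigma, in the form of a
telescoping sum. *)
Lemma npow_telescope sigma n : 1 < sigma -> (0 < n)%N ->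
  (sigma - 1) * npow sigma n.+1 <= npow (sigma - 1) n - npow (sigma - 1) n.+1.
Proof.
move=> s1 n0; set de := sigma - 1.
have de0 : 0 < de by rewrite subr_gt0.
have n0R : 0 < n%:R :> R by rewrite ltr0n.
have nS0 : 0 < n.+1%:R :> R by [].
have -> : npow de n = npow de n.+1 * expR (de * (ln n.+1%:R - ln n%:R)).
  by rewrite /npow -expRD; congr expR; ring.
have -> : npow sigma n.+1 = npow de n.+1 * n.+1%:R^-1.
  rewrite /npow -[in RHS](lnK nS0) -expRN -expRD; congr expR.
  by rewrite lnK// /de; ring.
have lnS : n.+1%:R^-1 <= ln (n.+1%:R : R) - ln n%:R.
  have x1 : -1 < - n.+1%:R^-1 :> R.
    by rewrite ltrN2 invf_lt1// ltr1n ltnS.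
  have := le_ln1Dx x1.
  have -> : 1 - n.+1%:R^-1 = n%:R / n.+1%:R :> R.
    by rewrite -natr1; field; rewrite natr1 gt_eqF.
  by rewrite ln_div ?posrE// => lnn; rewrite -lerN2 opprB.
have h := expR_ge1Dx (de * (ln (n.+1%:R : R) - ln n%:R)).
have h2 := ler_wpM2l (ltW de0) lnS.
move: h h2; set u := de * (ln _ - _); move: (_^-1) => i h h2.
rewrite mulrCA -[X in _ - X]mulr1 -mulrBr ler_pM2l ?npow_gt0//.
lra.
Qed.

Lemma zeta_part_bound K sigma N : 1 < sigma ->
  zeta_part K sigma N <= 1 + (sigma - 1)^-1.
Proof.
move=> s1; have de0 : 0 < sigma - 1 by rewrite subr_gt0.
have tele M : (sigma - 1) * zeta_part K sigma M.+1 <=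
    (sigma - 1) + 1 - npow (sigma - 1) M.+1.
  have le1 n : (n \in K)%:R <= 1 :> R by rewrite lern1 leq_b1.
  elim: M => [|M IH].
    rewrite zeta_partS /zeta_part big_geq// add0r !npow1 mulr1.
    by have := ler_wpM2l (ltW de0) (le1 1%N); lra.
  rewrite zeta_partS mulrDr.
  have := npow_telescope s1 (ltn0Sn M).
  have : (M.+2 \in K)%:R * npow sigma M.+2 <= npow sigma M.+2.
    by rewrite ler_piMl// ltW// npow_gt0.
  move=> /(ler_wpM2l (ltW de0)); lra.
apply: le_trans (zeta_part_homo K sigma (leqnSn N)) _.
rewrite -(ler_pM2l de0) (le_trans (tele N))// mulrDr mulr1 divff ?gt_eqF//.
by have := npow_gt0 (sigma - 1) N.+1; lra.
Qed.

Definition rzeta K sigma : R := limn (zeta_part K sigma).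

Lemma rzeta_cvg K sigma : 1 < sigma -> zeta_part K sigma @ \oo --> rzeta K sigma.
Proof.
move=> s1; apply: nondecreasing_is_cvgn; first exact: zeta_part_homo.
by exists (1 + (sigma - 1)^-1) => _ [n _ <-]; exact: zeta_part_bound.
Qed.

Lemma zeta_part_le K sigma N : 1 < sigma -> zeta_part K sigma N <= rzeta K sigma.
Proof.
move=> s1; apply: nondecreasing_cvgn_le; first exact: zeta_part_homo.
exact: rzeta_cvg.
Qed.

Section Factor.
Variables (Q : set nat).
Hypothesis Qp : Q `<=` primes_set.
Let K := generated_integers Q.
Let J := generated_integers (primes_set `\` Q).
Let pi : nat_pred := [pred p | p \in Q].

Lemma generatedE n : (n \in K) = pi.-nat n.
Proof.
have [->|n0] := posnP n.
  by apply/negbTE; rewrite notin_setE => -[].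
apply/idP/pnatP => //.
  by move=> /set_mem[_ nP] p pp pn; change (p \in Q); apply/mem_set; exact: nP.
move=> nP; apply/mem_set; split => // p pp pn.
by apply: set_mem; exact: nP p pp pn.
Qed.

Lemma generatedCE n : (n \in J) = (negn pi).-nat n.
Proof.
have [->|n0] := posnP n.
  by apply/negbTE; rewrite notin_setE => -[].
apply/idP/pnatP => //.
  move=> /set_mem[_ nP] p pp pn; have [_ nQ] := nP p pp pn.
  by change (p \notin Q); rewrite notin_setE.
move=> nP; apply/mem_set; split => // p pp pn; split => //.
have h : p \notin Q := nP p pp pn.
by move: h; rewrite notin_setE.
Qed.

Lemma factor_uniq k j : k \in K -> j \in J -> k = partn (k * j)%N pi /\ j = partn (k * j)%N (negn pi).
Proof.
rewrite generatedE generatedCE => kK jJ.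
have k0 := part_gt0; have [k1 j1] : (0 < k)%N /\ (0 < j)%N.
  by split; [case/andP: kK|case/andP: jJ].
split; rewrite partnM//.
  by rewrite part_pnat_id// part_p'nat ?muln1.
by rewrite (part_pnat_id jJ) part_p'nat ?mul1n// pnatNK.
Qed.

(** The number of factorizations n = k j with k in K, j in J and k, j <= N; unique
factorization makes it at most 1, and exactly 1 if n <= N. *)
Definition factor_count N n : R :=
  \sum_(1 <= k < N.+1) \sum_(1 <= j < N.+1)
    ((k \in K)%:R * (j \in J)%:R * (n == k * j)%N%:R).

Lemma factor_count_le1 N n : factor_count N n <= 1.
Proof.
pose g k : R := (k == (partn n pi))%:R; pose h k : R := (k == (partn n (negn pi)))%:R.
apply: le_trans (_ : \sum_(1 <= k < N.+1) \sum_(1 <= j < N.+1) g k * h j <= _).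
  apply: ler_sum => k _; apply: ler_sum => j _.
  have [kK|_] := boolP (k \in K); last by rewrite !mul0r mulr_ge0.
  have [jJ|_] := boolP (j \in J); last by rewrite mulr0 mul0r mulr_ge0.
  rewrite !mul1r; have [nkj|_] := eqVneq n (k * j)%N; last by rewrite mulr_ge0.
  have [kE jE] := factor_uniq kK jJ; rewrite -nkj in kE jE.
  by rewrite /g /h -kE -jE !eqxx mulr1.
have s1 m : \sum_(1 <= k < N.+1) (k == m)%:R <= 1 :> R.
  rewrite -natr_sum lern1 -big_mkcond/= sum1_count.
  rewrite -/(count_mem m _) count_uniq_mem ?iota_uniq//.
  exact: leq_b1.
under eq_bigr do rewrite -mulr_sumr.
by rewrite -mulr_suml; apply: mulr_ile1; [exact: sumr_ge0|exact: sumr_ge0|exact: s1|exact: s1].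
Qed.

Lemma factor_count_ge1 N n : (0 < n)%N -> (n <= N)%N -> 1 <= factor_count N n.
Proof.
move=> n0 nN; rewrite /factor_count.
have k0 : (0 < (partn n pi))%N := part_gt0 _ _.
have j0 : (0 < (partn n (negn pi)))%N := part_gt0 _ _.
have kn : ((partn n pi) <= N)%N by rewrite (leq_trans _ nN)// dvdn_leq// dvdn_part.
have jn : ((partn n (negn pi)) <= N)%N by rewrite (leq_trans _ nN)// dvdn_leq// dvdn_part.
rewrite (bigD1_seq (partn n pi)) ?mem_index_iota ?k0 ?iota_uniq//=.
rewrite (bigD1_seq (partn n (negn pi))) ?mem_index_iota ?j0 ?iota_uniq//=.
rewrite generatedE generatedCE !part_pnat partnC// eqxx !mulr1 -addrA lerDl.
by rewrite addr_ge0// sumr_ge0// => i _; rewrite ?sumr_ge0// => *; rewrite !mulr_ge0.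
Qed.

Lemma zeta_part_mul sigma N :
  zeta_part K sigma N * zeta_part J sigma N =
  \sum_(1 <= n < (N * N).+1) factor_count N n * npow sigma n.
Proof.
rewrite /factor_count.
under [RHS]eq_bigr do rewrite mulr_suml.
rewrite exchange_big/= [LHS]mulr_suml !big_nat; apply: eq_bigr => k /andP[k0 kN].
under [RHS]eq_bigr do rewrite mulr_suml.
rewrite exchange_big/= [LHS]mulr_sumr !big_nat; apply: eq_bigr => j /andP[j0 jN].
rewrite (bigD1_seq (k * j)%N) ?mem_index_iota ?iota_uniq//=; last first.
  by rewrite muln_gt0 k0 j0 ltnS leq_mul.
rewrite eqxx mulr1 big1 ?addr0 => [|i /negbTE ->]; last by rewrite mulr0 mul0r.
by rewrite npowM//; ring.
Qed.

(** The product of the partial sums contains all terms n <= N once, and each term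
n <= N^2 at most once. *)
Lemma zeta_part_setT_le sigma N :
  zeta_part setT sigma N <= zeta_part K sigma N * zeta_part J sigma N
   <= zeta_part setT sigma (N * N).
Proof.
rewrite zeta_part_mul /zeta_part; apply/andP; split.
  apply: le_trans (_ : \sum_(1 <= n < N.+1) factor_count N n * npow sigma n <= _).
    rewrite !big_nat; apply: ler_sum => n /andP[n0 nN].
    by rewrite in_setT ler_pM2r ?npow_gt0// factor_count_ge1.
  have NN : (N.+1 <= (N * N).+1)%N by rewrite ltnS; case: (N) => // m; rewrite leq_pmulr.
  rewrite [leRHS](@big_cat_nat _ _ _ N.+1 1 (N * N).+1)//= lerDl sumr_ge0// => n _.
  rewrite mulr_ge0 ?(ltW (npow_gt0 _ _))// sumr_ge0// => *.
  by rewrite sumr_ge0// => *; rewrite !mulr_ge0.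
apply: ler_sum => n _.
by rewrite in_setT ler_pM2r ?npow_gt0// factor_count_le1.
Qed.

Lemma rzetaM sigma : 1 < sigma -> rzeta K sigma * rzeta J sigma = rzeta setT sigma.
Proof.
move=> s1.
have hKJ : zeta_part K sigma N * zeta_part J sigma N @[N --> \oo] -->
    rzeta K sigma * rzeta J sigma.
  by apply: cvgM; exact: rzeta_cvg.
apply/eqP; rewrite eq_le; apply/andP; split.
  apply: (cvgr_to_le hKJ); near=> N.
  have /andP[_ h] := zeta_part_setT_le sigma N.
  exact: le_trans h (zeta_part_le _ _ s1).
have hT : zeta_part setT sigma N @[N --> \oo] --> rzeta setT sigma.
  exact: rzeta_cvg.
apply: (ler_cvg_to hT hKJ); near=> N.
by have /andP[] := zeta_part_setT_le sigma N.
Unshelve. all: by end_near. Qed.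

End Factor.

(** Summation by parts: when all partial sums of w are non-negative, so is the sum
of w against a non-increasing non-negative sequence. *)
Lemma summation_nonneg (w f : nat -> R) N :
  (forall n, 0 <= \sum_(1 <= k < n.+1) w k) ->
  (forall n, f n.+2 <= f n.+1) -> 0 <= f N.+1 ->
  (\sum_(1 <= k < N.+2) w k) * f N.+1 <= \sum_(1 <= k < N.+2) w k * f k.
Proof.
move=> w0 fdec; elim: N => [|N IH] f0; first by rewrite !big_nat1.
rewrite big_nat_recr//= [leRHS]big_nat_recr//= mulrDl lerD2r.
apply: le_trans (IH _); last exact: le_trans (fdec N).
by rewrite ler_wpM2l// w0.
Qed.

(** The density hypothesis says that w_k = e + [k in K] - d, corrected by a constant at
k = 1, has non-negative partial sums, and likewise with
the opposite sign for [k in K] - d; summation by parts against k^-sigma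
transfers the inequality to the Dirichlet series, uniformly in sigma. *)
Lemma zeta_part_density K d e : has_density K d -> 0 <= d <= 1 -> 0 < e ->
  exists C : R, forall sigma N, 0 <= sigma ->
    `|zeta_part K sigma N - d * zeta_part setT sigma N| <= C + e * zeta_part setT sigma N.
Proof.
move=> Kd d01 e0; have [N0 NP] := Kd _ e0; exists N0%:R => sigma N s0.
have /andP[d0 d1] := d01.
case: N => [|N].
  by rewrite /zeta_part !big_geq// !mulr0 subrr normr0 addr0.
have aux (b : R) : `|b| = 1 -> 0 <= N0%:R + e * zeta_part setT sigma N.+1 +
     b * (zeta_part K sigma N.+1 - d * zeta_part setT sigma N.+1).
  move=> b1.
  (* up to N0 the trivial bound is used, hence N0 as the correction at 1 *)
  pose w k := (if k == 1%N then N0%:R else 0) + e + b * ((k \in K)%:R - d) : R.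
  have wE n : \sum_(1 <= k < n.+2) w k = N0%:R + e * n.+1%:R +
      b * (count_upto K n.+1 - d * n.+1%:R).
    elim: n => [|n IH].
      by rewrite big_nat1 /w eqxx /count_upto big_nat1 !mulr1.
    by rewrite big_nat_recr//= IH (count_uptoS _ n.+1) /w/= add0r -[n.+2%:R]natr1; ring.
  have w0 n : 0 <= \sum_(1 <= k < n.+1) w k.
    case: n => [|n]; first by rewrite big_geq.
    rewrite wE; set D := count_upto K n.+1 - d * n.+1%:R.
    have bD : - `|D| <= b * D.
      have := ler_norm (- (b * D)); rewrite normrN normrM b1 mul1r; lra.
    have : `|D| <= N0%:R + e * n.+1%:R.
      have [Nn|nN] := leqP N0 n.+1.
        by rewrite (le_trans (NP _ Nn))// lerDr.
      have : `|D| <= n.+1%:R.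
        have c0 := count_upto_ge0 (R := R) K n.+1; have c1 := @count_upto_le R K n.+1.
        have := ler_wpM2r (ler0n R n.+1) d1; have := mulr_ge0 d0 (ler0n R n.+1).
        by rewrite /D ler_norml => *; apply/andP; split; lra.
      have : n.+1%:R <= N0%:R :> R by rewrite ler_nat ltnW.
      have : 0 <= e * n.+1%:R by rewrite mulr_ge0// ltW.
      lra.
    lra.
  have fdec n : npow sigma n.+2 <= npow sigma n.+1 by exact: npow_nincr.
  have := summation_nonneg w0 fdec (ltW (npow_gt0 sigma N.+1)).
  have -> : \sum_(1 <= k < N.+2) w k * npow sigma k =
     N0%:R + e * zeta_part setT sigma N.+1 +
     b * (zeta_part K sigma N.+1 - d * zeta_part setT sigma N.+1).
    elim: N {w0 wE} => [|N IH].
      rewrite /zeta_part !big_nat1 /w eqxx npow1 in_setT /=; ring.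
    rewrite big_nat_recr//= IH !(zeta_partS _ _ N.+1) /w in_setT /=; ring.
  by move=> /(le_trans _); apply; rewrite mulr_ge0 ?w0// ltW// npow_gt0.
have h1 := aux 1 (normr1 _); have h2 := aux (-1) ltac:(by rewrite normrN1).
rewrite ler_norml; apply/andP; split; lra.
Qed.

(** The partial sums are continuous in sigma, and those at 1 are the harmonic sums. *)
Lemma rzeta_setT_pinfty : rzeta setT sigma @[sigma --> (1 : R)^'+] --> +oo.
Proof.
apply/cvgryPge => A.
have hN : exists N, A + 1 <= zeta_part setT 1 N.
  apply: contrapT => nh; apply: (@dvg_harmonic R).
  apply: nondecreasing_is_cvgn.
    by apply/nondecreasing_seqP => n; rewrite seriesSr lerDl invr_ge0.
  exists (A + 1) => _ [n _ <-].
  rewrite leNgt; apply/negP => An; apply: nh; exists n; rewrite (le_trans (ltW An))//.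
  rewrite le_eqVlt; apply/orP; left; apply/eqP.
  elim: n {An} => [|n IH]; first by rewrite /series/= /zeta_part !big_geq.
  rewrite seriesSr IH zeta_partS in_setT mul1r /npow mulN1r expRN lnK//.
  by rewrite posrE.
have [N AN] := hN.
have cont : zeta_part setT sigma N @[sigma --> (1 : R)^'+] --> zeta_part setT 1 N.
  apply: cvg_at_right_filter; rewrite /zeta_part.
  apply: (cvg_big (op := +%R)) => [|n _]; first exact: add_continuous.
  apply: cvgMl_tmp; apply: continuous_cvg; first exact: continuous_expR.
  by apply: cvgMr_tmp; apply: cvgN; exact: cvg_id.
near=> sigma.
have s1 : 1 < sigma by [].
apply: le_trans (zeta_part_le setT N s1).
have : `|zeta_part setT 1 N - zeta_part setT sigma N| <= 1.
  by near: sigma; move/cvgrPdist_le : cont; apply.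
by rewrite ler_norml => /andP[]; lra.
Unshelve. all: by end_near. Qed.

(** By the Euler factorization, the inverse is the ratio of the series of K to the
full one; the error in [zeta_part_density] is negligible since the latter tends to
infinity. *)
Theorem inv_rzeta_cvg Q d : Q `<=` primes_set ->
  has_density (generated_integers Q) d -> 0 <= d <= 1 ->
  (rzeta (generated_integers (primes_set `\` Q)) sigma)^-1 @[sigma --> (1 : R)^'+] --> d.
Proof.
move=> Qp Kd d01; apply/cvgrPdist_le => e e0.
have e2 : 0 < e / 2 by rewrite divr_gt0.
have [C CP] := zeta_part_density Kd d01 e2.
set K := generated_integers Q in Kd CP *; set J := generated_integers _.
have /cvgryPge/(_ (2 * `|C| / e + 1)) hC := rzeta_setT_pinfty.
near=> sigma.
have s1 : 1 < sigma by [].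
have z1 : 2 * `|C| / e + 1 <= rzeta setT sigma by near: sigma.
set z := rzeta setT sigma in z1.
have z0 : 0 < z by apply: lt_le_trans z1; rewrite ltr_wpDl// divr_ge0 ?mulr_ge0// ltW.
have KJ : rzeta K sigma * rzeta J sigma = z by exact: rzetaM.
have J0 : rzeta J sigma != 0.
  by apply/eqP => J0; move: z0; rewrite -KJ J0 mulr0 ltxx.
have -> : (rzeta J sigma)^-1 = rzeta K sigma / z.
  have K0 : rzeta K sigma != 0.
    by apply/eqP => K0; move: z0; rewrite -KJ K0 mul0r ltxx.
  by rewrite -KJ; field; rewrite K0 J0.
have h : `|rzeta K sigma - d * z| <= C + e / 2 * z.
  have l1 : `|zeta_part K sigma N - d * zeta_part setT sigma N| @[N --> \oo] -->
      `|rzeta K sigma - d * z|.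
    apply: cvg_norm; apply: cvgB; first exact: rzeta_cvg.
    by apply: cvgMl_tmp; exact: rzeta_cvg.
  have l2 : C + e / 2 * zeta_part setT sigma N @[N --> \oo] --> C + e / 2 * z.
    by apply: cvgD; [exact: cvg_cst|apply: cvgMl_tmp; exact: rzeta_cvg].
  apply: (ler_cvg_to l1 l2); near=> N; apply: CP.
  by rewrite ltW// (lt_trans _ s1).
have Ce : C <= e / 2 * z.
  have := ler_wpM2l (ltW e2) z1; have := ler_norm C.
  have -> : e / 2 * (2 * `|C| / e + 1) = `|C| + e / 2 by field; rewrite gt_eqF.
  lra.
have -> : d - rzeta K sigma / z = - (rzeta K sigma - d * z) / z.
  by field; rewrite gt_eqF.
rewrite normrM normrN normfV (gtr0_norm z0) ler_pdivrMr// (le_trans h)//.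
lra.
Unshelve. all: by end_near. Qed.

End RealZeta.

(** * The real space of square integrable functions on (-T, T) *)

Section RealL2.
Context {R : realType}.
Notation mu := (@lebesgue_measure R).
Implicit Types (T : R) (f g : R -> R).

Definition sq_integrable T f :=
  measurable_fun (sym_itv T) f /\ mu.-integrable (sym_itv T) (EFin \o (fun t => f t ^+ 2)).

(** Stated for the sigma-algebra generated by the half-open intervals, the one on
which the Lebesgue measure is defined. *)
Lemma measurable_sym_itv T : (R.-ocitv.-measurable).-sigma.-measurable (sym_itv T).
Proof. exact: measurable_itv. Qed.
#[local] Hint Resolve measurable_sym_itv : core.

Lemma sym_itv_fin T : (mu (sym_itv T) < +oo)%E.
Proof. by rewrite lebesgue_measure_itv/=; case: ifP => _; rewrite ltry. Qed.

Lemma le_integrable_real T f g : measurable_fun (sym_itv T) f ->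
  (forall t, sym_itv T t -> `|f t| <= g t) ->
  mu.-integrable (sym_itv T) (EFin \o g) -> mu.-integrable (sym_itv T) (EFin \o f).
Proof.
move=> mf fg ig; apply: le_integrable ig => //.
  exact/measurable_EFinP.
move=> t Dt /=; rewrite lee_fin (le_trans (fg t Dt))// ler_norm//.
Qed.

Lemma integrable_cst_sym T (k : R) : mu.-integrable (sym_itv T) (EFin \o cst k).
Proof.
apply/integrableP; split; first exact/measurable_EFinP/measurable_cst.
rewrite (eq_integral (cst `|k|%:E)) => [|t _]; last by [].
rewrite integral_cst; last exact: measurable_sym_itv.
by rewrite lte_mul_pinfty// ?lee_fin//; exact: sym_itv_fin.
Qed.

Lemma integrable_realD T f g : mu.-integrable (sym_itv T) (EFin \o f) ->
  mu.-integrable (sym_itv T) (EFin \o g) ->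
  mu.-integrable (sym_itv T) (EFin \o (fun t => f t + g t)).
Proof. by move=> fi gi; have := integrableD (measurable_sym_itv T) fi gi. Qed.

Lemma integrable_realZ T f k : mu.-integrable (sym_itv T) (EFin \o f) ->
  mu.-integrable (sym_itv T) (EFin \o (fun t => k * f t)).
Proof. by move=> fi; have := integrableZl (measurable_sym_itv T) k fi. Qed.

Lemma sq_integrableM T f g : sq_integrable T f -> sq_integrable T g ->
  mu.-integrable (sym_itv T) (EFin \o (fun t => f t * g t)).
Proof.
move=> [mf fi] [mg gi]; apply: (le_integrable_real _ _ (integrable_realD fi gi)).
  exact: measurable_funM.
move=> t _; have := sqr_ge0 (f t + g t); have := sqr_ge0 (f t - g t).
by rewrite ler_norml => *; apply/andP; split; nra.
Qed.

Lemma sq_integrable_cst T k : sq_integrable T (cst k).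
Proof.
split; first exact: measurable_cst.
exact: (integrable_cst_sym T (k ^+ 2)).
Qed.

Lemma sq_integrable_bounded T f k : measurable_fun (sym_itv T) f ->
  (forall t, sym_itv T t -> `|f t| <= k) -> sq_integrable T f.
Proof.
move=> mf fk; split => //.
apply: (le_integrable_real _ _ (integrable_cst_sym T (k ^+ 2))).
  exact: measurable_funX.
move=> t /fk ftk; rewrite normrX/= lerXn2r ?nnegrE//.
exact: le_trans ftk.
Qed.

Lemma sq_integrable_int T f : sq_integrable T f ->
  mu.-integrable (sym_itv T) (EFin \o f).
Proof.
move=> fi; have := sq_integrableM fi (sq_integrable_cst T 1).
by apply: eq_integrable => // t _ /=; rewrite mulr1.
Qed.

Lemma sq_integrable_lin T k f g : sq_integrable T f -> sq_integrable T g ->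
  sq_integrable T (fun t => k * f t + g t).
Proof.
move=> fi gi; have fgi := sq_integrableM fi gi; case: fi gi => mf fi [mg gi].
split; first by apply: measurable_funD => //; exact: measurable_funM.
have := integrable_realD (integrable_realZ (k ^+ 2) fi)
  (integrable_realD (integrable_realZ (2 * k) fgi) gi).
by apply: eq_integrable => // t _ /=; congr EFin; ring.
Qed.

Definition L2pred T : {pred R -> R} := fun f => `[< sq_integrable T f >].

Lemma L2pred_submod T : submod_closed (L2pred T).
Proof.
split; first by apply/asboolP; exact: sq_integrable_cst.
by move=> k f g /asboolP fi /asboolP gi; apply/asboolP; exact: sq_integrable_lin.
Qed.

HB.instance Definition _ T := GRing.isSubmodClosed.Build R (R -> R) (L2pred T) (L2pred_submod T).

(** A function of this type is defined on the whole line, but only its values on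
(-T, T) count. *)
Record L2real T := L2Real { L2fun :> R -> R ; _ : L2fun \in L2pred T }.

HB.instance Definition _ T := [isSub for @L2fun T].
HB.instance Definition _ T := [Choice of L2real T by <:].
HB.instance Definition _ T := [SubChoice_isSubLmodule of L2real T by <:].

Lemma L2realP T (u : L2real T) : sq_integrable T u.
Proof. by case: u => f /= fL2; apply/asboolP; move: fL2; rewrite unfold_in. Qed.

Definition mkL2 T f (fi : sq_integrable T f) : L2real T := L2Real (asboolT fi).

Lemma mkL2E T f (fi : sq_integrable T f) : L2fun (mkL2 fi) = f.
Proof. by []. Qed.

Definition l2ip T (u v : L2real T) : R := \int[mu]_(t in sym_itv T) (u t * v t).

Lemma L2funD T (u v : L2real T) t : (u + v) t = u t + v t. Proof. by []. Qed.
Lemma L2funZ T k (u : L2real T) t : (k *: u) t = k * u t. Proof. by []. Qed.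
Lemma L2funN T (u : L2real T) t : (- u) t = - u t. Proof. by []. Qed.
Lemma L2fun0 T t : (0 : L2real T) t = 0. Proof. by []. Qed.

Lemma l2ipC T (u v : L2real T) : l2ip u v = l2ip v u.
Proof. by apply: eq_Rintegral => t _; rewrite mulrC. Qed.

Lemma l2ip_int T (u v : L2real T) :
  mu.-integrable (sym_itv T) (EFin \o (fun t => u t * v t)).
Proof. exact: sq_integrableM (L2realP u) (L2realP v). Qed.

Lemma l2ipD T (u v w : L2real T) : l2ip (u + v) w = l2ip u w + l2ip v w.
Proof.
rewrite /l2ip -RintegralD//; try exact: l2ip_int.
by apply: eq_Rintegral => t _; rewrite L2funD mulrDl.
Qed.

Lemma l2ipZ T k (u w : L2real T) : l2ip (k *: u) w = k * l2ip u w.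
Proof.
rewrite /l2ip -RintegralZl//; last exact: l2ip_int.
by apply: eq_Rintegral => t _; rewrite L2funZ mulrA.
Qed.

Lemma l2ip_ge0 T (u : L2real T) : 0 <= l2ip u u.
Proof. by apply: Rintegral_ge0 => t _; rewrite -expr2 sqr_ge0. Qed.

Lemma l2ip_ereal T (u : L2real T) :
  (\int[mu]_(t in sym_itv T) (u t ^+ 2)%:E = (l2ip u u)%:E)%E.
Proof.
rewrite /l2ip /Rintegral fineK; last first.
  by apply: integrable_fin_num => //; exact: l2ip_int.
by apply: eq_integral => t _; rewrite expr2.
Qed.

End RealL2.
#[local] Hint Resolve measurable_sym_itv : core.

Section Completeness.
Context {R : realType}.
Notation mu := (@lebesgue_measure R).
Variable T : R.
Local Notation D := (sym_itv T).
Implicit Types u v : L2real T.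

Lemma measurable_EFin_fun (f : R -> R) : measurable_fun D f ->
  measurable_fun D (fun t => (f t)%:E).
Proof. by move=> mf; exact/measurable_EFinP. Qed.

Lemma measurable_abs_fun (f : R -> R) : measurable_fun D f ->
  measurable_fun D (fun t => `|f t|).
Proof. by move=> mf; apply: measurableT_comp. Qed.

Lemma limn_einf_le (v : nat -> \bar R) (c : \bar R) (n0 : nat) :
  (forall n, (n0 <= n)%N -> (v n <= c)%E) -> (limn_einf v <= c)%E.
Proof.
move=> vc; rewrite limn_einf_lim; apply: lime_le; first exact: is_cvg_einfs.
near=> n; apply: ereal_inf_le; exists (v (maxn n n0)).
  by exists (maxn n n0) => //=; rewrite leq_maxl.
by apply: vc; rewrite leq_maxr.
Unshelve. all: by end_near. Qed.

Lemma l2ip_dist_le u v w :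
  l2ip (u - w) (u - w) <= 2 * l2ip (u - v) (u - v) + 2 * l2ip (v - w) (v - w).
Proof.
have ipBl (a b c : L2real T) : l2ip (a - b) c = l2ip a c - l2ip b c.
  by rewrite l2ipD -scaleN1r l2ipZ mulN1r.
have ipBr (a b c : L2real T) : l2ip c (a - b) = l2ip c a - l2ip c b.
  by rewrite l2ipC ipBl !(l2ipC c).
have := l2ip_ge0 ((u - v) - (v - w)).
rewrite !ipBl !ipBr !(l2ipC v u) !(l2ipC w u) !(l2ipC w v); lra.
Qed.

(** The Cauchy-Schwarz inequality against 1, with a free parameter a. *)
Lemma int_abs_le u (a : R) : 0 < a ->
  (\int[mu]_(t in D) `|u t|%:E <= ((a * fine (mu D) + a^-1 * l2ip u u) / 2)%:E)%E.
Proof.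
move=> a0; have uL := L2realP u.
have i2 : mu.-integrable D (EFin \o (fun t => a^-1 / 2 * (u t ^+ 2))).
  exact: integrable_realZ uL.2.
have i1 := integrable_cst_sym T (a / 2).
have iu := sq_integrable_int uL.
apply: le_trans (_ : (\int[mu]_(t in D) (a / 2 + a^-1 / 2 * u t ^+ 2)%:E <= _)%E).
  apply: ge0_le_integral => //.
  - by exact: (measurable_EFin_fun (measurable_abs_fun uL.1)).
  - exact: measurable_int (integrable_realD i1 i2).
  move=> t _; rewrite lee_fin.
  have ai : 0 < a^-1 by rewrite invr_gt0.
  have : 0 <= a^-1 * (`|u t| - a) ^+ 2 by rewrite mulr_ge0 ?sqr_ge0 ?(ltW ai).
  have -> : a^-1 * (`|u t| - a) ^+ 2 = a^-1 * `|u t| ^+ 2 - 2 * `|u t| + a.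
    by field; rewrite gt_eqF.
  rewrite real_normK ?num_real//; lra.
under eq_integral do rewrite EFinD.
rewrite integralD//.
rewrite integral_cst//.
under eq_integral do rewrite EFinM.
rewrite integralZl//; last exact: uL.2.
rewrite l2ip_ereal.
have mf : mu D \is a fin_num by rewrite ge0_fin_numE// sym_itv_fin.
rewrite -[X in (_ * X + _)%E](fineK mf) -EFinM -EFinM -EFinD lee_fin.
by rewrite le_eqVlt; apply/orP; left; apply/eqP; ring.
Qed.

(** Riesz-Fischer.  Along a subsequence w whose squared distances decrease like 4^-k,
the increments are absolutely summable almost everywhere, and the limit of the
w_k is an L^2 limit by Fatou's lemma. *)
Lemma l2_complete (u : nat -> L2real T) :
  (forall e, 0 < e -> exists N, forall m n, (N <= m)%N -> (N <= n)%N ->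
       l2ip (u m - u n) (u m - u n) < e) ->
  exists l, l2ip (u n - l) (u n - l) @[n --> \oo] --> 0.
Proof.
move=> uC; pose r k : R := 4^-1 ^+ k.
have r0 k : 0 < r k by rewrite exprn_gt0.
have [N NP] := choice (fun k => uC (r k) (r0 k)).
pose M k := (\max_(i < k.+1) N i)%N.
have NM i k : (i <= k)%N -> (N i <= M k)%N.
  by move=> ik; exact: (leq_bigmax (Ordinal (ik : (i < k.+1)%N))).
pose w k := u (M k).
have wr k l : (k <= l)%N -> l2ip (w l - w k) (w l - w k) <= r k.
  by move=> kl; apply: ltW; apply: NP; exact: NM.
pose h k t : R := `|(w k.+1 - w k) t|.
pose m := fine (mu D).
have m0 : 0 <= m by exact: fine_ge0.
have ih k : (\int[mu]_(t in D) (h k t)%:E <= ((m + 1) / 2 * 2^-1 ^+ k)%:E)%E.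
  have a0 : 0 < (2^-1 : R) ^+ k by rewrite exprn_gt0.
  apply: le_trans (int_abs_le _ a0) _; rewrite lee_fin.
  have ai0 : 0 <= ((2^-1 : R) ^+ k)^-1 by rewrite invr_ge0 ltW.
  have := ler_wpM2l ai0 (wr k k.+1 (leqnSn k)).
  have -> : (2^-1 ^+ k)^-1 * r k = (2^-1 : R) ^+ k.
    have -> : r k = 2^-1 ^+ k * 2^-1 ^+ k.
      by rewrite /r -exprMn; congr (_ ^+ _); field.
    by rewrite mulKf// gt_eqF.
  rewrite -/m; lra.
pose G t := (\sum_(k <oo) (h k t)%:E)%E.
have h0 k t : (0 <= (h k t)%:E)%E by rewrite lee_fin normr_ge0.
have mh k : measurable_fun D (fun t => (h k t)%:E).
  by apply: measurable_EFin_fun; apply: measurable_abs_fun; exact: (L2realP _).1.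
have mG : measurable_fun D G.
  by apply: ge0_emeasurable_sum => //.
have iG : (\int[mu]_(t in D) G t < +oo)%E.
  rewrite integral_nneseries//.
  apply: le_lt_trans (_ : ((m + 1)%:E < +oo)%E); last exact: ltry.
  apply: lime_le; first by apply: is_cvg_nneseries => n _ _; exact: integral_ge0.
  near=> n; apply: le_trans (lee_sum _ (fun k _ => ih k)) _.
  rewrite sumEFin lee_fin -mulr_sumr.
  have -> : \sum_(0 <= k < n) (2^-1 : R) ^+ k = 2 * (1 - 2^-1 ^+ n).
    elim: (n) => [|k IH]; first by rewrite big_geq// expr0 subrr mulr0.
    by rewrite big_nat_recr//= IH exprS; field.
  have : 0 <= (2^-1 : R) ^+ n by rewrite exprn_ge0.
  nra.
have Gi : mu.-integrable D G.
  apply/integrableP; split => //.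
  have -> // : (\int[mu]_(x in D) `|G x| = \int[mu]_(x in D) G x)%E.
  by apply: eq_integral => t _; rewrite gee0_abs//; exact: nneseries_ge0.
have Gfin := integrable_ae (measurable_sym_itv T) Gi.
pose f t := fine (limn_esup (fun k => (w k t)%:E)).
have wcvg t : G t \is a fin_num -> w k t @[k --> \oo] --> f t.
  move=> Gt.
  have [l wl] : exists l : R, w k t @[k --> \oo] --> l.
    have sc : cvgn (series (fun k => (w k.+1 - w k) t)).
      apply: normed_cvg; apply: nondecreasing_is_cvgn.
        by apply/nondecreasing_seqP => n; rewrite /= [leRHS]big_nat_recr//= lerDl.
      exists (fine (G t)) => _ [n _ <-]; rewrite -lee_fin fineK//.
      rewrite /= -sumEFin; by apply: nneseries_lim_ge => k _ _; exact: h0.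
    have /cvg_ex[l sl] := sc; exists (l + w 0%N t).
    have : series (fun k => (w k.+1 - w k) t) n + w 0%N t @[n --> \oo] --> l + w 0%N t.
      by apply: cvgD => //; exact: cvg_cst.
    apply: cvg_trans; apply: near_eq_cvg; near=> n.
    elim: (n) => [|k IH]; first by rewrite /series/= big_geq// add0r.
    by rewrite seriesSr -addrA addrCA IH L2funD L2funN subrK.
  suff -> : f t = l by [].
  rewrite /f (cvg_limn_einf_sup (_ : (w k t)%:E @[k --> \oo] --> l%:E)%E)//.
  by apply: cvg_EFin => //; exact: nearW.
have mf : measurable_fun D f.
  apply: (@measurableT_comp _ _ _ _ _ _ fine) => //.
  by apply: measurable_fun_limn_esup => k; apply: measurable_EFin_fun; exact: (L2realP _).1.
have fw k : (\int[mu]_(t in D) ((f t - w k t) ^+ 2)%:E <= (r k)%:E)%E.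
  pose g l t : \bar R := ((w l t - w k t) ^+ 2)%:E.
  have mg l : measurable_fun D (g l).
    by apply: measurable_EFin_fun; apply: measurable_funX; apply: measurable_funB; exact: (L2realP _).1.
  have g0 l t : D t -> (0 <= g l t)%E by rewrite lee_fin sqr_ge0.
  have -> : (\int[mu]_(t in D) ((f t - w k t) ^+ 2)%:E =
             \int[mu]_(t in D) limn_einf (g ^~ t))%E; last first.
    apply: le_trans (@fatou _ _ _ mu D (measurable_sym_itv T) g mg g0) _.
    apply: (@limn_einf_le _ _ k) => l kl.
    by rewrite (l2ip_ereal (w l - w k)) lee_fin wr.
  apply: ge0_ae_eq_integral => //.
  - by apply: measurable_EFin_fun; apply: measurable_funX; apply: measurable_funB => //; exact: (L2realP _).1.
  - rewrite (_ : (fun t => _) = fun t => (- limn_esup (fun l => - g l t))%E).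
      apply: measurableT_comp => //; apply: measurable_fun_limn_esup => l.
      by apply: measurableT_comp => //; exact: mg.
    by apply/funext => t; rewrite -limn_einfN; congr limn_einf; apply/funext => l; rewrite /comp oppeK.
  - by move=> t _; rewrite lee_fin sqr_ge0.
  - move=> t Dt; rewrite limn_einf_lim; apply: lime_ge; first exact: is_cvg_einfs.
    by near=> n; apply/ereal_infP => _ [l _ <-]; exact: g0.
  - move: Gfin; apply: filterS => t Gt Dt.
    have /wcvg wf := Gt Dt.
    rewrite (cvg_limn_einf_sup (_ : g l t @[l --> \oo] --> ((f t - w k t) ^+ 2)%:E)%E)//.
    apply: cvg_EFin; first exact: nearW.
    rewrite expr2; apply: cvgM; apply: cvgB => //; exact: cvg_cst.
have fL : sq_integrable T f.
  split => //.
  have fw0 : sq_integrable T (fun t => f t - w 0%N t).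
    have mfw : measurable_fun D (fun t => f t - w 0%N t).
      by apply: measurable_funB => //; exact: (L2realP _).1.
    split => //; apply/integrableP; split.
      by apply: measurable_EFin_fun; exact: measurable_funX.
    under eq_integral do rewrite /= ger0_norm ?sqr_ge0//.
    exact: le_lt_trans (fw 0%N) (ltry _).
  have := (sq_integrable_lin 1 fw0 (L2realP (w 0%N))).2.
  by apply: eq_integrable => // t _ /=; rewrite mul1r subrK.
pose l := mkL2 fL; exists l.
apply/cvgrPdist_le => e e0.
have [k rk] : exists k, 4 * r k <= e.
  exists (Num.truncn (4 / e)); rewrite /r exprVn ler_pdivrMr ?exprn_gt0//.
  rewrite mulrC -ler_pdivrMr// ltW// (lt_le_trans (truncnS_gt _))//.
  have -> : (4 : R) ^+ Num.truncn (4 / e) = (4 ^ Num.truncn (4 / e))%:R by rewrite natrX.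
  by rewrite ler_nat ltn_expl.
exists (N k) => // n /= Nn; rewrite sub0r normrN ger0_norm ?l2ip_ge0//.
apply: le_trans (l2ip_dist_le _ (w k) _) _.
have h1 : l2ip (u n - w k) (u n - w k) <= r k by apply: ltW; apply: NP => //; exact: NM.
have h2 : l2ip (w k - l) (w k - l) <= r k.
  rewrite -lee_fin -l2ip_ereal; apply: le_trans (fw k).
  rewrite le_eqVlt; apply/orP; left; apply/eqP; apply: eq_integral => t _.
  by rewrite L2funD L2funN mkL2E -sqrrN opprB.
lra.
Unshelve. all: by end_near. Qed.

HB.instance Definition _ := isSemiHilbert.Build R (L2real T)
  (@l2ipC R T) (@l2ipD R T) (@l2ipZ R T) (@l2ip_ge0 R T) l2_complete.

Lemma ipE u v : ip u v = \int[mu]_(t in D) (u t * v t).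
Proof. by []. Qed.

End Completeness.

(** * Cosines and sines as vectors *)

Section TrigVectors.
Context {R : realType}.
Notation mu := (@lebesgue_measure R).
Variable T : R.
Local Notation D := (sym_itv T).
Implicit Types u v : L2real T.

Lemma measurable_cosM (y : R) : measurable_fun D (fun t => cos (y * t)).
Proof.
apply: measurableT_comp; first exact: continuous_measurable_fun (@continuous_cos R).
exact: measurable_funM.
Qed.

Lemma measurable_sinM (y : R) : measurable_fun D (fun t => sin (y * t)).
Proof.
apply: measurableT_comp; first exact: continuous_measurable_fun (@continuous_sin R).
exact: measurable_funM.
Qed.

Lemma sq_integrable_cosM y : sq_integrable T (fun t => cos (y * t)).
Proof.
by apply: (@sq_integrable_bounded _ _ _ 1); [exact: measurable_cosM|move=> t _; exact: cos_max].
Qed.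

Lemma sq_integrable_sinM y : sq_integrable T (fun t => sin (y * t)).
Proof.
by apply: (@sq_integrable_bounded _ _ _ 1); [exact: measurable_sinM|move=> t _; exact: sin_max].
Qed.

Definition cosv y : L2real T := mkL2 (sq_integrable_cosM y).
Definition sinv y : L2real T := mkL2 (sq_integrable_sinM y).

Lemma sym_itv_norm t : D t -> `|t| <= T.
Proof. by rewrite /sym_itv/= in_itv/= => /andP[/ltW h1 /ltW h2]; rewrite ler_norml h1. Qed.

Lemma sq_integrable_mul v : sq_integrable T (fun t => t * v t).
Proof.
have [mv vi] := L2realP v.
split; first exact: measurable_funM.
apply: (le_integrable_real _ _ (integrable_realZ (T ^+ 2) vi)).
  by apply: measurable_funX; exact: measurable_funM.
move=> t /sym_itv_norm tT; rewrite normrX normrM exprMn real_normK ?num_real//.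
rewrite real_normK ?num_real// ler_wpM2r ?sqr_ge0//.
by rewrite -(real_normK (num_real t)) lerXn2r ?nnegrE// (le_trans _ tT).
Qed.

Definition mulv v : L2real T := mkL2 (sq_integrable_mul v).

Lemma l2_mulv v : 0 < T -> nrm (mulv v) <= T * nrm v.
Proof.
move=> T0; rewrite -ler_sqr ?nnegrE ?mulr_ge0 ?nrm_ge0 ?(ltW T0)// exprMn !sqr_nrm !ipE.
rewrite -RintegralZl//; last exact: l2ip_int.
apply: le_Rintegral => //.
- exact: l2ip_int (mulv v) (mulv v).
- by apply: integrable_realZ; exact: l2ip_int.
move=> t /sym_itv_norm tT; rewrite !mkL2E.
rewrite mulrACA -!expr2 ler_wpM2r ?sqr_ge0//.
by rewrite -(real_normK (num_real t)) lerXn2r ?nnegrE// (le_trans _ tT).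
Qed.

Lemma lebesgue_sym_itv : 0 < T -> fine (mu D) = 2 * T.
Proof.
move=> T0; rewrite lebesgue_measure_itv/= lte_fin ifT; last by lra.
by rewrite -EFinD/=; ring.
Qed.

Lemma Rintegral_cst_sym (k : R) : 0 < T -> \int[mu]_(t in D) k = 2 * T * k.
Proof. by move=> T0; rewrite Rintegral_cst// lebesgue_sym_itv// mulrC. Qed.

Lemma cosv_le y : 0 < T -> ip (cosv y) (cosv y) <= 2 * T.
Proof.
move=> T0; rewrite ipE -[leRHS]mulr1 -Rintegral_cst_sym//.
apply: le_Rintegral => //.
- exact: l2ip_int (cosv y) (cosv y).
- exact: integrable_cst_sym.
move=> t _; rewrite mkL2E -expr2 -(real_normK (num_real _)).
by rewrite expr_le1 ?cos_max.
Qed.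

Lemma sinv_le y : 0 < T -> ip (sinv y) (sinv y) <= 2 * T.
Proof.
move=> T0; rewrite ipE -[leRHS]mulr1 -Rintegral_cst_sym//.
apply: le_Rintegral => //.
- exact: l2ip_int (sinv y) (sinv y).
- exact: integrable_cst_sym.
move=> t _; rewrite mkL2E -expr2 -(real_normK (num_real _)).
by rewrite expr_le1 ?sin_max.
Qed.

Lemma is_derive_scaled (f f' : R -> R) (k t y : R) :
  (forall x, is_derive x (1 : R) f (f' x)) ->
  is_derive y (1 : R) (fun y => k * f (y * t)) (k * (t * f' (y * t))).
Proof.
move=> df.
have h1 : is_derive y (1 : R) (fun y : R => y * t) t.
  have -> : (fun y : R => y * t) = t \*: (id : R -> R).
    by apply/funext => x; rewrite /= mulrC.
  apply: trigger_derive; by rewrite scaler1.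
have h2 := @is_derive1_comp _ f (fun y => y * t) y _ _ (df (y * t)) h1.
have h3 := @is_deriveZ _ _ _ (f \o (fun y => y * t)) k y 1 _ h2.
by apply: trigger_derive h3 _; rewrite /GRing.scale/=; ring.
Qed.

(** Differentiation under the integral sign. *)
Lemma is_derive_ip_trig v (f f' : R -> R) (F F' : R -> L2real T) (y : R) :
  (forall x, is_derive x (1 : R) f (f' x)) -> (forall x, `|f' x| <= 1) ->
  (forall y, L2fun (F y) = fun t => f (y * t)) ->
  (forall y, L2fun (F' y) = fun t => f' (y * t)) ->
  is_derive y (1 : R) (fun y => ip v (F y)) (ip (mulv v) (F' y)).
Proof.
move=> df f'1 FE F'E.
pose g (y t : R) := v t * f (y * t).
have gi x : mu.-integrable D (EFin \o g x).
  by have := l2ip_int v (F x); rewrite FE.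
have dg x t : is_derive x (1 : R) (g ^~ t) (v t * (t * f' (x * t))).
  exact: is_derive_scaled.
have ya : (`]y - 1, y + 1[)%classic y by rewrite /= in_itv/=; apply/andP; split; lra.
have Gi : mu.-integrable D (EFin \o (fun t => `|T| * `|v t|)).
  apply: integrable_realZ; exact: integrable_norm (sq_integrable_int (L2realP v)).
have d1 x t : partial1of2 g x t = v t * (t * f' (x * t)).
  by rewrite partial1of2E; have := dg x t => /@derive_val.
have h1 := @derivable_under_integral R _ _ mu g D (measurable_sym_itv T) y (y - 1) (y + 1) ya
  (fun x _ => gi x) (fun x t _ _ => @ex_derive _ _ _ _ _ _ _ (dg x t))
  (fun t => `|T| * `|v t|) _ Gi.
have h2 := @differentiation_under_integral R _ _ mu g D (measurable_sym_itv T) y (y - 1) (y + 1) ya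
  (fun x _ => gi x) (fun x t _ _ => @ex_derive _ _ _ _ _ _ _ (dg x t))
  (fun t => `|T| * `|v t|) _ Gi.
have G0 t : 0 <= `|T| * `|v t| by rewrite mulr_ge0.
have GU x t : (`]y - 1, y + 1[)%classic x -> D t -> `|partial1of2 g x t| <= `|T| * `|v t|.
  move=> _ Dt; rewrite d1 !normrM mulrCA ler_pM ?mulr_ge0//.
    by rewrite (le_trans (sym_itv_norm Dt))// ler_norm.
  by rewrite ler_piMr.
have {}h1 := h1 G0 GU; have {}h2 := h2 G0 GU.
have E : (fun y => ip v (F y)) = (fun y => \int[mu]_(t in D) g y t).
  by apply/funext => x; rewrite ipE FE.
rewrite E; apply: DeriveDef; first exact: h1.
rewrite -derive1E h2 ipE; apply: eq_Rintegral => t _.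
by rewrite d1 mkL2E F'E; ring.
Qed.

Lemma is_derive_cosv v y :
  is_derive y (1 : R) (fun y => ip v (cosv y)) (- ip (mulv v) (sinv y)).
Proof.
have h := @is_derive_ip_trig v cos (fun x => - sin x) cosv (fun y => - sinv y) y.
rewrite -ipNr; apply: h => // x; last by rewrite normrN sin_max.
Qed.

Lemma is_derive_sinv v y :
  is_derive y (1 : R) (fun y => ip v (sinv y)) (ip (mulv v) (cosv y)).
Proof.
apply: (@is_derive_ip_trig v sin cos sinv cosv y) => // x.
exact: cos_max.
Qed.

End TrigVectors.

Section Orthogonality.
Context {R : realType}.
Notation mu := (@lebesgue_measure R).
Variable T : R.
Hypothesis T0 : 0 < T.
Local Notation D := (sym_itv T).
Local Notation cosv := (@cosv R T).
Local Notation sinv := (@sinv R T).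
Implicit Types (u v : L2real T) (a y : R).

(** The fundamental theorem of calculus over the open interval. *)
Lemma Rintegral_FTC_sym (f F : R -> R) : (forall x, is_derive x (1 : R) F (f x)) ->
  continuous f -> measurable_fun D f ->
  \int[mu]_(t in D) f t = F T - F (- T).
Proof.
move=> dF cf mf.
have TT : - T < T by rewrite gtrN.
have cF x : {for x, continuous F}.
  by apply: differentiable_continuous; apply/derivable1_diffP; exact: (@ex_derive _ _ _ _ _ _ _ (dF x)).
have h := @continuous_FTC2 R f F (- T) T TT.
have fi : mu.-integrable `[- T, T] (EFin \o f).
  apply: continuous_compact_integrable; first exact: segment_compact.
  exact: continuous_subspaceT.
rewrite /sym_itv Rintegral_itv_obnd_cbnd; last first.
  by apply: integrableS fi => //; exact: subset_itv_oo_cc.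
rewrite Rintegral_itv_bndo_bndc; last first.
  by apply: integrableS fi => //; exact: subset_itv_co_cc.
rewrite /Rintegral h//.
- exact: continuous_subspaceT.
- split; first by move=> x _; exact: (@ex_derive _ _ _ _ _ _ _ (dF x)).
  + by apply: cvg_at_right_filter; exact: cF.
  + by apply: cvg_at_left_filter; exact: cF.
by move=> x _; rewrite derive1E; have := dF x => /@derive_val.
Qed.

Lemma int_cosM a : a != 0 -> \int[mu]_(t in D) cos (a * t) = 2 * sin (a * T) / a.
Proof.
move=> a0.
have dF x : is_derive x (1 : R) (fun t => a^-1 * sin (t * a)) (cos (a * x)).
  apply: trigger_derive (is_derive_scaled a^-1 a x (@is_derive_sin R)) _.
  by rewrite mulrA mulVf// mul1r mulrC.
have cf : continuous (fun x => cos (a * x)).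
  move=> x; apply: continuous_comp; last exact: continuous_cos.
  exact: mulrl_continuous.
rewrite (Rintegral_FTC_sym dF cf (measurable_cosM a)).
by rewrite mulNr sinN ![_ * a]mulrC; field.
Qed.

Lemma int_sinM a : \int[mu]_(t in D) sin (a * t) = 0.
Proof.
have [->|a0] := eqVneq a 0.
  by under eq_Rintegral do rewrite mul0r sin0; rewrite Rintegral_cst_sym// mulr0.
have dF x : is_derive x (1 : R) (fun t => - a^-1 * cos (t * a)) (sin (a * x)).
  apply: trigger_derive (is_derive_scaled (- a^-1) a x (@is_derive_cos R)) _.
  by rewrite mulrN mulrNN mulrA mulVf// mul1r mulrC.
have cf : continuous (fun x => sin (a * x)).
  move=> x; apply: continuous_comp; last exact: continuous_sin.
  exact: mulrl_continuous.
rewrite (Rintegral_FTC_sym dF cf (measurable_sinM a)).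
by rewrite [- T * a]mulNr cosN subrr.
Qed.

Lemma sin_natpi n : sin (pi * n%:R : R) = 0.
Proof.
elim: n => [|n IH]; first by rewrite mulr0 sin0.
by rewrite -natr1 mulrDr mulr1 sinD IH sinpi mul0r mulr0 addr0.
Qed.

Local Notation eta := (pi / T).

Lemma int_cos_nat n : \int[mu]_(t in D) cos (eta * n%:R * t) = if n == 0%N then 2 * T else 0.
Proof.
case: eqP => [->|/eqP n0].
  by under eq_Rintegral do rewrite mulr0 mul0r cos0; rewrite Rintegral_cst_sym// mulr1.
rewrite int_cosM; last by rewrite !mulf_neq0 ?invr_eq0 ?pnatr_eq0// gt_eqF// pi_gt0.
have -> : eta * n%:R * T = pi * n%:R by field; rewrite gt_eqF.
by rewrite sin_natpi mulr0 mul0r.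
Qed.

Lemma int_trigD (f g : R -> R) : measurable_fun D f -> (forall t, `|f t| <= 1) ->
  measurable_fun D g -> (forall t, `|g t| <= 1) ->
  \int[mu]_(t in D) (f t + g t) = \int[mu]_(t in D) f t + \int[mu]_(t in D) g t.
Proof.
move=> mf f1 mg g1; rewrite RintegralD//; apply: sq_integrable_int.
  exact: (@sq_integrable_bounded _ _ _ 1).
exact: (@sq_integrable_bounded _ _ _ 1).
Qed.

Lemma int_trigB (f g : R -> R) : measurable_fun D f -> (forall t, `|f t| <= 1) ->
  measurable_fun D g -> (forall t, `|g t| <= 1) ->
  \int[mu]_(t in D) (f t - g t) = \int[mu]_(t in D) f t - \int[mu]_(t in D) g t.
Proof.
move=> mf f1 mg g1; rewrite RintegralB//; apply: sq_integrable_int.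
  exact: (@sq_integrable_bounded _ _ _ 1).
exact: (@sq_integrable_bounded _ _ _ 1).
Qed.

Lemma int_trigZ (f : R -> R) : measurable_fun D f -> (forall t, `|f t| <= 2) ->
  \int[mu]_(t in D) (2^-1 * f t) = 2^-1 * \int[mu]_(t in D) f t.
Proof.
move=> mf f2; rewrite RintegralZl//; apply: sq_integrable_int.
exact: (@sq_integrable_bounded _ _ _ 2).
Qed.

Let cos1 a t : `|cos (a * t)| <= 1 := cos_max _.
Let sin1 a t : `|sin (a * t)| <= 1 := sin_max _.
Let mcos := @measurable_cosM R T.
Let msin := @measurable_sinM R T.

Lemma ip_cosv a b : ip (cosv a) (cosv b) =
  2^-1 * (\int[mu]_(t in D) cos ((a - b) * t) + \int[mu]_(t in D) cos ((a + b) * t)).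
Proof.
rewrite -int_trigD// -int_trigZ; last first.
- by move=> t; rewrite (le_trans (ler_normD _ _))// (_ : 2 = 1 + 1)// lerD.
- exact: measurable_funD.
by apply: eq_Rintegral => t _; rewrite !mkL2E mulrBl mulrDl cosB cosD; field.
Qed.

Lemma ip_sinv a b : ip (sinv a) (sinv b) =
  2^-1 * (\int[mu]_(t in D) cos ((a - b) * t) - \int[mu]_(t in D) cos ((a + b) * t)).
Proof.
rewrite -int_trigB// -int_trigZ; last first.
- by move=> t; rewrite (le_trans (ler_normB _ _))// (_ : 2 = 1 + 1)// lerD.
- exact: measurable_funB.
by apply: eq_Rintegral => t _; rewrite !mkL2E mulrBl mulrDl cosB cosD; field.
Qed.

Lemma ip_cosv_sinv a b : ip (cosv a) (sinv b) = 0.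
Proof.
transitivity (2^-1 * (\int[mu]_(t in D) sin ((a + b) * t) - \int[mu]_(t in D) sin ((a - b) * t))).
  rewrite -int_trigB// -int_trigZ; last first.
  - by move=> t; rewrite (le_trans (ler_normB _ _))// (_ : 2 = 1 + 1)// lerD.
  - exact: measurable_funB.
  by apply: eq_Rintegral => t _; rewrite !mkL2E mulrBl mulrDl sinB sinD; field.
by rewrite !int_sinM subrr mulr0.
Qed.

Lemma int_cos_diff j k :
  \int[mu]_(t in D) cos ((eta * j%:R - eta * k%:R) * t) = if j == k then 2 * T else 0.
Proof.
wlog jk : j k / (k <= j)%N => [H|].
  have [|/ltnW kj] := leqP k j; first exact: H.
  rewrite eq_sym -H//; apply: eq_Rintegral => t _.
  by rewrite -cosN -mulNr opprB.
rewrite -mulrBr -natrB// int_cos_nat subn_eq0.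
by rewrite eqn_leq jk andbT.
Qed.

Lemma ip_cosv_lattice j k : ip (cosv (eta * j%:R)) (cosv (eta * k%:R)) =
  if j == k then (if j == 0%N then 2 * T else T) else 0.
Proof.
rewrite ip_cosv int_cos_diff -mulrDr -natrD int_cos_nat.
have [->|jk] := eqVneq j k.
  by case: k => [|k] /=; field.
have -> : (j + k == 0)%N = false.
  by apply/negbTE; move: jk; rewrite addn_eq0; apply: contra => /andP[/eqP -> /eqP ->].
by rewrite addr0 mulr0.
Qed.

Lemma ip_sinv_lattice j k : ip (sinv (eta * j%:R)) (sinv (eta * k%:R)) =
  if (j == k) && (j != 0%N) then T else 0.
Proof.
rewrite ip_sinv int_cos_diff -mulrDr -natrD int_cos_nat.
have [->|jk] := eqVneq j k.
  by case: k => [|k] /=; field.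
have -> : (j + k == 0)%N = false.
  by apply/negbTE; move: jk; rewrite addn_eq0; apply: contra => /andP[/eqP -> /eqP ->].
by rewrite subr0 mulr0.
Qed.

End Orthogonality.

(** * Totality of the trigonometric system of period 2T *)

Section Threshold.
Context {R : realType}.

Lemma bernoulli_ge (x : R) k : 0 <= x -> x <= 1 -> 1 - k%:R * x <= (1 - x) ^+ k.
Proof.
move=> x0 x1; elim: k => [|k IH]; first by rewrite mul0r subr0.
have y0 : 0 <= 1 - x by lra.
have := ler_wpM2l y0 IH; rewrite -exprS -natr1.
have : 0 <= k%:R * x ^+ 2 by rewrite mulr_ge0// sqr_ge0.
lra.
Qed.

Lemma bernoulli_le (x : R) k : 0 <= x -> x <= 1 -> (1 - x) ^+ k * (1 + k%:R * x) <= 1.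
Proof.
move=> x0 x1; elim: k => [|k IH]; first by rewrite mul0r addr0 mulr1.
have y0 : 0 <= (1 - x) ^+ k by rewrite exprn_ge0// subr_ge0.
apply: le_trans IH; rewrite exprSr -mulrA ler_wpM2l//.
rewrite -natr1; have := ler0n R k; move: (k%:R : R) => q q0.
have : 0 <= q * x ^+ 2 by rewrite mulr_ge0// sqr_ge0.
have := sqr_ge0 x; lra.
Qed.

(** Of the order of theta^-n, so that (1 - u^n) to this power tends to 1 or 0
according to the position of u with respect to theta. *)
Definition threshold_exp (theta : R) n := (Num.truncn (theta ^- n)).+1.

Lemma threshold_below (u theta : R) : 0 <= u -> u < theta -> theta < 1 ->
  (1 - u ^+ n) ^+ threshold_exp theta n @[n --> \oo] --> (1 : R).
Proof.
move=> u0 ut t1; have t0 : 0 < theta by lra.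
have q1 : `|u / theta| < 1.
  by rewrite ger0_norm ?divr_ge0 ?(ltW t0)// ltr_pdivrMr// mul1r.
have l1 : 1 - 2 * (u / theta) ^+ n @[n --> \oo] --> 1 - 2 * (0 : R).
  by apply: cvgB; [exact: cvg_cst|apply: cvgMl_tmp; exact: cvg_expr].
rewrite mulr0 subr0 in l1.
have l2 : (1 : R) @[n --> \oo] --> (1 : R) by exact: cvg_cst.
apply: (squeeze_cvgr _ l1 l2); near=> n.
have un0 : 0 <= u ^+ n by rewrite exprn_ge0.
have un1 : u ^+ n <= 1 by rewrite exprn_ile1//; lra.
have tn0 : 0 < theta ^+ n by rewrite exprn_gt0.
apply/andP; split; last by rewrite exprn_ile1; lra.
apply: le_trans (bernoulli_ge _ un0 un1); rewrite lerD2l lerN2.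
have tn1 : theta ^+ n <= 1 by rewrite exprn_ile1 ?ltW.
have k2 : (threshold_exp theta n)%:R <= 2 * theta ^- n.
  have tt : 0 <= theta ^- n by rewrite invr_ge0 ltW.
  have /andP[h _] := truncn_itv tt; rewrite /threshold_exp -natr1.
  have : 1 <= theta ^- n by rewrite invf_ge1.
  lra.
by rewrite expr_div_n mulrA mulrAC ler_wpM2r.
Unshelve. all: by end_near. Qed.

Lemma threshold_above (u theta : R) : 0 < theta -> theta < u -> u <= 1 ->
  (1 - u ^+ n) ^+ threshold_exp theta n @[n --> \oo] --> (0 : R).
Proof.
move=> t0 tu u1; have u0 : 0 < u by lra.
have q1 : `|theta / u| < 1.
  by rewrite ger0_norm ?divr_ge0 ?ltW// ltr_pdivrMr// mul1r.
have l1 : (theta / u) ^+ n @[n --> \oo] --> (0 : R) by exact: cvg_expr.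
have l2 : (0 : R) @[n --> \oo] --> (0 : R) by exact: cvg_cst.
apply: (squeeze_cvgr _ l2 l1); near=> n.
have un0 : 0 < u ^+ n by rewrite exprn_gt0.
have un1 : u ^+ n <= 1 by rewrite exprn_ile1//; exact: ltW.
have tn0 : 0 < theta ^+ n by rewrite exprn_gt0.
have x0 : 0 <= (1 - u ^+ n) ^+ threshold_exp theta n by rewrite exprn_ge0// subr_ge0.
rewrite x0/= expr_div_n ler_pdivlMr//.
have := bernoulli_le (threshold_exp theta n) (ltW un0) un1.
set X := (1 - _) ^+ _ in x0 *.
have kt : theta ^- n <= (threshold_exp theta n)%:R by rewrite ltW// truncnS_gt.
have h : u ^+ n <= theta ^+ n * (1 + (threshold_exp theta n)%:R * u ^+ n).
  have := ler_wpM2r (ltW un0) kt => /(ler_wpM2l (ltW tn0)).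
  by rewrite mulrA mulfV ?gt_eqF// mul1r; lra.
move=> XB; apply: le_trans (ler_wpM2l x0 h) _.
rewrite mulrCA -[leRHS]mulr1 ler_wpM2l// ltW//.
Unshelve. all: by end_near. Qed.

End Threshold.

Section Totality.
Context {R : realType}.
Notation mu := (@lebesgue_measure R).
Variable T : R.
Hypothesis T0 : 0 < T.
Local Notation D := (sym_itv T).
Local Notation cosv := (@cosv R T).
Local Notation sinv := (@sinv R T).
Local Notation eta := (pi / T).
Implicit Types (u v w : L2real T) (m : R).

Lemma L2_ext u v : L2fun u =1 L2fun v -> u = v.
Proof. by move=> uv; apply: val_inj; apply/funext. Qed.

(** A trigonometric polynomial of period 2T with values in [0, 1], decreasing with
the distance to m modulo the period. *)
Definition bump m t : R := (1 + cos (eta * (t - m))) / 2.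

Lemma bump_itv m t : 0 <= bump m t <= 1.
Proof.
have := cos_geN1 (eta * (t - m)); have := cos_le1 (eta * (t - m)).
by rewrite /bump => c1 c2; apply/andP; split; lra.
Qed.

Lemma measurable_bump m : measurable_fun D (bump m).
Proof.
apply: measurable_funM => //; apply: measurable_funD => //.
apply: measurableT_comp; first exact: continuous_measurable_fun (@continuous_cos R).
by apply: measurable_funM => //; exact: measurable_funB.
Qed.

Lemma sq_integrable_bump m v : sq_integrable T (fun t => bump m t * v t).
Proof.
have [mv vi] := L2realP v.
have mbv : measurable_fun D (fun t => bump m t * v t).
  by apply: measurable_funM => //; exact: measurable_bump.
split => //; apply: (le_integrable_real _ _ vi); first exact: measurable_funX.
move=> t _; rewrite ger0_norm ?sqr_ge0// exprMn ler_piMl ?sqr_ge0//.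
by have /andP[b0 b1] := bump_itv m t; rewrite expr_le1.
Qed.

Definition mul_bump m v : L2real T := mkL2 (sq_integrable_bump m v).

Lemma ip_mul_bump m u v : ip (mul_bump m u) v = ip u (mul_bump m v).
Proof. by rewrite !ipE; apply: eq_Rintegral => t _; rewrite !mkL2E [RHS]mulrCA mulrA. Qed.

Definition freq (z : int) : R := eta * z%:~R.

(** Multiplication by the bump preserves the trigonometric polynomials with
frequencies in (pi / T) Z, hence the functions orthogonal to all of them. *)
Lemma mul_bump_cosv m z : mul_bump m (cosv (freq z)) = 2^-1 *: cosv (freq z) +
  4^-1 *: (cos (eta * m) *: (cosv (freq (z + 1)) + cosv (freq (z - 1)))
         + sin (eta * m) *: (sinv (freq (z + 1)) - sinv (freq (z - 1)))).
Proof.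
apply: L2_ext => t; rewrite !(L2funD, L2funN, L2funZ) !mkL2E /bump /freq.
rewrite rmorphB rmorphD/= rmorph1.
have -> : eta * (z%:~R + 1) * t = eta * z%:~R * t + eta * t by ring.
have -> : eta * (z%:~R - 1) * t = eta * z%:~R * t - eta * t by ring.
have -> : eta * (t - m) = eta * t - eta * m by ring.
by rewrite !cosB !cosD !sinB !sinD; field.
Qed.

Lemma mul_bump_sinv m z : mul_bump m (sinv (freq z)) = 2^-1 *: sinv (freq z) +
  4^-1 *: (cos (eta * m) *: (sinv (freq (z + 1)) + sinv (freq (z - 1)))
         + sin (eta * m) *: (cosv (freq (z - 1)) - cosv (freq (z + 1)))).
Proof.
apply: L2_ext => t; rewrite !(L2funD, L2funN, L2funZ) !mkL2E /bump /freq.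
rewrite rmorphB rmorphD/= rmorph1.
have -> : eta * (z%:~R + 1) * t = eta * z%:~R * t + eta * t by ring.
have -> : eta * (z%:~R - 1) * t = eta * z%:~R * t - eta * t by ring.
have -> : eta * (t - m) = eta * t - eta * m by ring.
by rewrite !cosB !cosD !sinB !sinD; field.
Qed.

Definition no_coef v := forall z, ip v (cosv (freq z)) = 0 /\ ip v (sinv (freq z)) = 0.

Lemma no_coef_bump m v : no_coef v -> no_coef (mul_bump m v).
Proof.
move=> v0 z; rewrite !ip_mul_bump mul_bump_cosv mul_bump_sinv.
rewrite !(ipDr, ipZr, ipNr) !(v0 _).1 !(v0 _).2.
by rewrite !(mulr0, addr0, oppr0).
Qed.

Lemma no_coefB u v : no_coef u -> no_coef v -> no_coef (u - v).
Proof.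
by move=> u0 v0 z; rewrite !ipBl (u0 z).1 (u0 z).2 (v0 z).1 (v0 z).2 subr0.
Qed.

Lemma no_coef_iter m v n k : no_coef v ->
  no_coef (iter k (fun w => w - iter n (mul_bump m) w) v).
Proof.
move=> v0; elim: k => // k IH; rewrite iterS; apply: no_coefB => //.
by elim: n {IH} (iter k _ v) IH => [//|n IHn] w w0; rewrite iterS; apply: no_coef_bump; exact: IHn.
Qed.

Lemma iter_bumpE m v n t : iter n (mul_bump m) v t = bump m t ^+ n * v t.
Proof. by elim: n => [|n IH]; [rewrite mul1r|rewrite iterS mkL2E IH exprS mulrA]. Qed.

Lemma iter_bump2E m v n k t :
  iter k (fun w => w - iter n (mul_bump m) w) v t = (1 - bump m t ^+ n) ^+ k * v t.
Proof.
elim: k => [|k IH]; first by rewrite mul1r.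
by rewrite iterS L2funD L2funN iter_bumpE IH exprS; ring.
Qed.

Lemma no_coef_int m v n k : no_coef v ->
  \int[mu]_(t in D) ((1 - bump m t ^+ n) ^+ k * v t) = 0.
Proof.
move=> v0; have [h _] := no_coef_iter m n k v0 0.
rewrite -[RHS]h ipE; apply: eq_Rintegral => t _.
by rewrite iter_bump2E mkL2E /freq mulr0 mul0r cos0 mulr1.
Qed.

Lemma measurable_tail v x : measurable_fun D (fun t => if x < t then v t else 0).
Proof.
apply: (measurable_fun_if (measurable_sym_itv T)) => //; first exact: (@measurable_fun_ltr _ _ _ D (cst x) id).
apply: (measurable_funS (measurable_sym_itv T)) (L2realP v).1.
exact: subIsetl.
Qed.

(** The trigonometric polynomials (1 - b^n)^k, with b a bump, converge boundedly to
the indicator of (x, T) when k is the threshold exponent. *)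
Lemma no_coef_tail v x : no_coef v -> D x ->
  \int[mu]_(t in D) (if x < t then v t else 0) = 0.
Proof.
move=> v0; rewrite /sym_itv/= in_itv/= => /andP[Tx xT].
(* m is the midpoint of (-T, x); modulo 2T, the points of (-T, x) are those at
   distance less than r = x - m from m *)
pose m := (x - T) / 2; pose r := (x + T) / 2; pose a := eta * r.
have e0 : 0 < eta by rewrite divr_gt0 ?pi_gt0.
have a0 : 0 < a by rewrite mulr_gt0// /r; lra.
have piE : pi = eta * T by field; rewrite gt_eqF.
have api : a < pi by rewrite piE ltr_pM2l// /r; lra.
pose theta : R := (1 + cos a) / 2.
have pI : (pi : R) \in `[0, pi] by rewrite in_itv/= lexx pi_ge0.
have zI : (0 : R) \in `[0, pi] by rewrite in_itv/= lexx pi_ge0.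
have aI : a \in `[0, pi] by rewrite in_itv/= !ltW.
have t0 : 0 < theta.
  have : cos pi < cos a by rewrite ltr_cos.
  by rewrite cospi /theta; lra.
have t1 : theta < 1.
  have : cos a < cos 0 by rewrite ltr_cos.
  by rewrite cos0 /theta; lra.
have low t : - T < t -> t < x -> theta < bump m t.
  move=> t2 t3.
  have nlt : `|eta * (t - m)| < a.
    rewrite normrM gtr0_norm// ltr_pM2l// ltr_norml /m /r; apply/andP; split; lra.
  rewrite /theta /bump ltr_pM2r// ltrD2l -(cos_norm (eta * (t - m))) ltr_cos//.
  by rewrite in_itv/= normr_ge0 ltW// (lt_trans nlt).
have high t : x < t -> t < T -> bump m t < theta.
  move=> t2 t3; rewrite /theta /bump ltr_pM2r// ltrD2l.
  set b := eta * (t - m).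
  have ab : a < b by rewrite /a /b ltr_pM2l// /m /r; lra.
  have ba : b < pi *+ 2 - a.
    rewrite -subr_gt0.
    have -> : pi *+ 2 - a - b = eta * (2 * T - r - (t - m)).
      by rewrite /a /b -mulr_natr; field; rewrite gt_eqF.
    rewrite mulr_gt0// /m /r; lra.
  have [bpi|pib] := leP b pi.
    by rewrite ltr_cos// in_itv/= bpi (le_trans (ltW a0) (ltW ab)).
  have -> : cos b = cos (pi *+ 2 - b) by rewrite addrC cosD2pi cosN.
  have b2 : pi *+ 2 - b < pi by rewrite mulr2n; lra.
  have b3 : a < pi *+ 2 - b by lra.
  by rewrite ltr_cos// in_itv/= (ltW b2) (le_trans (ltW a0) (ltW b3)).
pose f n t : R := (1 - bump m t ^+ n) ^+ threshold_exp theta n * v t.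
pose g t : R := if x < t then v t else 0.
have vL := L2realP v.
have fE n : f n = iter (threshold_exp theta n) (fun w => w - iter n (mul_bump m) w) v.
  by apply/funext => t; rewrite iter_bump2E.
have mf n : measurable_fun D (fun t => (f n t)%:E).
  by apply: measurable_EFin_fun; rewrite fE; exact: (L2realP _).1.
have mg : measurable_fun D (fun t => (g t)%:E).
  by apply: measurable_EFin_fun; exact: measurable_tail.
have vi : mu.-integrable D (EFin \o (fun t => `|v t|)).
  exact: integrable_norm (sq_integrable_int vL).
have fg : {ae mu, forall t, D t -> (f n t)%:E @[n --> \oo] --> (g t)%:E}.
  exists [set x]; split; first exact: measurable_set1.
    exact: lebesgue_measure_set1.
  move=> t /=; apply: contra_notP => tx; rewrite /sym_itv/= in_itv/= => /andP[Tt tT].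
  apply: cvg_EFin; first exact: nearW.
  rewrite /f /g; have /andP[b0 b1] := bump_itv m t.
  have [xt|tx'] := ltP x t.
    rewrite -[X in _ --> X]mul1r; apply: cvgMr_tmp; apply: threshold_below => //.
    exact: high.
  rewrite -[X in _ --> X](mul0r (v t)); apply: cvgMr_tmp; apply: threshold_above => //.
  by apply: low => //; rewrite lt_neqAle tx' andbT; apply/eqP.
have dom : {ae mu, forall t n, D t -> (`|(f n t)%:E| <= (`|v t|)%:E)%E}.
  apply: aeW => t n _; rewrite lee_fin /f normrM ler_piMl// ger0_norm.
    by have /andP[b0 b1] := bump_itv m t; rewrite exprn_ile1 ?subr_ge0 ?exprn_ile1// lerBlDr lerDl exprn_ge0.
  by have /andP[b0 b1] := bump_itv m t; rewrite exprn_ge0// subr_ge0 exprn_ile1.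
have [gi _ h] := @dominated_convergence _ _ _ mu D (measurable_sym_itv T) _ _ _ mf mg fg vi dom.
have int0 n : (\int[mu]_(t in D) (f n t)%:E = 0)%E.
  have fi : mu.-integrable D (EFin \o f n).
    by rewrite fE; exact: sq_integrable_int (L2realP _).
  rewrite -[LHS]fineK; last by apply: integrable_fin_num => //; exact: fi.
  by congr EFin; exact: no_coef_int.
rewrite /Rintegral -/g; have /cvg_lim <- // := h.
rewrite (_ : [sequence _]_n = fun=> 0%E); first by rewrite lim_cst.
by apply/funext => n /=; exact: int0.
Qed.

Lemma no_coef_tailT v x : no_coef v ->
  \int[mu]_(t in D) (if x < t then v t else 0) = 0.
Proof.
move=> v0.
have int0 : \int[mu]_(t in D) v t = 0.
  have [h _] := v0 0; rewrite -[RHS]h ipE; apply: eq_Rintegral => t _.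
  by rewrite mkL2E /freq mulr0 mul0r cos0 mulr1.
have [xT|Tx] := leP x (- T).
  rewrite -[RHS]int0; apply: eq_Rintegral => t.
  by rewrite inE /sym_itv/= in_itv/= => /andP[Tt _]; rewrite (le_lt_trans xT Tt).
have [Tx'|xT] := leP T x; last by apply: no_coef_tail => //; rewrite /sym_itv/= in_itv/= Tx.
transitivity (\int[mu]_(t in D) (0 : R)); last by rewrite Rintegral_cst_sym// mulr0.
apply: eq_Rintegral => t.
by rewrite inE /sym_itv/= in_itv/= => /andP[_ tT]; rewrite ltNge (le_trans (ltW tT) Tx').
Qed.

(** The primitive of v vanishes identically, hence v almost everywhere by Lebesgue's
differentiation theorem. *)
Theorem no_coef_null v : no_coef v -> nrm v = 0.
Proof.
move=> v0; have vL := L2realP v; have vi := sq_integrable_int vL.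
pose f := v \_ D.
have fi : mu.-integrable setT (EFin \o f).
  by rewrite /f -restrict_EFin; apply/(integrable_mkcond _ (measurable_sym_itv T)).1.
have lf : locally_integrable setT f by exact: integrable_locally_restrict (measurable_sym_itv T) vi.
have fiy y : mu.-integrable `]-oo, y] (EFin \o f).
  by apply: integrableS fi.
have F0 y : \int[mu]_(t in `]-oo, y]) f t = 0.
  rewrite /f -Rintegral_mkcondr.
  have h := no_coef_tailT y v0; have h0 := no_coef_tailT (- T) v0.
  have vT : \int[mu]_(t in D) v t = 0.
    rewrite -[RHS]h0; apply: eq_Rintegral => t.
    by rewrite inE /sym_itv/= in_itv/= => /andP[Tt _]; rewrite Tt.
  rewrite setIC Rintegral_mkcondr.
  transitivity (\int[mu]_(t in D) (v t - (if y < t then v t else 0))).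
    apply: eq_Rintegral => t _; rewrite patchE.
    by case: ifPn; rewrite ?in_setE ?notin_setE/= in_itv/=; case: ltP => //; rewrite ?subrr ?subr0.
  rewrite RintegralB//; first by rewrite vT h subrr.
  apply: (@le_integrable_real _ T _ (fun t => `|v t|)).
  - exact: measurable_tail.
  - by move=> t _; case: ifP => //; rewrite normr0.
  - exact: integrable_norm vi.
have := FTC1Ny fiy lf.
have -> : (fun x => \int[mu]_(t in `]-oo, x]) f t) = cst 0 by apply/funext => x; exact: F0.
move=> ae0.
have : (\int[mu]_(t in D) (v t ^+ 2)%:E = 0)%E.
  rewrite (@ge0_ae_eq_integral _ _ _ mu D _ (cst 0%E)) ?integral0//.
  - by apply: measurable_EFin_fun; apply: measurable_funX; exact: vL.1.
  - by move=> t _; rewrite lee_fin sqr_ge0.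
  move: ae0; apply: filterS; first exact: (ae_filter_ringOfSetsType mu).
  move=> t [_ h] Dt.
  move: h; rewrite derive1_cst /f patchE mem_set// => <-.
  by rewrite expr0n.
rewrite l2ip_ereal => -[vv]; apply/eqP.
by rewrite -sqrf_eq0 sqr_nrm; apply/eqP.
Qed.

End Totality.

(** * Parseval's formula *)

Section OrthoParseval.
Context {R : realType} {V : semiHilbertType R}.
Variables (x : nat -> V) (e : nat -> R).
Hypotheses (e01 : forall i, e i = 0 \/ e i = 1)
  (xe : forall i j, ip (x i) (x j) = if i == j then e i else 0)
  (total : forall v, (forall i, ip v (x i) = 0) -> nrm v = 0).

Lemma ortho_coef v i : e i * ip v (x i) = ip v (x i).
Proof.
have [ei|->] := e01 i; last by rewrite mul1r.
rewrite [in RHS]ipC (@nrm_eq0_ip _ _ (x i)) ?ei ?mul0r//.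
by apply/eqP; rewrite -sqrf_eq0 sqr_nrm xe eqxx ei.
Qed.

Lemma ortho_bessel : bessel 1 x.
Proof.
move=> n v; rewrite mul1r -subr_ge0.
pose S := \sum_(0 <= i < n) ip v (x i) *: x i.
have -> // : ip v v - \sum_(0 <= i < n) ip v (x i) ^+ 2 = ip (v - S) (v - S); last exact: ip_ge0.
have vS : ip v S = \sum_(0 <= i < n) ip v (x i) ^+ 2.
  by rewrite ip_sumr; apply: eq_bigr => i _; rewrite ipZr expr2.
have SS : ip S S = ip v S.
  rewrite vS {1}/S ip_suml; apply: eq_big_nat => i /andP[_ ni].
  rewrite ipZl ip_sumr expr2; congr (_ * _).
  rewrite (bigD1_seq i) ?mem_index_iota ?iota_uniq//=.
  rewrite ipZr xe eqxx mulrC ortho_coef big1 ?addr0// => j ji.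
  by rewrite ipZr xe eq_sym (negbTE ji) mulr0.
by rewrite ipBl !ipBr (ipC S v) SS vS; ring.
Qed.

(** The difference between v and its Fourier series has no coefficient. *)
Theorem ortho_parseval v : \sum_(0 <= i < n) ip v (x i) ^+ 2 @[n --> \oo] --> ip v v.
Proof.
pose w (i : nat) : R := 1.
have w1 i : 0 <= w i <= 1 by rewrite /w ler01 lexx.
pose z := frame_op x w v.
have zx k : ip z (x k) = ip v (x k).
  have h := @frame_op_ip _ _ _ _ ltr01 ortho_bessel _ v (x k) w1.
  suff h' : \sum_(0 <= i < n) w i * ip v (x i) * ip (x k) (x i) @[n --> \oo] --> ip v (x k).
    by rewrite -(cvg_lim _ h)// -(cvg_lim _ h').
  apply: cvg_near_cst; exists k.+1 => // n /= kn.
  rewrite (bigD1_seq k) ?mem_index_iota ?iota_uniq//=.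
  rewrite xe eqxx mul1r mulrC ortho_coef big1 ?addr0// => j jk.
  by rewrite xe eq_sym (negbTE jk) mulr0.
have vz : nrm (v - z) = 0 by apply: total => i; rewrite ipBl zx subrr.
have -> : ip v v = ip z v by apply/eqP; rewrite -subr_eq0 -ipBl nrm_eq0_ip.
apply: cvg_trans (@frame_op_ip _ _ _ _ ltr01 ortho_bessel _ v v w1).
by apply: near_eq_cvg; near=> n; apply: eq_bigr => i _; rewrite mul1r expr2.
Unshelve. all: by end_near. Qed.

End OrthoParseval.

Section Fourier.
Context {R : realType}.
Notation mu := (@lebesgue_measure R).
Variable T : R.
Hypothesis T0 : 0 < T.
Local Notation D := (sym_itv T).
Local Notation cosv := (@cosv R T).
Local Notation sinv := (@sinv R T).
Local Notation eta := (pi / T).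
Implicit Types (u v w : L2real T).

Lemma cosvN y : cosv (- y) = cosv y.
Proof. by apply: L2_ext => t; rewrite !mkL2E mulNr cosN. Qed.

Lemma sinvN y : sinv (- y) = - sinv y.
Proof. by apply: L2_ext => t; rewrite L2funN !mkL2E mulNr sinN. Qed.

(** Cosines at the even indices, sines at the odd ones.  The vector of index 1 is
zero, which is harmless and makes the frequency i./2 in both cases. *)
Definition fourier_vec i : L2real T :=
  if odd i then (Num.sqrt T)^-1 *: sinv (eta * i./2%:R)
  else (Num.sqrt (if i == 0%N then 2 * T else T))^-1 *: cosv (eta * i./2%:R).

Lemma sqr_inv_sqrt (A : R) : 0 < A -> (Num.sqrt A)^-1 * ((Num.sqrt A)^-1 * A) = 1.
Proof.
move=> A0; rewrite -{3}(sqr_sqrtr (ltW A0)).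
by field; rewrite gt_eqF// sqrtr_gt0.
Qed.

Lemma half_eq i j : odd i = odd j -> (i./2 == j./2) = (i == j).
Proof. by move=> ij; apply/eqP/eqP => [h|->//]; rewrite -(odd_double_half i) ij h odd_double_half. Qed.

Lemma fourier_ortho i j :
  ip (fourier_vec i) (fourier_vec j) = if i == j then (i != 1%N)%:R else 0.
Proof.
rewrite /fourier_vec.
have [oi|ei] := boolP (odd i); have [oj|ej] := boolP (odd j); rewrite ipZl ipZr.
- rewrite ip_sinv_lattice// half_eq ?oi ?oj//.
  case: (i =P j) => [ij|_]; last by rewrite !mulr0.
  subst j.
  have -> : (i./2 != 0%N) = (i != 1%N) by case: i oi {oj} => [|[|[|i]]].
  by case: (i != 1%N); rewrite /= ?mulr0// sqr_inv_sqrt.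
- rewrite ipC ip_cosv_sinv// !mulr0 ifF//.
  by apply/negbTE; apply: contraNneq ej => <-.
- rewrite ip_cosv_sinv// !mulr0 ifF//.
  by apply/negbTE; apply: contraNneq ei => ->.
- rewrite ip_cosv_lattice// half_eq ?(negbTE ei) ?(negbTE ej)//.
  case: (i =P j) => [ij|_]; last by rewrite !mulr0.
  subst j.
  have -> : (i./2 == 0%N) = (i == 0%N) by case: i ei {ej} => [|[|[|i]]].
  have -> : i != 1%N by apply: contraNneq ei => ->.
  by case: ifP => _; rewrite sqr_inv_sqrt// mulr_gt0.
Qed.

Lemma fourier_total v : (forall i, ip v (fourier_vec i) = 0) -> nrm v = 0.
Proof.
move=> v0; apply: (no_coef_null T0).
have c0 j : ip v (cosv (eta * j%:R)) = 0.
  have := v0 j.*2; rewrite /fourier_vec odd_double doubleK ipZr => /eqP.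
  rewrite mulf_eq0 invr_eq0 sqrtr_eq0 leNgt => /orP[|/eqP//].
  by case: ifP => _; rewrite ?mulr_gt0 ?T0.
have s0 j : ip v (sinv (eta * j%:R)) = 0.
  have := v0 j.*2.+1; rewrite /fourier_vec/= odd_double/= uphalf_double ipZr => /eqP.
  by rewrite mulf_eq0 invr_eq0 sqrtr_eq0 leNgt T0/= => /eqP.
move=> [n|n]; rewrite /freq; first by split; [exact: c0|exact: s0].
rewrite NegzE rmorphN/= mulrN cosvN sinvN ipNr.
by split; [exact: c0|rewrite s0 oppr0].
Qed.

(** Grouping the terms of indices 2 j and 2 j + 1 of the orthogonal expansion. *)
Lemma fourier_parseval v :
  \sum_(0 <= j < n) (if j == 0%N then 2^-1 else 1) *
     (ip v (cosv (eta * j%:R)) ^+ 2 + ip v (sinv (eta * j%:R)) ^+ 2) @[n --> \oo]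
    --> T * ip v v.
Proof.
have e01 (i : nat) : ((i != 1%N)%:R : R) = 0 \/ ((i != 1%N)%:R : R) = 1 by case: (_ != _); [right|left].
have h := @ortho_parseval _ _ _ _ e01 fourier_ortho fourier_total v.
have dbl : (fun n => n.*2) @ \oo --> \oo.
  move=> A [N _ NA]; exists N => // n /= Nn; apply: NA => /=.
  by rewrite (leq_trans Nn)// -addnn leq_addr.
have h2 : \sum_(0 <= i < n.*2) ip v (fourier_vec i) ^+ 2 @[n --> \oo] --> ip v v.
  exact: (cvg_comp _ _ dbl h).
apply: cvg_trans (@cvgMl_tmp _ _ _ _ _ T _ h2); apply: near_eq_cvg; near=> n.
rewrite mulr_sumr; elim: (n) => [|k IH]; first by rewrite !big_geq.
rewrite doubleS !big_nat_recr//= IH -!addrA; congr (_ + _).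
rewrite /fourier_vec/= odd_double/= doubleK uphalf_double !ipZr !exprMn !exprVn.
rewrite double_eq0 sqr_sqrtr; last by case: ifP => _; rewrite ?mulr_ge0// ltW.
rewrite sqr_sqrtr ?(ltW T0)//.
case: eqP => [->|_]; last by field; rewrite gt_eqF.
rewrite mulr0 (_ : sinv 0 = 0) ?ip0r; first by field; rewrite gt_eqF.
by apply: L2_ext => t; rewrite mkL2E L2fun0 mul0r sin0.
Unshelve. all: by end_near. Qed.

End Fourier.

Section Extension.
Context {R : realType}.
Notation mu := (@lebesgue_measure R).
Variables (T L : R).
Hypothesis TL : T <= L.
Implicit Types (u v w : L2real T).

Lemma sym_itv_sub : sym_itv T `<=` sym_itv L.
Proof.
move=> t; rewrite /sym_itv/= !in_itv/= => /andP[h1 h2].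
by rewrite (le_lt_trans _ h1) ?lerN2// (lt_le_trans h2).
Qed.

Lemma sq_integrable_ext v : sq_integrable L (v \_ (sym_itv T)).
Proof.
have [mv vi] := L2realP v.
have mv' : measurable_fun (sym_itv L) (v \_ (sym_itv T)).
  apply: (measurable_restrict v (measurable_sym_itv T) (measurable_sym_itv L)).1.
  by rewrite (setIidr sym_itv_sub).
split => //; rewrite (_ : EFin \o _ = (EFin \o (fun t => v t ^+ 2)) \_ (sym_itv T)); last first.
  apply/funext => t; rewrite /= !patchE; case: ifP => // _.
  by rewrite expr0n.
apply: (integrable_restrict mu (measurable_sym_itv T) (measurable_sym_itv L) _).1.
by rewrite (setIidr sym_itv_sub).
Qed.

Definition extv v : L2real L := mkL2 (sq_integrable_ext v).

Lemma Rintegral_extv (f : R -> R) v :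
  \int[mu]_(t in sym_itv L) (extv v t * f t) = \int[mu]_(t in sym_itv T) (v t * f t).
Proof.
rewrite -[in RHS](setIidl sym_itv_sub) Rintegral_mkcondl.
apply: eq_Rintegral => t _; rewrite mkL2E !patchE.
by case: ifP; rewrite ?mul0r.
Qed.

End Extension.

Section TrigSystem.
Context {R : realType}.
Variable T : R.
Hypothesis T0 : 0 < T.
Implicit Types (u v w : L2real T).

(** A step eta <= pi / T is the fundamental frequency of the longer interval
(-L, L), L = pi / eta; extend v by zero to it. *)
Lemma trig_parseval v (eta : R) : 0 < eta -> eta * T <= pi ->
  \sum_(0 <= j < n) (if j == 0%N then 2^-1 else 1) *
     (ip v (cosv T (eta * j%:R)) ^+ 2 + ip v (sinv T (eta * j%:R)) ^+ 2) @[n --> \oo]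
    --> pi / eta * ip v v.
Proof.
move=> e0 eT; pose L := pi / eta.
have L0 : 0 < L by rewrite divr_gt0 ?pi_gt0.
have TL : T <= L by rewrite ler_pdivlMr// mulrC.
have eE : pi / L = eta by rewrite /L invf_div mulrCA divff ?mulr1// gt_eqF// pi_gt0.
have <- : ip (extv TL v) (extv TL v) = ip v v.
  rewrite !ipE Rintegral_extv; apply: eq_Rintegral => t tD.
  by rewrite mkL2E patchE tD.
apply: cvg_trans (@fourier_parseval _ L L0 (extv TL v)); apply: near_eq_cvg.
by near=> n; apply: eq_bigr => j _; rewrite eE !ipE !Rintegral_extv.
Unshelve. all: by end_near. Qed.

Theorem trig_system : exp_system T (cosv T) (sinv T) (@mulv R T).
Proof.
split => //.
- by move=> v; exact: l2_mulv.
- by move=> y; exact: cosv_le.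
- by move=> y; exact: sinv_le.
- exact: is_derive_cosv.
- exact: is_derive_sinv.
- exact: trig_parseval.
Qed.

Lemma cosv_orthogonal (m n : nat) :
  ip (cosv T (pi / T * m.+1%:R)) (cosv T (pi / T * n.+1%:R)) = if m == n then T else 0.
Proof. by rewrite ip_cosv_lattice// eqSS. Qed.

Lemma cosv_separated m n : (m < n)%N ->
  T <= nrm (cosv T (pi / T * m.+1%:R) - cosv T (pi / T * n.+1%:R)) ^+ 2.
Proof.
move=> mn; rewrite sqr_nrm ipBl !ipBr !cosv_orthogonal !eqxx.
by rewrite (gtn_eqF mn) (ltn_eqF mn); have := T0; lra.
Qed.

End TrigSystem.

(** * Real and imaginary parts of the zeta function of a set *)

Section ComplexLimits.
Local Open Scope complex_scope.
Context {R : realType}.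
Implicit Types (z : R[i]) (a b : R).

Lemma norm_complex_le a b : `|a +i* b| <= (`|a| + `|b|)%:C.
Proof.
rewrite lecE/= eqxx/= -[leRHS]ger0_norm ?addr_ge0// -sqrtr_sqr ler_sqrt ?sqr_ge0//.
rewrite sqrrD !real_normK ?num_real// addrAC lerDl.
by rewrite mulrn_wge0// mulr_ge0.
Qed.

Lemma cvg_complex (I : Type) (F : set_system I) {FF : Filter F} (f g : I -> R) a b :
  f x @[x --> F] --> a -> g x @[x --> F] --> b ->
  (f x +i* g x : R[i]^o) @[x --> F] --> (a +i* b : R[i]^o).
Proof.
move=> fa gb; apply/cvgrPdist_lt => -[e e'].
rewrite ltcE/= => /andP[/eqP -> e0].
have e2 : 0 < e / 2 by rewrite divr_gt0.
move/cvgrPdist_lt : fa => /(_ _ e2) fa; move/cvgrPdist_lt : gb => /(_ _ e2) gb.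
near=> x.
apply: le_lt_trans (norm_complex_le (a - f x) (b - g x)) _.
rewrite ltcE/= eqxx/= [ltRHS](splitr e) ltrD//.
- by near: x.
- by near: x.
Unshelve. all: by end_near. Qed.

End ComplexLimits.

Section ZetaKernel.
Local Open Scope complex_scope.
Context {R : realType}.
Variable K : set nat.
Implicit Types (sigma x y : R) (f : nat -> R).

Definition twisted_part sigma f N : R :=
  \sum_(1 <= n < N.+1) (n \in K)%:R * npow sigma n * f n.

Definition twisted_zeta sigma f : R := limn (twisted_part sigma f).

Lemma twisted_part_diff sigma f m n : (forall k, `|f k| <= 1) -> (m <= n)%N ->
  `|twisted_part sigma f n - twisted_part sigma f m| <= zeta_part K sigma n - zeta_part K sigma m.
Proof.
move=> f1 mn; rewrite /twisted_part /zeta_part.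
rewrite !(@big_cat_nat _ _ _ m.+1 1 n.+1)//= ![\sum_(1 <= _ < m.+1) _ + _]addrC !addrK.
apply: le_trans (ler_norm_sum _ _ _) _; apply: ler_sum => k _.
have w0 : 0 <= (k \in K)%:R * npow sigma k by rewrite mulr_ge0// ltW// npow_gt0.
by rewrite normrM (ger0_norm w0) ler_piMr.
Qed.

Lemma twisted_cvg sigma f : 1 < sigma -> (forall k, `|f k| <= 1) ->
  twisted_part sigma f @ \oo --> twisted_zeta sigma f.
Proof.
move=> s1 f1.
pose F n := (n.+1 \in K)%:R * npow sigma n.+1 * f n.+1.
have pE : twisted_part sigma f = series F.
  by apply/funext => N; rewrite /twisted_part big_add1.
rewrite /twisted_zeta pE; apply: normed_cvg; apply: nondecreasing_is_cvgn.
  by apply/nondecreasing_seqP => n; rewrite /= [leRHS]big_nat_recr//= lerDl.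
exists (rzeta K sigma) => _ [n _ <-].
apply: le_trans (zeta_part_le K n s1); rewrite /zeta_part big_add1.
apply: ler_sum => k _.
have w0 : 0 <= (k.+1 \in K)%:R * npow sigma k.+1 by rewrite mulr_ge0// ltW// npow_gt0.
by rewrite /= /F normrM (ger0_norm w0) ler_piMr.
Qed.

(** A bound that does not depend on f: this is what makes the convergence uniform in
the position when f is a cosine. *)
Lemma twisted_tail sigma f N : 1 < sigma -> (forall k, `|f k| <= 1) ->
  `|twisted_zeta sigma f - twisted_part sigma f N| <= rzeta K sigma - zeta_part K sigma N.
Proof.
move=> s1 f1.
have h : `|twisted_part sigma f n - twisted_part sigma f N| @[n --> \oo] -->
    `|twisted_zeta sigma f - twisted_part sigma f N|.
  by apply: cvg_norm; apply: cvgB; [exact: twisted_cvg|exact: cvg_cst].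
apply: (cvgr_to_le h); near=> n.
have Nn : (N <= n)%N by near: n; exists N.
apply: le_trans (twisted_part_diff _ f1 Nn) _.
by rewrite lerB// zeta_part_le.
Unshelve. all: by end_near. Qed.

Lemma cnatpowE sigma y n : cnatpow n (- (sigma +i* y)) =
  (npow sigma n * cos (y * ln n%:R)) +i* - (npow sigma n * sin (y * ln n%:R)).
Proof.
rewrite /cnatpow /cexp /npow /=; apply/eqP; rewrite eq_complex/=.
rewrite !mulr0 !mul0r !subr0 !add0r !addr0.
have -> : - y * ln n%:R = - (y * ln n%:R) :> R by rewrite mulNr.
rewrite cosN sinN mulrN.
by rewrite !eqxx.
Qed.

Lemma complex_sum (r : seq nat) (P : pred nat) (F G : nat -> R) :
  \sum_(n <- r | P n) (F n +i* G n) = (\sum_(n <- r | P n) F n) +i* (\sum_(n <- r | P n) G n).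
Proof. by elim/big_rec3: _ => // n a b _ _ ->. Qed.

Lemma zetaE sigma y : 1 < sigma ->
  zeta K (sigma +i* y) = twisted_zeta sigma (fun n => cos (y * ln n%:R))
    +i* - twisted_zeta sigma (fun n => sin (y * ln n%:R)).
Proof.
move=> s1; apply: (@cvg_lim R[i]^o) => //.
have c1 n : `|cos (y * ln n%:R : R)| <= 1 by exact: cos_max.
have c2 n : `|sin (y * ln n%:R : R)| <= 1 by exact: sin_max.
apply: cvg_trans (cvg_complex (twisted_cvg s1 c1) (cvgN (twisted_cvg s1 c2))).
apply: near_eq_cvg; near=> N.
under [RHS]eq_bigr do rewrite cnatpowE.
rewrite complex_sum /twisted_part; congr (_ +i* _).
  rewrite [RHS]big_mkcond/=; apply: eq_bigr => n _.
  by case: (n \in K); rewrite ?mul1r ?mul0r.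
rewrite -sumrN [RHS]big_mkcond/=; apply: eq_bigr => n _.
by case: (n \in K); rewrite ?mul1r ?mul0r ?oppr0.
Unshelve. all: by end_near. Qed.

Lemma twisted_zeta1 sigma f : (forall n, f n = 1) -> twisted_zeta sigma f = rzeta K sigma.
Proof.
move=> f1; rewrite /twisted_zeta /rzeta; congr (limn _); apply/funext => N.
by apply: eq_bigr => n _; rewrite f1 mulr1.
Qed.

Lemma zeta_real sigma : 1 < sigma -> zeta K sigma%:C = (rzeta K sigma)%:C.
Proof.
move=> s1; rewrite zetaE// twisted_zeta1; last by move=> n; rewrite mul0r cos0.
rewrite (_ : twisted_zeta _ _ = 0) ?oppr0// /twisted_zeta (_ : twisted_part _ _ = fun=> 0).
  exact: lim_cst.
by apply/funext => N; apply: big1 => n _; rewrite mul0r sin0 mulr0.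
Qed.

Lemma Re_zeta sigma y : 1 < sigma ->
  complex.Re (zeta K (sigma +i* y)) = twisted_zeta sigma (fun n => cos (y * ln n%:R)).
Proof. by move=> s1; rewrite zetaE. Qed.

End ZetaKernel.

Section InvZeta.
Local Open Scope complex_scope.
Context {R : realType}.

(** On the real half-line the complex zeta function is real. *)
Lemma inv_zeta_at1E (Q : set nat) (d : R) : Q `<=` primes_set ->
  has_density (generated_integers Q) d -> 0 <= d <= 1 ->
  inv_zeta_at1 R (generated_integers (primes_set `\` Q)) = d%:C.
Proof.
move=> Qp Kd d01; apply: (@cvg_lim R[i]^o) => //.
apply: cvg_trans (cvg_complex (inv_rzeta_cvg Qp Kd d01) (cvg_cst (0 : R))).
apply: near_eq_cvg; near=> sigma.
have s1 : 1 < sigma by near: sigma; exact: nbhs_right_gt.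
by rewrite zeta_real// -[in LHS]/((_)%:C) fmorphV.
Unshelve. all: by end_near. Qed.

End InvZeta.

(** * Complex functions as pairs of real vectors *)

Section ComplexL2.
Local Open Scope complex_scope.
Context {R : realType}.
Notation mu := (@lebesgue_measure R).
Variable T : R.
Local Notation D := (sym_itv T).
Implicit Types (g h : R -> R[i]) (u v w : L2real T) (f : R -> R).

(** Total, with the default value 0, so as to be applied to a function before it is
known to be square integrable. *)
Definition toL2 f : L2real T :=
  if pselect (sq_integrable T f) is left fi then mkL2 fi else 0.

Lemma toL2E f : sq_integrable T f -> L2fun (toL2 f) = f.
Proof. by rewrite /toL2; case: pselect. Qed.

Definition rep g := toL2 (fun t => complex.Re (g t)).
Definition imp g := toL2 (fun t => complex.Im (g t)).

(** The complex modulus inside the norm is the square root of a sum of squares. *)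
Lemma L2norm_int g :
  L2norm T g = poweR (\int[mu]_(t in D) (complex.Re (g t) ^+ 2 + complex.Im (g t) ^+ 2)%:E) 2^-1.
Proof.
rewrite /L2norm unlock [in RHS]integral_mkcond; congr poweR.
apply: eq_integral => t _; rewrite !patchE.
case: ifP => _; last by rewrite abse0 poweR0r.
case: (g t) => a b /=.
rewrite ger0_norm ?sqrtr_ge0// powR_mulrn ?sqrtr_ge0//.
by rewrite sqr_sqrtr// addr_ge0 ?sqr_ge0.
Qed.

Lemma L2P g : L2 T g <-> sq_integrable T (fun t => complex.Re (g t)) /\
  sq_integrable T (fun t => complex.Im (g t)).
Proof.
split=> [[mr mi]|[[mr ir] [mi ii]]]; last first.
  split => //; rewrite L2norm_int.
  have : mu.-integrable D (EFin \o (fun t => complex.Re (g t) ^+ 2 + complex.Im (g t) ^+ 2)).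
    exact: integrable_realD.
  move/(integrable_fin_num (measurable_sym_itv T)) => /fineK <-.
  by rewrite poweR_EFin ltry.
rewrite L2norm_int => fin.
have msum : measurable_fun D (fun t => complex.Re (g t) ^+ 2 + complex.Im (g t) ^+ 2).
  by apply: measurable_funD; exact: measurable_funX.
have isum : mu.-integrable D (EFin \o (fun t => complex.Re (g t) ^+ 2 + complex.Im (g t) ^+ 2)).
  apply/integrableP; split; first exact/measurable_EFinP.
  under eq_integral do rewrite /= ger0_norm ?addr_ge0 ?sqr_ge0//.
  rewrite ltey; apply/eqP => E; by move: fin; rewrite E poweRyr ?ltxx// invr_neq0.
have le_part f : measurable_fun D f ->
    (forall t, f t ^+ 2 <= complex.Re (g t) ^+ 2 + complex.Im (g t) ^+ 2) -> sq_integrable T f.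
  move=> mf fg; split => //; apply: (le_integrable_real _ _ isum).
    exact: measurable_funX.
  by move=> t _; rewrite ger0_norm ?sqr_ge0.
by split; apply: le_part => // t; rewrite ?lerDl ?lerDr sqr_ge0.
Qed.

Lemma repE g : L2 T g -> L2fun (rep g) = fun t => complex.Re (g t).
Proof. by move=> /L2P[? _]; rewrite toL2E. Qed.

Lemma impE g : L2 T g -> L2fun (imp g) = fun t => complex.Im (g t).
Proof. by move=> /L2P[_ ?]; rewrite toL2E. Qed.

Lemma L2normE g : L2 T g -> L2norm T g = (Num.sqrt (nrm (rep g) ^+ 2 + nrm (imp g) ^+ 2))%:E.
Proof.
move=> gL; rewrite L2norm_int !sqr_nrm.
have s0 : 0 <= ip (rep g) (rep g) + ip (imp g) (imp g) by rewrite addr_ge0 ?ip_ge0.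
rewrite -powR12_sqrt// -poweR_EFin; congr poweR.
rewrite EFinD -!l2ip_ereal repE// impE//.
under eq_integral do rewrite EFinD.
have [[mr ir] [mi ii]] := (L2P g).1 gL.
by rewrite integralD.
Qed.

Definition cvec u v : R -> R[i] := fun t => u t +i* v t.

Lemma L2_cvec u v : L2 T (cvec u v).
Proof. by apply/L2P; split; exact: L2realP. Qed.

Lemma rep_cvec u v : rep (cvec u v) = u.
Proof. by apply: L2_ext => t; rewrite repE//; exact: L2_cvec. Qed.

Lemma imp_cvec u v : imp (cvec u v) = v.
Proof. by apply: L2_ext => t; rewrite impE//; exact: L2_cvec. Qed.

Lemma cvec_parts g : L2 T g -> g = cvec (rep g) (imp g).
Proof. by move=> gL; apply/funext => t; rewrite /cvec repE// impE//; case: (g t). Qed.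

Lemma cvec_lin (a : R[i]) u v u' v' :
  (fun t => a * cvec u v t + cvec u' v' t) =
  cvec (complex.Re a *: u - complex.Im a *: v + u') (complex.Re a *: v + complex.Im a *: u + v').
Proof. by apply/funext => t; case: a => a b. Qed.

Lemma cvecB u v u' v' :
  (fun t => cvec u v t - cvec u' v' t) = cvec (u - u') (v - v').
Proof. by apply/funext => t. Qed.

Lemma L2norm_cvec u v : L2norm T (cvec u v) = (Num.sqrt (nrm u ^+ 2 + nrm v ^+ 2))%:E.
Proof. by rewrite (L2normE (L2_cvec u v)) rep_cvec imp_cvec. Qed.

Lemma nrm_null_ae u : nrm u = 0 <-> {ae mu, forall t, D t -> u t = 0}.
Proof.
have FF := ae_filter_ringOfSetsType mu.
have m2 : measurable_fun D (fun t => (u t ^+ 2)%:E).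
  by apply: measurable_EFin_fun; apply: measurable_funX; exact: (L2realP u).1.
have I2 : (\int[mu]_(t in D) `|(u t ^+ 2)%:E| = (nrm u ^+ 2)%:E)%E.
  rewrite sqr_nrm -l2ip_ereal; apply: eq_integral => t _.
  by rewrite gee0_abs// lee_fin sqr_ge0.
have h := ae_eq_integral_abs mu (measurable_sym_itv T) m2.
split=> [u0|u0].
  have /h : (\int[mu]_(t in D) `|(u t ^+ 2)%:E| = 0)%E by rewrite I2 u0 expr0n.
  apply: filterS => t ut Dt; have := ut Dt => -[/eqP].
  by rewrite sqrf_eq0 => /eqP.
have : (\int[mu]_(t in D) `|(u t ^+ 2)%:E| = 0)%E.
  by apply/h; move: u0; apply: filterS => t ut Dt; rewrite ut// expr0n.
by rewrite I2 => -[/eqP]; rewrite sqrf_eq0 => /eqP.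
Qed.

Lemma nrm_eq_on u v : (forall t, D t -> u t = v t) -> nrm (u - v) = 0.
Proof.
move=> uv; apply/nrm_null_ae/aeW => t Dt.
by rewrite L2funD L2funN uv// subrr.
Qed.

Lemma L2eq_cvec u v u' v' : L2eq T (cvec u v) (cvec u' v') <->
  nrm (u - u') = 0 /\ nrm (v - v') = 0.
Proof.
have FF := ae_filter_ringOfSetsType mu.
split=> [E|[/nrm_null_ae uu /nrm_null_ae vv]].
  split; apply/nrm_null_ae; move: E; apply: filterS => t Et /Et[e1 e2];
    by rewrite L2funD L2funN ?e1 ?e2 subrr.
move: uu vv; apply: filterS2 => t ut vt Dt.
rewrite /cvec; congr (_ +i* _); apply/eqP; rewrite -subr_eq0.
  by have := ut Dt; rewrite L2funD L2funN => ->.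
by have := vt Dt; rewrite L2funD L2funN => ->.
Qed.

Lemma nrm_le_sup u b : 0 < T -> (forall t, D t -> `|u t| <= b) -> nrm u <= Num.sqrt (2 * T) * b.
Proof.
move=> T0 ub.
have b0 : 0 <= b.
  by apply: le_trans (ub 0 _) => //; rewrite /sym_itv/= in_itv/= oppr_lt0 T0.
rewrite -ler_sqr ?nnegrE ?nrm_ge0 ?mulr_ge0// exprMn sqr_nrm sqr_sqrtr ?mulr_ge0 ?(ltW T0)//.
rewrite ipE -(Rintegral_cst_sym _ T0); apply: le_Rintegral => //.
- exact: (l2ip_int u u).
- exact: integrable_cst_sym.
move=> t /ub utb; rewrite -expr2 -(real_normK (num_real (u t))).
by rewrite lerXn2r ?nnegrE.
Qed.

End ComplexL2.

(** * Convolution with the real part of the zeta function *)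

Section Convolution.
Local Open Scope complex_scope.
Context {R : realType}.
Notation mu := (@lebesgue_measure R).
Variable T : R.
Hypothesis T0 : 0 < T.
Local Notation D := (sym_itv T).
Local Notation cosv := (@cosv R T).
Local Notation sinv := (@sinv R T).
Variable K : set nat.
Variable sigma : R.
Hypothesis sigma1 : 1 < sigma.
Implicit Types (u v w : L2real T) (g : R -> R[i]) (t : R).

Lemma L2fun_sum (r : seq nat) (P : pred nat) (F : nat -> L2real T) t :
  (\sum_(n <- r | P n) F n) t = \sum_(n <- r | P n) F n t.
Proof. by elim/big_rec2: _ => // n y x _ <-; rewrite L2funD. Qed.

Definition kernel_part t m : L2real T := \sum_(1 <= n < m.+1) ((n \in K)%:R * npow sigma n) *:
  (cos (ln n%:R * t) *: cosv (ln n%:R) + sin (ln n%:R * t) *: sinv (ln n%:R)).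

Lemma kernel_partE t m s :
  kernel_part t m s = twisted_part K sigma (fun n => cos ((t - s) * ln n%:R)) m.
Proof.
rewrite /kernel_part L2fun_sum; apply: eq_bigr => n _.
rewrite L2funZ L2funD !L2funZ !mkL2E; congr (_ * _).
by rewrite mulrBl cosB ![ln _ * _]mulrC.
Qed.

Definition zeta_kernel t s : R := twisted_zeta K sigma (fun n => cos ((t - s) * ln n%:R)).

Lemma kernel_cvg t s : kernel_part t m s @[m --> \oo] --> zeta_kernel t s.
Proof.
have c1 n : `|cos ((t - s) * ln n%:R)| <= 1 by exact: cos_max.
rewrite (_ : (fun m => _) = twisted_part K sigma (fun n => cos ((t - s) * ln n%:R))).
  exact: twisted_cvg.
by apply/funext => m; rewrite kernel_partE.
Qed.

Lemma kernel_tail t s m :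
  `|zeta_kernel t s - kernel_part t m s| <= rzeta K sigma - zeta_part K sigma m.
Proof. by rewrite kernel_partE; apply: twisted_tail => // n; exact: cos_max. Qed.

Lemma sq_integrable_kernel t : sq_integrable T (zeta_kernel t).
Proof.
apply: (@sq_integrable_bounded _ _ _ (rzeta K sigma)) => [|s _].
  apply: (@measurable_fun_cvg _ _ _ _ (fun m => L2fun (kernel_part t m))) => [m|s _].
    exact: (L2realP _).1.
  exact: kernel_cvg.
have := kernel_tail t s 0; rewrite kernel_partE /twisted_part /zeta_part.
by rewrite !big_geq// !subr0.
Qed.

Definition kernel_vec t : L2real T := mkL2 (sq_integrable_kernel t).

Lemma kernel_vec_tail t m :
  nrm (kernel_vec t - kernel_part t m) <= Num.sqrt (2 * T) * (rzeta K sigma - zeta_part K sigma m).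
Proof.
apply: nrm_le_sup => // s _; rewrite L2funD L2funN mkL2E; exact: kernel_tail.
Qed.

Lemma zeta_rest_cvg : rzeta K sigma - zeta_part K sigma m @[m --> \oo] --> (0 : R).
Proof.
rewrite -[X in _ --> X](subrr (rzeta K sigma)).
by apply: cvgB; [exact: cvg_cst|exact: rzeta_cvg].
Qed.

Definition conv_part v m : L2real T := \sum_(1 <= n < m.+1) ((n \in K)%:R * npow sigma n) *:
  (ip v (cosv (ln n%:R)) *: cosv (ln n%:R) + ip v (sinv (ln n%:R)) *: sinv (ln n%:R)).

Lemma conv_partE v m t : conv_part v m t = ip v (kernel_part t m).
Proof.
rewrite /conv_part L2fun_sum ip_sumr; apply: eq_bigr => n _.
rewrite ipZr ipDr !ipZr L2funZ L2funD !L2funZ !mkL2E; congr (_ * _).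
by rewrite ![_ * ip _ _]mulrC.
Qed.

(** <v, kernel_vec t> is the convolution of v with the kernel at t; the bound does not
depend on t, so that the partial sums converge uniformly. *)
Lemma conv_tail v m t : `|ip v (kernel_vec t) - conv_part v m t| <=
  nrm v * (Num.sqrt (2 * T) * (rzeta K sigma - zeta_part K sigma m)).
Proof.
rewrite conv_partE -ipBr; apply: le_trans (cauchy_schwarz _ _) _.
by rewrite ler_wpM2l ?nrm_ge0// kernel_vec_tail.
Qed.

Lemma sq_integrable_conv v : sq_integrable T (fun t => ip v (kernel_vec t)).
Proof.
have h0 : nrm v * (Num.sqrt (2 * T) * (rzeta K sigma - zeta_part K sigma m)) @[m --> \oo] --> (0 : R).
  rewrite -[X in _ --> X](mulr0 (nrm v)); apply: cvgMl_tmp.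
  rewrite -[X in _ --> X](mulr0 (Num.sqrt (2 * T))); apply: cvgMl_tmp.
  exact: zeta_rest_cvg.
apply: (@sq_integrable_bounded _ _ _ (nrm v * (Num.sqrt (2 * T) * rzeta K sigma))) => [|t _].
  apply: (@measurable_fun_cvg _ _ _ _ (fun m => L2fun (conv_part v m))) => [m|t _].
    exact: (L2realP _).1.
  apply/cvgrPdist_le => e e0.
  move/cvgrPdist_le : h0 => /(_ _ e0); apply: filterS => m.
  rewrite sub0r normrN => h; apply: le_trans (conv_tail v m t) _.
  exact: le_trans (ler_norm _) h.
have c0 : conv_part v 0 t = 0 by rewrite /conv_part big_geq.
by have := conv_tail v 0 t; rewrite c0 subr0 /zeta_part big_geq// subr0.
Qed.

Definition conv_vec v : L2real T := mkL2 (sq_integrable_conv v).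

Lemma conv_part_scvg v : scvg (conv_part v) (conv_vec v).
Proof.
pose B := Num.sqrt (2 * T) * (nrm v * Num.sqrt (2 * T)).
have hB : B * (rzeta K sigma - zeta_part K sigma m) @[m --> \oo] --> (0 : R).
  by rewrite -[X in _ --> X](mulr0 B); apply: cvgMl_tmp; exact: zeta_rest_cvg.
apply/scvgP => e e0; move/cvgrPdist_le : hB => /(_ _ e0); apply: filterS => m.
rewrite sub0r normrN => h; apply: le_trans (le_trans (ler_norm _) h).
rewrite nrmB /B -!mulrA; apply: nrm_le_sup => // t _.
by rewrite L2funD L2funN mkL2E; exact: conv_tail.
Qed.

End Convolution.

Section ZetaOpDelta.
Local Open Scope complex_scope.
Context {R : realType}.
Notation mu := (@lebesgue_measure R).
Variable T : R.
Hypothesis T0 : 0 < T.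
Local Notation D := (sym_itv T).
Variable K : set nat.
Implicit Types (u v w : L2real T) (g : R -> R[i]) (t delta : R).

Lemma sq_integrable_eq (f f' : R -> R) : (forall t, D t -> f t = f' t) ->
  sq_integrable T f -> sq_integrable T f'.
Proof.
move=> ff [mf fi]; split.
  by apply: eq_measurable_fun mf => t; rewrite inE => Dt; rewrite ff.
by apply: eq_integrable fi => // t; rewrite inE => Dt /=; rewrite ff.
Qed.

Lemma toL2_eq (f : R -> R) u : (forall t, D t -> f t = u t) ->
  sq_integrable T f /\ nrm (toL2 T f - u) = 0.
Proof.
move=> fu.
have fi : sq_integrable T f by apply: (sq_integrable_eq _ (L2realP u)) => t Dt; rewrite fu.
by split => //; apply: nrm_eq_on => t Dt; rewrite toL2E// fu.
Qed.

(** The kernel is real. *)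
Lemma zeta_op_deltaE delta g t (d0 : 0 < delta) (s1 : 1 < 1 + delta) : L2 T g -> D t ->
  zeta_op_delta K T delta g t = cvec (pi^-1 *: conv_vec T0 K s1 (rep T g))
    (pi^-1 *: conv_vec T0 K s1 (imp T g)) t.
Proof.
move=> gL Dt; rewrite /zeta_op_delta /cvec !L2funZ !mkL2E.
rewrite indicE mem_set// /cintegral.
have E : forall z (x : R), complex.Re (z * x%:C) = complex.Re z * x /\ complex.Im (z * x%:C) = complex.Im z * x.
  by move=> [a b] x /=; rewrite !mulr0 subr0 add0r.
have -> : \int[mu]_(s in D) complex.Re (g s * (complex.Re (zeta K ((1 + delta) +i* (t - s))))%:C)
  = ip (rep T g) (kernel_vec T K s1 t).
  rewrite ipE; apply: eq_Rintegral => s _.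
  by rewrite (E _ _).1 Re_zeta// repE// mkL2E.
have -> : \int[mu]_(s in D) complex.Im (g s * (complex.Re (zeta K ((1 + delta) +i* (t - s))))%:C)
  = ip (imp T g) (kernel_vec T K s1 t).
  rewrite ipE; apply: eq_Rintegral => s _.
  by rewrite (E _ _).2 Re_zeta// impE// mkL2E.
by apply/eqP; rewrite eq_complex/= mul1r !mul0r subr0 addr0 !eqxx.
Qed.

End ZetaOpDelta.

(** * The limit of the regularized operators *)

Section ZetaOp.
Local Open Scope complex_scope.
Context {R : realType}.
Notation mu := (@lebesgue_measure R).
Variable T : R.
Hypothesis T0 : 0 < T.
Local Notation D := (sym_itv T).
Variables (K : set nat) (d : R).
Hypotheses (Kd : has_density K d) (d01 : 0 <= d <= 1).
Implicit Types (u v w : L2real T) (g : R -> R[i]) (t delta : R).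

Local Notation lam := (fun n : nat => ln (n%:R : R)).
Local Notation zsum := (sum_op (cosv T) (sinv T) (log_wt K) lam).
Local Notation Z := (sum_op1 (cosv T) (sinv T) (log_wt K) lam).

Let ES := trig_system T0.
Let a0 := @log_wt_ge0 R K.
Let areg := log_wt_regular Kd d01.

Lemma npow_itv delta : 0 <= delta -> forall n, 0 <= npow delta n <= 1.
Proof.
move=> d0 n; rewrite ltW ?npow_gt0//= /npow expR_le1 mulNr oppr_le0 mulr_ge0//.
by case: n => [|n]; [rewrite ln0|rewrite ln_ge0// ler1n].
Qed.

Lemma npow_cvg1 n : npow delta n @[delta --> (0 : R)^'+] --> (1 : R).
Proof.
have -> : (1 : R) = npow 0 n by rewrite /npow oppr0 mul0r expR0.
apply: cvg_at_right_filter; apply: continuous_comp; last exact: continuous_expR.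
by apply: cvgMr_tmp; apply: cvgN; exact: cvg_id.
Qed.

Lemma npow_shift delta n : (0 < n)%N -> npow (1 + delta) n = npow delta n / n%:R.
Proof.
move=> n0; rewrite /npow opprD mulrDl mulN1r expRD mulrC expRN lnK//.
by rewrite posrE ltr0n.
Qed.

(** The weight n^-delta / n is n^-(1+delta); there is no term of index 0. *)
Lemma sum_part_conv delta v m :
  sum_part (cosv T) (sinv T) (log_wt K) lam (npow delta) v m.+1 = conv_part K (1 + delta) v m.
Proof.
rewrite /sum_part /conv_part big_ltn// {1}/log_wt invr0 mulr0 mulr0 scale0r add0r.
apply: eq_big_nat => n /andP[n0 _]; congr (_ *: _).
by rewrite npow_shift// /log_wt mulrCA.
Qed.

(** Both are limits of the same partial sums. *)
Lemma conv_sum_op delta v (s1 : 1 < 1 + delta) : 0 < delta ->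
  nrm (conv_vec T0 K s1 v - zsum (npow delta) v) = 0.
Proof.
move=> d0; apply: scvg_uniq (conv_part_scvg T0 K s1 v) _.
have h := @sum_opP _ _ _ _ _ _ ES _ _ _ a0 areg d01 (npow delta) v (npow_itv (ltW d0)).
have h' := (cvg_comp _ _ (cvg_addnr 1%N) h).
rewrite /scvg; apply: cvg_trans h'; apply: near_eq_cvg; near=> m.
by rewrite /= addn1 sum_part_conv.
Unshelve. all: by end_near. Qed.

Lemma nrm_limit_unique (I : Type) (F : set_system I) {FF : ProperFilter F}
    (P : I -> L2real T) (y z : L2real T) :
  nrm (P i - y) @[i --> F] --> 0 -> nrm (P i - z) @[i --> F] --> 0 -> nrm (y - z) = 0.
Proof.
move=> Py Pz; apply/eqP; rewrite eq_le nrm_ge0 andbT.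
have h : nrm (P i - y) + nrm (P i - z) @[i --> F] --> (0 + 0 : R) by exact: cvgD.
rewrite addr0 in h; apply: (cvgr_to_ge h); near=> i.
by rewrite [nrm (P i - y)]nrmB; exact: ler_nrm_dist.
Unshelve. all: by end_near. Qed.

Lemma zeta_op_delta_sum delta g : 0 < delta -> L2 T g ->
  [/\ L2 T (zeta_op_delta K T delta g),
    null_eq (rep T (zeta_op_delta K T delta g)) (pi^-1 *: zsum (npow delta) (rep T g)) &
    null_eq (imp T (zeta_op_delta K T delta g)) (pi^-1 *: zsum (npow delta) (imp T g))].
Proof.
move=> d0 gL; have s1 : 1 < 1 + delta by rewrite ltrDl.
have zE t : D t -> _ := zeta_op_deltaE T0 K d0 s1 gL.
have [ri rn] := @toL2_eq _ T (fun t => complex.Re (zeta_op_delta K T delta g t))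
  (pi^-1 *: conv_vec T0 K s1 (rep T g)) (fun t Dt => congr1 (@complex.Re _) (zE t Dt)).
have [ii in'] := @toL2_eq _ T (fun t => complex.Im (zeta_op_delta K T delta g t))
  (pi^-1 *: conv_vec T0 K s1 (imp T g)) (fun t Dt => congr1 (@complex.Im _) (zE t Dt)).
split; first by apply/L2P.
- by apply: null_trans rn _; apply: null_scale; exact: conv_sum_op.
- by apply: null_trans in' _; apply: null_scale; exact: conv_sum_op.
Qed.

Lemma zsum_cvg v : nrm (zsum (npow delta) v - Z v) @[delta --> (0 : R)^'+] --> 0.
Proof.
apply: (sum_op_cvg ES a0 areg d01); last exact: npow_cvg1.
near=> delta => n; apply: npow_itv; apply: ltW.
by near: delta; exact: nbhs_right_gt.
Unshelve. all: by end_near. Qed.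

Lemma nrm_le_approx (x y z : L2real T) : null_eq x (pi^-1 *: y) ->
  nrm (x - pi^-1 *: z) <= pi^-1 * nrm (y - z).
Proof.
move=> xy; apply: le_trans (ler_nrm_dist _ (pi^-1 *: y) _) _.
by rewrite [nrm _]xy add0r -scalerBr nrmZ ger0_norm// invr_ge0 pi_ge0.
Qed.

Lemma zeta_op_delta_cvg g : L2 T g ->
  (nrm (rep T (zeta_op_delta K T delta g) - pi^-1 *: Z (rep T g)) @[delta --> (0 : R)^'+] --> 0) /\
  (nrm (imp T (zeta_op_delta K T delta g) - pi^-1 *: Z (imp T g)) @[delta --> (0 : R)^'+] --> 0).
Proof.
move=> gL.
have sq (P : R -> L2real T) v : (forall delta, 0 < delta -> null_eq (P delta) (pi^-1 *: zsum (npow delta) v)) ->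
    nrm (P delta - pi^-1 *: Z v) @[delta --> (0 : R)^'+] --> 0.
  move=> Pv.
  have l1 : pi^-1 * nrm (zsum (npow delta) v - Z v) @[delta --> (0 : R)^'+] --> (0 : R).
    rewrite -[X in _ --> X](mulr0 pi^-1); apply: cvgMl_tmp; exact: zsum_cvg.
  have l0 : (0 : R) @[delta --> (0 : R)^'+] --> (0 : R) by exact: cvg_cst.
  apply: (squeeze_cvgr _ l0 l1); near=> delta.
  rewrite nrm_ge0/=; apply: nrm_le_approx; apply: Pv.
  by near: delta; exact: nbhs_right_gt.
split; apply: sq => delta d0; have [_ hr hi] := zeta_op_delta_sum d0 gL.
  exact: hr.
exact: hi.
Unshelve. all: by end_near. Qed.

Lemma sqrt_sumsq_le (a b : R) : 0 <= a -> 0 <= b -> Num.sqrt (a ^+ 2 + b ^+ 2) <= a + b.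
Proof.
move=> a0' b0; rewrite -[leRHS]ger0_norm ?addr_ge0// -sqrtr_sqr ler_sqrt ?sqr_ge0//.
by rewrite sqrrD addrAC lerDl mulrn_wge0// mulr_ge0.
Qed.

Lemma sqrt_sumsq_ge (a b : R) : 0 <= a -> 0 <= b ->
  a <= Num.sqrt (a ^+ 2 + b ^+ 2) /\ b <= Num.sqrt (a ^+ 2 + b ^+ 2).
Proof.
move=> a0' b0; split.
  by rewrite -{1}(ger0_norm a0') -sqrtr_sqr ler_sqrt ?lerDl ?addr_ge0 ?sqr_ge0.
by rewrite -{1}(ger0_norm b0) -sqrtr_sqr ler_sqrt ?lerDr ?addr_ge0 ?sqr_ge0.
Qed.

Lemma L2norm_diff g h : L2 T g -> L2 T h -> L2norm T (fun t => g t - h t) =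
  (Num.sqrt (nrm (rep T g - rep T h) ^+ 2 + nrm (imp T g - imp T h) ^+ 2))%:E.
Proof.
by move=> gL hL; rewrite {1}(cvec_parts gL) {1}(cvec_parts hL) cvecB L2norm_cvec.
Qed.

(** A limit exists, given by Z on both parts; the operator is some limit, and limits
agree up to functions of norm zero. *)
Theorem zeta_op_sum g : L2 T g -> [/\ L2 T (zeta_op K T g),
  null_eq (rep T (zeta_op K T g)) (pi^-1 *: Z (rep T g)) &
  null_eq (imp T (zeta_op K T g)) (pi^-1 *: Z (imp T g))].
Proof.
move=> gL; have [rc ic] := zeta_op_delta_cvg gL.
have [hL hc] : [set h | L2 T h /\ L2norm T (fun t => zeta_op_delta K T delta g t - h t)
      @[delta --> (0 : R)^'+] --> 0%E] (zeta_op K T g).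
  rewrite /zeta_op; apply: xgetPex.
  pose h := cvec (pi^-1 *: Z (rep T g)) (pi^-1 *: Z (imp T g)).
  have hL : L2 T h by exact: L2_cvec.
  exists h; split => //.
  have lim0 : (nrm (rep T (zeta_op_delta K T delta g) - pi^-1 *: Z (rep T g)) +
    nrm (imp T (zeta_op_delta K T delta g) - pi^-1 *: Z (imp T g)))%:E
      @[delta --> (0 : R)^'+] --> 0%E.
    apply: cvg_EFin; first exact: nearW.
    have z0 : (0 : R) = 0 + 0 by rewrite addr0.
    by rewrite /= [X in _ --> X]z0; exact: (@cvgD _ _ _ _ _ _ _ _ _ rc ic).
  have l0 : (0%E : \bar R) @[delta --> (0 : R)^'+] --> (0%E : \bar R) by exact: cvg_cst.
  apply: (squeeze_cvge _ l0 lim0); near=> delta.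
  have d0 : 0 < delta by near: delta; exact: nbhs_right_gt.
  have [zL _ _] := zeta_op_delta_sum d0 gL.
  rewrite (L2norm_diff zL hL) rep_cvec imp_cvec !lee_fin sqrtr_ge0/=.
  by rewrite sqrt_sumsq_le ?nrm_ge0.
have [_ hc'] := (fine_cvgP _ _).1 hc.
have l0 : (0 : R) @[delta --> (0 : R)^'+] --> (0 : R) by exact: cvg_cst.
have near_L2norm : \forall delta \near (0 : R)^'+, [/\ 0 < delta,
    nrm (rep T (zeta_op_delta K T delta g) - rep T (zeta_op K T g)) <=
      fine (L2norm T (fun t => zeta_op_delta K T delta g t - zeta_op K T g t)) &
    nrm (imp T (zeta_op_delta K T delta g) - imp T (zeta_op K T g)) <=
      fine (L2norm T (fun t => zeta_op_delta K T delta g t - zeta_op K T g t))].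
  near=> delta; have d0 : 0 < delta by near: delta; exact: nbhs_right_gt.
  have [zL _ _] := zeta_op_delta_sum d0 gL.
  by rewrite (L2norm_diff zL hL)/=; have [] := sqrt_sumsq_ge (nrm_ge0 (rep T (zeta_op_delta K T delta g) - rep T (zeta_op K T g)))
    (nrm_ge0 (imp T (zeta_op_delta K T delta g) - imp T (zeta_op K T g))).
split => //.
- apply: (nrm_limit_unique _ rc).
  apply: (squeeze_cvgr _ l0 hc'); apply: filterS near_L2norm => delta [_ h _].
  by rewrite nrm_ge0.
- apply: (nrm_limit_unique _ ic).
  apply: (squeeze_cvgr _ l0 hc'); apply: filterS near_L2norm => delta [_ _ h].
  by rewrite nrm_ge0.
Unshelve. all: by end_near. Qed.

End ZetaOp.

(** * Operators acting in the same way on real and imaginary parts *)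

Section PartwiseOperators.
Local Open Scope complex_scope.
Context {R : realType}.
Variable T : R.
Implicit Types (u v w : L2real T) (g h : R -> R[i]) (t : R).
Variables (A : L2real T -> L2real T) (B : (R -> R[i]) -> (R -> R[i])).
Hypotheses (Alin : semi_linear A) (Abd : exists M, forall v, nrm (A v) <= M * nrm v).
Hypothesis BA : forall g, L2 T g -> [/\ L2 T (B g),
  null_eq (rep T (B g)) (A (rep T g)) & null_eq (imp T (B g)) (A (imp T g))].

Lemma semi_linear_respect u v : null_eq u v -> null_eq (A u) (A v).
Proof.
rewrite /null_eq semi_linearB// => uv; have [M AM] := Abd.
by apply/eqP; rewrite eq_le nrm_ge0 andbT (le_trans (AM _))// uv mulr0.
Qed.

Lemma L2eqP g h : L2 T g -> L2 T h ->
  L2eq T g h <-> null_eq (rep T g) (rep T h) /\ null_eq (imp T g) (imp T h).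
Proof. by move=> gL hL; rewrite {1}(cvec_parts gL) {1}(cvec_parts hL) L2eq_cvec. Qed.

Lemma L2_lin (a : R[i]) g h : L2 T g -> L2 T h -> [/\ L2 T (fun t => a * g t + h t),
  rep T (fun t => a * g t + h t) = complex.Re a *: rep T g + (- complex.Im a *: imp T g + rep T h) &
  imp T (fun t => a * g t + h t) = complex.Re a *: imp T g + (complex.Im a *: rep T g + imp T h)].
Proof.
move=> gL hL.
have E : (fun t => a * g t + h t) = cvec (complex.Re a *: rep T g - complex.Im a *: imp T g + rep T h)
    (complex.Re a *: imp T g + complex.Im a *: rep T g + imp T h).
  by rewrite -cvec_lin -(cvec_parts gL) -(cvec_parts hL).
rewrite E; split; first exact: L2_cvec.
  by rewrite rep_cvec scaleNr addrA.
by rewrite imp_cvec addrA.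
Qed.

Lemma semi_linear3 k l u v w :
  null_eq (A (k *: u + (l *: v + w))) (k *: A u + (l *: A v + A w)).
Proof.
apply: null_trans (Alin k u _) _; apply: null_add; first exact: null_refl.
exact: Alin.
Qed.

Lemma partwise_operator : L2_operator T B.
Proof.
split=> [g gL|g h gL hL|a g h gL hL]; first by have [] := BA gL.
  have [BgL Bgr Bgi] := BA gL; have [BhL Bhr Bhi] := BA hL.
  move=> /(L2eqP gL hL)[er ei]; apply/(L2eqP BgL BhL); split.
    apply: null_trans Bgr _; apply: null_trans (null_sym Bhr); exact: semi_linear_respect.
  apply: null_trans Bgi _; apply: null_trans (null_sym Bhi); exact: semi_linear_respect.
have [sL sr si] := L2_lin a gL hL.
have [BgL Bgr Bgi] := BA gL; have [BhL Bhr Bhi] := BA hL; have [BsL Bsr Bsi] := BA sL.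
have [tL tr ti] := L2_lin a BgL BhL.
apply/(L2eqP BsL tL); rewrite tr ti; rewrite sr in Bsr; rewrite si in Bsi; split.
  apply: null_trans Bsr _; apply: null_trans (semi_linear3 _ _ _ _ _) _.
  apply: null_add; first exact/null_scale/null_sym.
  by apply: null_add; [exact/null_scale/null_sym|exact: null_sym].
apply: null_trans Bsi _; apply: null_trans (semi_linear3 _ _ _ _ _) _.
apply: null_add; first exact/null_scale/null_sym.
by apply: null_add; [exact/null_scale/null_sym|exact: null_sym].
Qed.

(** A subsequence for the real parts, then a further one for the imaginary parts. *)
Lemma partwise_compact : seq_compact A -> compact_operator T B.
Proof.
move=> Acpt; split; first exact: partwise_operator.
move=> u uL [M uM].
have part_le n : nrm (rep T (u n)) <= M /\ nrm (imp T (u n)) <= M.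
  have := uM n; rewrite (L2normE (uL n)) lee_fin => h.
  have [h1 h2] := sqrt_sumsq_ge (nrm_ge0 (rep T (u n))) (nrm_ge0 (imp T (u n))).
  by split; [exact: le_trans h1 h|exact: le_trans h2 h].
have [|phi1 [h1 [lt1 cv1]]] := Acpt (fun n => rep T (u n)).
  by exists M => n; case: (part_le n).
have [|phi2 [h2 [lt2 cv2]]] := Acpt (fun n => imp T (u (phi1 n))).
  by exists M => n; case: (part_le (phi1 n)).
have cv1' : nrm (A (rep T (u (phi1 (phi2 n)))) - h1) @[n --> \oo] --> 0.
  exact: (cvg_comp _ _ (incr_cvg lt2) cv1).
exists (phi1 \o phi2), (cvec h1 h2); split.
- by move=> m n mn; apply: lt1; exact: lt2.
- exact: L2_cvec.
have lim0 : (nrm (A (rep T (u (phi1 (phi2 n)))) - h1) +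
    nrm (A (imp T (u (phi1 (phi2 n)))) - h2))%:E @[n --> \oo] --> 0%E.
  apply: cvg_EFin; first exact: nearW.
  have z0 : (0 : R) = 0 + 0 by rewrite addr0.
  by rewrite /= [X in _ --> X]z0; exact: (@cvgD _ _ _ _ _ _ _ _ _ cv1' cv2).
have l0 : (0%E : \bar R) @[n --> \oo] --> (0%E : \bar R) by exact: cvg_cst.
apply: (squeeze_cvge _ l0 lim0); near=> n.
have [BL Br Bi] := BA (uL (phi1 (phi2 n))).
rewrite (L2norm_diff BL (L2_cvec h1 h2)) rep_cvec imp_cvec (null_dist _ Br) (null_dist _ Bi).
by rewrite !lee_fin sqrtr_ge0/= sqrt_sumsq_le ?nrm_ge0.
Unshelve. all: by end_near. Qed.

Lemma partwise_L2norm g : L2 T g ->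
  L2norm T (B g) = (Num.sqrt (nrm (A (rep T g)) ^+ 2 + nrm (A (imp T g)) ^+ 2))%:E.
Proof.
by move=> gL; have [BL Br Bi] := BA gL; rewrite (L2normE BL) (null_nrm Br) (null_nrm Bi).
Qed.

Lemma partwise_below : bounded_below T B <->
  exists2 k, 0 < k & forall v, k * nrm v <= nrm (A v).
Proof.
split=> [[k k0 kB]|[k k0 kA]].
  exists k => // v; have gL := L2_cvec v 0; have := kB _ gL.
  rewrite (partwise_L2norm gL) (L2normE gL) rep_cvec imp_cvec.
  rewrite (semi_linear_null Alin) nrm0 expr0n/= !addr0 !sqrtr_sqr !ger0_norm ?nrm_ge0//.
exists k => // g gL; rewrite (partwise_L2norm gL) (L2normE gL) -EFinM lee_fin.
rewrite -[leLHS]ger0_norm ?mulr_ge0 ?sqrtr_ge0 ?(ltW k0)// -sqrtr_sqr.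
rewrite ler_sqrt ?addr_ge0 ?sqr_ge0// exprMn sqr_sqrtr ?addr_ge0 ?sqr_ge0//.
by rewrite mulrDr -!exprMn lerD// lerXn2r ?nnegrE ?mulr_ge0 ?nrm_ge0 ?(ltW k0).
Qed.

End PartwiseOperators.

(** * Identity plus compact, and the criterion for a lower bound *)

Lemma scaled_difference (R : comPzRingType) (V : lmodType R) (k p d : R) (x y u v : V) :
  k *: (p *: x - d *: u) + (p *: y - d *: v) = p *: (k *: x + y) - d *: (k *: u + v).
Proof.
rewrite scalerBr !scalerDr opprD !scalerA (mulrC k p) (mulrC k d).
by rewrite addrACA.
Qed.

Lemma scaled_sum (R : comPzRingType) (V : lmodType R) (k p : R) (x y : V) :
  k *: (p *: x) + p *: y = p *: (k *: x + y).
Proof. by rewrite scalerDr !scalerA mulrC. Qed.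

Section Criterion.
Local Open Scope complex_scope.
Context {R : realType}.
Variable T : R.
Hypothesis T0 : 0 < T.
Variables (K : set nat) (d : R).
Hypotheses (Kd : has_density K d) (d01 : 0 <= d <= 1).
Implicit Types (u v w : L2real T).

Local Notation lam := (fun n : nat => ln (n%:R : R)).
Local Notation Z := (sum_op1 (cosv T) (sinv T) (log_wt K) lam).

Let ES := trig_system T0.
Let a0 := @log_wt_ge0 R K.
Let areg := log_wt_regular Kd d01.

Lemma zeta_sum_lin : semi_linear Z.
Proof. exact: (sum_op_semi_linear ES a0 areg d01 (@unit_weight R)). Qed.

Lemma zeta_sum_bounded : exists M, forall v, nrm (Z v) <= M * nrm v.
Proof.
have [M MZ] := sum_op_bounded ES a0 areg d01.
by exists M => v; apply: MZ; exact: unit_weight.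
Qed.

(** The cosines (pi / T) n, n >= 1, are orthogonal with the same norm, so that a
compact operator is not bounded below. *)
Lemma zeta_sum_below : (exists2 k, 0 < k & forall v, k * nrm v <= nrm (Z v)) <-> 0 < d.
Proof.
have Zc := sum_op1_compact ES a0 areg d01.
have [M ZM] := zeta_sum_bounded.
split=> [below|d0].
  rewrite lt0r (andP d01).1 andbT; apply/negP => /eqP d0.
  have Zc' : seq_compact Z.
    move: Zc; rewrite d0 mul0r.
    suff -> : (fun v => Z v - 0 *: v) = Z by [].
    by apply/funext => v; rewrite scale0r subr0.
  have sT : 0 < Num.sqrt T by rewrite sqrtr_gt0.
  refine (seq_compact_not_below zeta_sum_lin (e := fun n => cosv T (pi / T * n.+1%:R))
    (M := Num.sqrt (2 * T)) Zc' _ sT _ below) => [n|m n mn].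
    by rewrite /nrm ler_sqrt ?mulr_ge0 ?(ltW T0)// cosv_le.
  rewrite -[leRHS]ger0_norm ?nrm_ge0// -sqrtr_sqr ler_sqrt ?sqr_ge0//.
  exact: cosv_separated.
apply: (identity_plus_compact_below zeta_sum_lin ZM _ Zc) => [|v Zv].
  by rewrite mulf_neq0 ?gt_eqF// pi_gt0.
apply: (exp_uniqueness ES) => B.
have [zs [X [zu zX X0 zI zk]]] := density_many_logs Kd B d0.
exists zs, X; split => // z /zk[n -> an].
exact: (sum_op1_kernel ES a0 areg d01 Zv an).
Qed.

Let A v : L2real T := pi^-1 *: Z v - d *: v.

Lemma compact_part_lin : semi_linear A.
Proof.
move=> k u v; rewrite -/(null_eq _ _) /A.
rewrite scaled_difference.
by apply: null_add; [exact/null_scale/zeta_sum_lin|exact: null_refl].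
Qed.

Lemma compact_part_bounded : exists M, forall v, nrm (A v) <= M * nrm v.
Proof.
have [M ZM] := zeta_sum_bounded; exists (pi^-1 * M + d) => v.
apply: le_trans (ler_nrmD _ _) _; rewrite nrmN !nrmZ mulrDl lerD//.
  by rewrite ger0_norm ?invr_ge0 ?pi_ge0// -mulrA ler_wpM2l ?invr_ge0 ?pi_ge0.
by rewrite ger0_norm//; case/andP: d01.
Qed.

Lemma compact_part_compact : seq_compact A.
Proof.
move=> u uM; have [phi [h [lt cv]]] := sum_op1_compact ES a0 areg d01 uM.
exists phi, (pi^-1 *: h); split => //.
have E : (fun n => A (u (phi n))) = (fun n => pi^-1 *: (Z (u (phi n)) - (d * pi) *: u (phi n))).
  apply/funext => n; rewrite /A scalerBr scalerA.
  by congr (_ - _ *: _); rewrite mulrCA mulVf ?mulr1// gt_eqF// pi_gt0.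
by rewrite E; exact: scvgZ.
Qed.

Lemma scaled_below (k : R) (Y : L2real T -> L2real T) : 0 < k ->
  (exists2 c, 0 < c & forall v, c * nrm v <= nrm (k *: Y v)) <->
  (exists2 c, 0 < c & forall v, c * nrm v <= nrm (Y v)).
Proof.
move=> k0; split=> -[c c0 cY].
  exists (c / k); rewrite ?divr_gt0// => v.
  by have := cY v; rewrite nrmZ gtr0_norm// mulrAC ler_pdivrMr// [k * _]mulrC.
exists (k * c); rewrite ?mulr_gt0// => v.
by rewrite nrmZ gtr0_norm// -mulrA ler_wpM2l// ltW.
Qed.

Lemma scaled_sum_lin : semi_linear (fun v => pi^-1 *: Z v).
Proof.
move=> k u v; rewrite -/(null_eq _ _).
rewrite scaled_sum.
exact/null_scale/zeta_sum_lin.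
Qed.

Lemma zeta_op_below : bounded_below T (zeta_op K T) <-> 0 < d.
Proof.
apply: iff_trans zeta_sum_below.
have pi0 : 0 < pi^-1 :> R by rewrite invr_gt0 pi_gt0.
apply: iff_trans (scaled_below Z pi0).
exact: (partwise_below scaled_sum_lin (fun g => zeta_op_sum T0 Kd d01 (g := g))).
Qed.

Lemma zeta_op_compact_part : compact_operator T (fun g t => zeta_op K T g t - d%:C * g t).
Proof.
apply: (partwise_compact compact_part_lin compact_part_bounded _ compact_part_compact) => g gL.
have [zL zr zi] := zeta_op_sum T0 Kd d01 gL.
have E : (fun t => zeta_op K T g t - d%:C * g t) = (fun t => (- d%:C) * g t + zeta_op K T g t).
  by apply/funext => t; rewrite mulNr addrC.
have [sL sr si] := L2_lin (- d%:C) gL zL.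
rewrite E; split => //.
  rewrite sr /= oppr0 oppr0 scale0r add0r scaleNr addrC.
  by apply: null_add => //; exact: null_refl.
rewrite si /= oppr0 scale0r add0r scaleNr addrC.
by apply: null_add => //; exact: null_refl.
Qed.

End Criterion.

(** K is the set left when sifting by the primes outside Q. *)
Lemma generated_fully_sifted (Q : set nat) : Q `<=` primes_set ->
  generated_integers Q = fully_sifted (primes_set `\` Q).
Proof.
move=> Qp; apply/seteqP; split=> n [n0 nQ]; split => // p.
  by move=> [pp nQp]; apply/negP => pn; apply: nQp; exact: nQ.
move=> pp pn; apply: contrapT => nQp.
by have := nQ p (conj pp nQp); rewrite pn.
Qed.

Lemma esum_prime_sum (R : realType) (P : set nat) :
  (\esum_(p in P) (p%:R^-1 : R)%:E < +oo)%E <-> @prime_sum_bounded R P.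
Proof.
have w0 p : (0 <= (prime_wt P p : R)%:E)%E by rewrite lee_fin /prime_wt; case: ifP.
have -> : (\esum_(p in P) (p%:R^-1 : R)%:E = \sum_(p <oo) (prime_wt P p : R)%:E)%E.
  rewrite esum_mkcond nneseries_esumT//; apply: eq_esum => p _.
  by rewrite /prime_wt; case: ifP.
have part m : (\sum_(0 <= p < m) (prime_wt P p : R)%:E = (\sum_(0 <= p < m) prime_wt P p : R)%:E)%E.
  by rewrite sumEFin.
split=> [fin|[B SB]].
  exists (fine (\sum_(p <oo) (prime_wt P p : R)%:E)) => m.
  rewrite -lee_fin fineK; last by rewrite ge0_fin_numE// nneseries_ge0.
  by rewrite -part; apply: nneseries_lim_ge.
apply: le_lt_trans (ltry B); apply: lime_le; first exact: is_cvg_nneseries.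
by apply: nearW => m; rewrite part lee_fin.
Qed.

Theorem theorem4 (R : realType) (T : R) (hT : 0 < T)
    (Q : set nat) (hQ : Q `<=` primes_set)
    (K : set nat) (hK : K = generated_integers Q)
    (J : set nat) (hJ : J = generated_integers (primes_set `\` Q)) :
  (exists Psi : (R -> R[i]) -> (R -> R[i]),
     compact_operator T Psi /\
     forall g : R -> R[i], L2 T g ->
       L2eq T (zeta_op K T g) (fun t => inv_zeta_at1 R J * g t + Psi g t)) /\
  (bounded_below T (zeta_op K T) <->
   (\esum_(p in primes_set `\` Q) (p%:R^-1 : R)%:E < +oo)%E).
Proof.
pose P := primes_set `\` Q; have Pp : P `<=` primes_set by move=> p [].
pose d := sift_density P : R.
have d01 : 0 <= d <= 1 := sift_density_itv Pp.
have Kd : has_density K d.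
  by rewrite hK generated_fully_sifted//; exact: fully_sifted_density.
split.
  exists (fun g t => zeta_op K T g t - d%:C%C * g t); split.
    exact: zeta_op_compact_part.
  move=> g gL; apply: aeW => t _.
  rewrite hJ (@inv_zeta_at1E _ Q d)//; last by rewrite -hK.
  by rewrite addrC subrK.
apply: iff_trans (zeta_op_below hT Kd d01) _.
apply: iff_trans (sift_density_gt0 Pp) _.
exact: iff_sym (esum_prime_sum _ _).
Qed.
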